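(* Fix the combinatorial structure of a quantum graph as in the context (vertices, $K\ge1$ infinite leads, $M$ finite edges). For any compact $\mathcal L\subset(0,\infty)$, compact $I\subset(0,\infty)$, $R>0$ and $\gamma<1$ there exists $\epsilon_0>0$ such that the following holds for every choice of finite-edge lengths $\ell_m\in\mathcal L$, $K+1\le m\le K+M$: if there exist $u\in\mathcal H_R\cap\mathcal D(P)$ and $\lambda_0\in I$ with $\|u\|_{L^2}=1$ and $\|(P-\lambda_0^2)u\|=\epsilon<\epsilon_0$, then \[ \operatorname{Res}(P)\cap D(\lambda_0,\epsilon^\gamma)\neq\emptyset, \] where $D(\lambda_0,r)=\{\lambda\in\mathbb C:|\lambda-\lambda_0|<r\}$.
   Context: The graph has vertices $v_1,\dots,v_J$, $K\ge1$ infinite leads $e_1,\dots,e_K$, each identified with $[0,\infty)$ with its unique vertex at $x=0$, and $M$ finite edges $e_{K+1},\dots,e_{K+M}$, $e_m$ identified with $[0,\ell_m]$ and having two distinct vertices as endpoints. $L^2=\bigoplus_{m=1}^{K+M}L^2([0,\ell_m])$ ($\ell_k=\infty$ for leads). $P$ acts by $(Pu)_m=-u_m''$ with domain $\mathcal D(P)$: $u_m\in H^2([0,\ell_m])$, $u$ continuous at each vertex ($u_m(v)=u_\ell(v)$ for common vertices), and $\sum_{e_m\ni v}\partial_\nu u_m(v)=0$ at every vertex, with $\partial_\nu u_m(0)=-u_m'(0)$, $\partial_\nu u_m(\ell_m)=u_m'(\ell_m)$. $\operatorname{Res}(P)$ is the set of poles of the meromorphic continuation of $\lambda\mapsto(P-\lambda^2)^{-1}$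 from $\operatorname{Im}\lambda>0$ to $\mathbb C$ as an operator $L^2_{\mathrm{comp}}\to L^2_{\mathrm{loc}}$. $\mathcal H_R:=\bigoplus_{m=1}^K L^2([0,R])\oplus\bigoplus_{m=K+1}^{K+M}L^2([0,\ell_m])$, viewed as the subspace of $L^2$ of functions vanishing on the leads for $x>R$.
   Formalization: The formal theorem assumes ε > 0; for ε = 0 (an exact compactly supported eigenfunction) and 0 < γ < 1 the disc D(λ₀, ε^γ) is empty, so the claim as written fails there. *)

(* Defs.v *)
From HB Require Import structures.
From mathcomp Require Import all_boot all_order all_algebra.
From mathcomp Require Import complex.
From mathcomp Require Import all_classical all_reals all_analysis.
Set Implicit Arguments.
Unset Strict Implicit.
Unset Printing Implicit Defensive.
Import Order.TTheory GRing.Theory Num.Theory.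
Import numFieldNormedType.Exports.
Local Open Scope classical_set_scope.
Local Open Scope ring_scope.

(* Complex numbers, as a numFieldType (hence a normed module over itself,
   so that [derivable h z 1] is complex differentiability). *)
Definition Cx (R : realType) : numFieldType := (R[i] : numFieldType).

Section QuantumGraph.
Variable R : realType.
Local Notation C := (Cx R).
Local Notation mu := (@lebesgue_measure R).

Definition sqmod (z : C) : R := complex.Re z ^+ 2 + complex.Im z ^+ 2.
Definition absC (z : C) : R := Num.sqrt (sqmod z).

Definition Cint (D : set R) (f : R -> C) : C :=
  Complex (Rintegral mu D (fun x => complex.Re (f x)))
          (Rintegral mu D (fun x => complex.Im (f x))).

Definition sqint (D : set R) (f : R -> C) : Prop :=
  [/\ measurable_fun D (fun x => complex.Re (f x)),
      measurable_fun D (fun x => complex.Im (f x)) &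
      (\int[mu]_(x in D) (sqmod (f x))%:E < +oo)%E].

(* u in H^2(D), D = [0,l] or [0,oo), with u' = v (continuous) and
   u'' = w (in L^2): u and v are absolutely continuous primitives. *)
Definition H2on (D : set R) (u v w : R -> C) : Prop :=
  [/\ sqint D u, sqint D v, sqint D w,
      (forall x, D x -> u x = u 0 + Cint [set y | 0 <= y <= x] v) &
      (forall x, D x -> v x = v 0 + Cint [set y | 0 <= y <= x] w)].

(* Combinatorial data: J vertices, K leads (edges 0..K-1), M finite edges
   (edges K..K+M-1).  v0 m : vertex at x = 0 of edge m;
   v1 m : vertex at x = l_m of a finite edge m (ignored for leads). *)
Variables (J K M : nat) (v0 v1 : 'I_(K + M) -> 'I_J).
Local Notation E := 'I_(K + M).

Definition isLead (m : E) : bool := (m < K)%N.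

(* lengths: l m is used only for finite edges *)
Variable l : E -> R.

Definition edom (m : E) : set R :=
  if isLead m then [set x | 0 <= x] else [set x | 0 <= x <= l m].

(* edge endpoints: (m, false) is x = 0, (m, true) is x = l_m
   (the latter only for finite edges) *)
Definition validEnd (p : E * bool) : bool := ~~ p.2 || ~~ isLead p.1.
Definition vertexOf (p : E * bool) : 'I_J := if p.2 then v1 p.1 else v0 p.1.
Definition posOf (p : E * bool) : R := if p.2 then l p.1 else 0.
(* outward normal derivative at the endpoint, given u' = v *)
Definition dnu (v : E -> R -> C) (p : E * bool) : C :=
  if p.2 then v p.1 (l p.1) else - v p.1 0.

(* u in D(P) with second derivative w, so that P u = - w. *)
Definition inDP (u w : E -> R -> C) : Prop :=
  exists v : E -> R -> C,
  [/\ (forall m, H2on (edom m) (u m) (v m) (w m)),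
      (forall p q : E * bool, validEnd p -> validEnd q ->
         vertexOf p = vertexOf q -> u p.1 (posOf p) = u q.1 (posOf q)) &
      (forall j : 'I_J,
         \sum_(p : E * bool | validEnd p && (vertexOf p == j)) dnu v p = 0)].

Definition L2norm (f : E -> R -> C) : R :=
  Num.sqrt (\sum_(m : E) Rintegral mu (edom m) (fun x => sqmod (f m x))).

Definition inHR (Rr : R) (u : E -> R -> C) : Prop :=
  forall m : E, isLead m -> forall x, Rr < x -> u m x = 0.

Definition L2comp (f : E -> R -> C) : Prop :=
  (forall m, sqint (edom m) (f m)) /\ exists Rr : R, inHR Rr f.

Definition L2loc (f : E -> R -> C) : Prop :=
  forall (m : E) (r : R), sqint (edom m `&` [set x | x <= r]) (f m).

Definition pairing (a b : E -> R -> C) : C :=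
  \sum_(m : E) Cint (edom m) (fun x => a m x * conjc (b m x)).

Definition solves (z : C) (f u : E -> R -> C) : Prop :=
  exists w, inDP u w /\
    forall m : E, {ae mu, forall x, edom m x -> - w m x - z ^+ 2 * u m x = f m x}.

(* lam in Res(P): lam lies in the (closed, discrete) exceptional set S of
   every meromorphic continuation F of the resolvent z |-> (P - z^2)^{-1}
   from Im z > 0 to C, as a family L^2_comp -> L^2_loc holomorphic (weakly,
   i.e. all matrix elements <F z f, g>, f g in L^2_comp) on C \ S.
   Equivalently, lam is a pole of the meromorphic continuation. *)
Definition isResonance (lam : C) : Prop :=
  forall (S : set C) (F : C -> (E -> R -> C) -> (E -> R -> C)),
    (forall z : C, exists2 r : R, 0 < r &
        forall y, S y -> absC (y - z) < r -> y = z) ->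
    (forall f, L2comp f -> forall z, ~ S z -> L2loc (F z f)) ->
    (forall f g, L2comp f -> L2comp g -> forall z, ~ S z ->
        derivable (fun y : C => pairing (F y f) g) z 1) ->
    (forall f, L2comp f -> forall z : C, 0 < complex.Im z -> ~ S z ->
        forall u, solves z f u -> forall g, L2comp g ->
        pairing (F z f) g = pairing u g) ->
    S lam.

End QuantumGraph.

(* Main.v *)
Require Import Defs.
From HB Require Import structures.
From mathcomp Require Import all_boot all_order all_algebra.
From mathcomp Require Import complex perm.
From mathcomp Require Import ring lra.
From mathcomp Require Import all_classical all_reals all_analysis.
From mathcomp Require Import measurable_realfun.
Set Implicit Arguments.
Unset Strict Implicit.
Unset Printing Implicit Defensive.
Import Order.TTheory GRing.Theory Num.Theory.
Import numFieldNormedType.Exports.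
Local Open Scope classical_set_scope.
Local Open Scope ring_scope.

Arguments Cx R : simpl never.

Local Notation Re := complex.Re.
Local Notation Im := complex.Im.
Local Notation borel := (@measurable _ (measurableTypeR _)).

(**
On each edge a solution of [- u'' = z^2 u] is a sum of two waves.  Collect the
amplitudes leaving the vertices in a vector [a]: propagation multiplies them by
[e^(i z l)], the leads return nothing, and the Kirchhoff conditions amount to the
scattering matrix [2/d - delta] at each vertex, a contraction.  Hence the wave
condition reads [T(z) a = 0] with [T(z) = 1 - S D(z)], where [D(z)] is diagonal with
entries [e^(i z l)] (those of the leads being absorbed in [S]).

A quasimode at [lam0] gives [a] with [T(lam0) a = O(eps)] and [|a| >= c].  Suppose
[det T] has no zero in the disc of radius [rho], about [eps^gamma].  Comparing [det T]
with the polynomial obtained by Taylor expansion of the exponentials yields a square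
contour of half-side comparable to [rho] on which [|det T| >= c rho^n], while for
[Im z > 0] the Neumann series gives [|T(z)^-1| <= C / Im z].  The maximum principle
for [T(z)^-1 T(lam0) a] times [exp (Lam (- i w - w^2/2))], [w = (z - lam0)/r], on the
rectangle cut at height [r/Lam], with [Lam] a small negative power of [eps],
contradicts [|a| >= c].

A zero [z1 != 0] of [det T] is a resonance.  Otherwise, for a source
[x |-> e^(i kap x)] on one finite edge, the amplitudes of the outgoing solution can
be read off from its pairings with indicator functions, so the identity theorem
extends the linear system they satisfy from [Im z > 0] to [z1]; then a left null
vector of [T(z1)] annihilates all right-hand sides, which forces it to vanish for
suitable [kap].

The maximum principle and the identity theorem are needed for functions that are
only assumed complex differentiable; they are derived from Goursat's theorem on
rectangles, which rests on compactness by repeated quartering.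
*)

(** On the contour [T(z)^-1] is only known to be [O(rho^-n)], far too large to be paid for by one
    factor [eps]. The exponential factor has real exponent at most [- Lam/5] on the three sides
    taken from the contour, which beats every power of [eps]; on the top side the exponent stays
    below 2 and the Neumann series costs [Lam/rho]. With [rho = eps^g / 2] and
    [Lam = eps^(-(1-g)/2)] the total is a multiple of [eps^((1-g)/2)]: this is where the exponent
    must be below 1. Taking [g = max(gam, 1/2)] covers small and negative [gam], and keeps the zero
    away from 0.

    Uniformity in the lengths comes from using [S] only as a contraction: all constants depend on
    the size of the matrix and on bounds for the lengths. The polynomial enters because values of a
    polynomial at two nearby points can be compared knowing only how many roots it has, wherever
    they lie. *)

Section ComplexModulus.
Variable R : realType.
Local Notation C := (Cx R).
Implicit Types (z w : C) (x y : R).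

(** The norm of [C] takes its values in [C]; through this embedding all estimates are moved to the
    real-valued [absC], where [lra] and [nra] apply. *)
Definition rc x : C := Complex x 0.
Definition ic : C := Complex 0 1.

Lemma absCE z : `|z| = rc (absC z). Proof. exact: normc_def. Qed.

Lemma rcD x y : rc (x + y) = rc x + rc y. Proof. by apply/eqP; rewrite eq_complex /= addr0 !eqxx. Qed.
Lemma rcM x y : rc (x * y) = rc x * rc y.
Proof. by apply/eqP; rewrite eq_complex /= !mulr0 !mul0r subr0 addr0 !eqxx. Qed.
Lemma rcN x : rc (- x) = - rc x. Proof. by apply/eqP; rewrite eq_complex /= oppr0 !eqxx. Qed.
Lemma rc_inj : injective rc. Proof. by move=> x y []. Qed.
Lemma rc0 : rc 0 = 0. Proof. by []. Qed.
Lemma rc1 : rc 1 = 1. Proof. by []. Qed.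
Lemma rcV x : rc x^-1 = (rc x)^-1.
Proof.
have [->|x0] := eqVneq x 0; first by rewrite rc0 !invr0.
have rx0 : rc x != 0 by rewrite -rc0 (inj_eq rc_inj).
by apply: (mulfI rx0); rewrite -rcM !mulfV.
Qed.
Lemma rcX x n : rc (x ^+ n) = rc x ^+ n.
Proof. by elim: n => [//|n IH]; rewrite !exprS rcM IH. Qed.

Lemma lerc x y : (rc x <= rc y) = (x <= y). Proof. exact: lecR. Qed.
Lemma ltrc x y : (rc x < rc y) = (x < y). Proof. exact: ltcR. Qed.

Lemma ReD z w : Re (z + w) = Re z + Re w.
Proof. by case: z; case: w. Qed.
Lemma ImD z w : Im (z + w) = Im z + Im w.
Proof. by case: z; case: w. Qed.
Lemma ReN z : Re (- z) = - Re z. Proof. by case: z. Qed.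
Lemma ImN z : Im (- z) = - Im z. Proof. by case: z. Qed.
Lemma ReM z w : Re (z * w) = Re z * Re w - Im z * Im w.
Proof. by case: z; case: w. Qed.
Lemma ImM z w : Im (z * w) = Re z * Im w + Im z * Re w.
Proof. by case: z; case: w. Qed.

Lemma cplx_eq z w : Re z = Re w -> Im z = Im w -> z = w.
Proof. by case: z => a b; case: w => c d /= -> ->. Qed.

Lemma sqr_ic : ic * ic = -1.
Proof. by apply: cplx_eq; rewrite ?ReM ?ImM /=; ring. Qed.

Lemma absC_ge0 z : 0 <= absC z. Proof. exact: sqrtr_ge0. Qed.
Lemma absC0 : absC (0 : C) = 0. Proof. by apply: rc_inj; rewrite -absCE normr0. Qed.
Lemma absC1 : absC (1 : C) = 1. Proof. by apply: rc_inj; rewrite -absCE normr1. Qed.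
Lemma absC_eq0 z : (absC z == 0) = (z == 0).
Proof. by rewrite -(inj_eq rc_inj) -absCE normr_eq0. Qed.
Lemma absC_gt0 z : (0 < absC z) = (z != 0).
Proof. by rewrite lt_neqAle absC_ge0 andbT eq_sym absC_eq0. Qed.
Lemma absCM z w : absC (z * w) = absC z * absC w.
Proof. by apply: rc_inj; rewrite rcM -!absCE normrM. Qed.
Lemma absCD z w : absC (z + w) <= absC z + absC w.
Proof. by rewrite -lerc rcD -!absCE ler_normD. Qed.
Lemma absCN z : absC (- z) = absC z.
Proof. by apply: rc_inj; rewrite -!absCE normrN. Qed.
Lemma absCB z w : absC (z - w) <= absC z + absC w.
Proof. by rewrite -(absCN w) absCD. Qed.
Lemma absCC z w : absC (z - w) = absC (w - z).
Proof. by rewrite -absCN opprB. Qed.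
Lemma absCV z : absC z^-1 = (absC z)^-1.
Proof. by apply: rc_inj; rewrite rcV -!absCE normfV. Qed.
Lemma absCX z n : absC (z ^+ n) = absC z ^+ n.
Proof. by apply: rc_inj; rewrite rcX -!absCE normrX. Qed.
Lemma absC_sub z w : absC z - absC w <= absC (z - w).
Proof. by rewrite lerBlDr; apply: le_trans (absCD _ _); rewrite subrK. Qed.
Lemma absC_rc x : absC (rc x) = `|x|.
Proof. by rewrite /absC /sqmod /= expr0n addr0 sqrtr_sqr. Qed.
Lemma absC_ic : absC ic = 1.
Proof. by rewrite /absC /sqmod /= expr0n add0r expr1n sqrtr1. Qed.
Lemma sqmodE z : sqmod z = absC z ^+ 2.
Proof. by rewrite /absC sqr_sqrtr // addr_ge0 // sqr_ge0. Qed.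
Lemma absC_Re z : `|Re z| <= absC z.
Proof. by rewrite -sqrtr_sqr ler_wsqrtr // lerDl sqr_ge0. Qed.
Lemma absC_Im z : `|Im z| <= absC z.
Proof. by rewrite -sqrtr_sqr ler_wsqrtr // lerDr sqr_ge0. Qed.
Lemma absC_le_ReIm z : absC z <= `|Re z| + `|Im z|.
Proof.
have -> : z = rc (Re z) + ic * rc (Im z).
  by apply: cplx_eq; rewrite ?ReD ?ImD ?ReM ?ImM /=; ring.
apply: le_trans (absCD _ _) _.
by rewrite absCM absC_ic mul1r !absC_rc ReD ImD !ReM !ImM /= !mul0r !mulr0 !mul1r !subr0 !addr0 !add0r.
Qed.
Lemma absC_sum (I : Type) (r : seq I) (P : pred I) (F : I -> C) :
  absC (\sum_(i <- r | P i) F i) <= \sum_(i <- r | P i) absC (F i).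
Proof.
elim/big_rec2 : _ => [|i y x _ IH]; first by rewrite absC0.
by apply: le_trans (absCD _ _) _; rewrite lerD2l.
Qed.
Lemma absC_prod (I : Type) (r : seq I) (P : pred I) (F : I -> C) :
  absC (\prod_(i <- r | P i) F i) = \prod_(i <- r | P i) absC (F i).
Proof. by elim/big_rec2 : _ => [|i y x _ <-]; rewrite ?absC1 ?absCM. Qed.

End ComplexModulus.

(** * Complex differentiability in real epsilon-delta form *)

Section ComplexDifferentiability.
Variable R : realType.
Local Notation C := (Cx R).
Implicit Types (f g : C -> C) (z w : C).

Definition ccontAt f z := forall e : R, 0 < e ->
  exists2 d : R, 0 < d & forall w, absC (w - z) < d -> absC (f w - f z) <= e.

(** The first-order expansion equivalent to [derivable f z 1]; being free of quotients, it needs no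
    separate treatment of [w = z]. *)
Definition cdiff f z := exists l : C, forall e : R, 0 < e ->
  exists2 d : R, 0 < d & forall w, absC (w - z) < d ->
    absC (f w - f z - l * (w - z)) <= e * absC (w - z).

Lemma gt0_rc (e : C) : 0 < e -> exists2 x : R, 0 < x & e = rc x.
Proof.
move=> e0; exists (Re e).
  by move: e0; rewrite ltcE /= => /andP[].
by apply: cplx_eq => //=; apply: ger0_Im; exact: ltW.
Qed.

Lemma derivable_cdiff f z : derivable f z 1 -> cdiff f z.
Proof.
move=> /cvg_ex[l fl]; exists l => e e0.
have /cvgrPdist_lt H := fl.
have e0' : (0 : C) < rc e by rewrite -[X in X < _]rc0 ltrc.
have := H _ e0'.
move=> /nbhs_ballP[d d0 dP].
have [x x0 dx] := gt0_rc d0; exists x => // w wz.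
have [->|wz0] := eqVneq w z.
  by rewrite !subrr mulr0 subr0 absC0 mulr0.
have wz0' : w - z != 0 by rewrite subr_eq0.
have := dP (w - z); rewrite /ball /= sub0r normrN dx absCE ltrc => /(_ wz wz0').
rewrite absCE ltrc.
have -> : (w - z) *: 1 + z = w by rewrite /GRing.scale /= mulr1 subrK.
move=> /ltW h.
have -> : f w - f z - l * (w - z) = - ((l - (w - z)^-1 *: (f w - f z)) * (w - z)).
  by rewrite mulrBl /GRing.scale /= mulrAC mulVf // mul1r opprB.
by rewrite absCN absCM ler_wpM2r // absC_ge0.
Qed.

Lemma cdiff_derivable f z : cdiff f z -> derivable f z 1.
Proof.
move=> [l fl]; apply/cvg_ex; exists l.
apply/cvgrPdist_le => e0 /gt0_rc [e epos ->].
have [d d0 dP] := fl _ epos.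
apply/nbhs_ballP; exists (rc d).
  by rewrite /= -[X in X < _]rc0 ltrc.
move=> h; rewrite /ball /= sub0r normrN absCE ltrc => hd h0.
have := dP (h + z); rewrite addrK => /(_ hd) H.
rewrite absCE lerc.
have -> : h *: 1 + z = h + z by rewrite /GRing.scale /= mulr1.
have -> : l - h^-1 *: (f (h + z) - f z) = - ((f (h + z) - f z - l * h) * h^-1).
  by rewrite /GRing.scale /= mulrBl mulfK // opprB mulrC.
by rewrite absCN absCM absCV ler_pdivrMr // absC_gt0.
Qed.

Lemma cdiff_local f g z (d : R) : 0 < d ->
  (forall w, absC (w - z) < d -> f w = g w) -> cdiff f z -> cdiff g z.
Proof.
move=> d0 fg [l fl]; exists l => e e0; have [d' d'0 H] := fl e e0.
exists (Num.min d d'); first by rewrite lt_min d0.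
move=> w; rewrite lt_min => /andP[w1 w2].
by rewrite -fg // -(fg z) ?subrr ?absC0 //; exact: H.
Qed.

Lemma cdiff_cont f z : cdiff f z -> ccontAt f z.
Proof.
move=> [l /(_ 1 ltr01)[d d0 H]] e e0.
pose K := 1 + absC l; have K0 : 0 < K by rewrite ltr_wpDr // absC_ge0.
exists (Num.min d (e / K)); first by rewrite lt_min d0 divr_gt0.
move=> w; rewrite lt_min => /andP[w1 w2].
have -> : f w - f z = (f w - f z - l * (w - z)) + l * (w - z) by rewrite subrK.
apply: le_trans (absCD _ _) _; rewrite absCM.
apply: (@le_trans _ _ (K * absC (w - z))).
  by rewrite mulrDl lerD2r; exact: H.
by rewrite mulrC -ler_pdivlMr // ltW.
Qed.

Lemma cdiffD f g z : cdiff f z -> cdiff g z -> cdiff (fun w => f w + g w) z.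
Proof.
by move=> /cdiff_derivable hf /cdiff_derivable hg; apply: derivable_cdiff; exact: derivableD.
Qed.
Lemma cdiffN f z : cdiff f z -> cdiff (fun w => - f w) z.
Proof. by move=> /cdiff_derivable hf; apply: derivable_cdiff; exact: derivableN. Qed.
Lemma cdiffB f g z : cdiff f z -> cdiff g z -> cdiff (fun w => f w - g w) z.
Proof. by move=> hf hg; apply: cdiffD => //; exact: cdiffN. Qed.
Lemma cdiffM f g z : cdiff f z -> cdiff g z -> cdiff (fun w => f w * g w) z.
Proof.
by move=> /cdiff_derivable hf /cdiff_derivable hg; apply: derivable_cdiff; exact: derivableM.
Qed.
Lemma cdiff_cst (a : C) z : cdiff (fun=> a) z.
Proof. by apply: derivable_cdiff; exact: derivable_cst. Qed.
Lemma cdiff_id z : cdiff id z.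
Proof. by apply: derivable_cdiff; exact: derivable_id. Qed.
Lemma cdiffV f z : cdiff f z -> f z != 0 -> cdiff (fun w => (f w)^-1) z.
Proof.
move=> /cdiff_derivable hf f0; apply: derivable_cdiff; exact: derivableV.
Qed.
Lemma cdiffX f n z : cdiff f z -> cdiff (fun w => f w ^+ n) z.
Proof.
move=> hf; elim: n => [|n IH]; first exact: cdiff_cst.
by under eq_fun do rewrite exprS; exact: cdiffM.
Qed.
Lemma cdiff_sum (I : Type) (r : seq I) (P : pred I) (F : I -> C -> C) z :
  (forall i, cdiff (F i) z) -> cdiff (fun w => \sum_(i <- r | P i) F i w) z.
Proof.
move=> hF; elim: r => [|i r IH].
  by under eq_fun do rewrite big_nil; exact: cdiff_cst.
under eq_fun do rewrite big_cons.
by case: (P i) => //; exact: cdiffD.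
Qed.
Lemma cdiff_prod (I : Type) (r : seq I) (P : pred I) (F : I -> C -> C) z :
  (forall i, cdiff (F i) z) -> cdiff (fun w => \prod_(i <- r | P i) F i w) z.
Proof.
move=> hF; elim: r => [|i r IH].
  by under eq_fun do rewrite big_nil; exact: cdiff_cst.
under eq_fun do rewrite big_cons.
by case: (P i) => //; exact: cdiffM.
Qed.

End ComplexDifferentiability.

(** * Compactness of rectangles by repeated quartering *)

Section Cousin.
Variable R : realType.

Definition inrect (a b c d : R) (z : Cx R) : bool :=
  (a <= Re z <= b) && (c <= Im z <= d).

Let rect := (R * R * (R * R))%type.

Lemma nested_sup (u v : nat -> R) : (forall n m, u n <= v m) ->
  exists x, forall n, u n <= x <= v n.
Proof.
move=> uv; exists (sup (range u)) => n; apply/andP; split.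
  apply: sup_upper_bound; last by exists n.
  by split; [exists (u 0%N), 0%N | exists (v 0%N) => _ [m _ <-]].
by apply: ge_sup; [exists (u 0%N), 0%N | move=> _ [m _ <-]].
Qed.

(** A rectangle on which [P] fails has a failing quarter; iterating, failing rectangles shrink to a
    point, where the local hypothesis is contradicted. It serves as an induction principle for
    Goursat's theorem, for boundedness and for avoiding a discrete set. *)
Lemma rect_cousin (P : R -> R -> R -> R -> Prop) a b c d :
  a <= b -> c <= d ->
  (forall a b c d, a <= b -> c <= d ->
     let x := (a + b) / 2 in let y := (c + d) / 2 in
     P a x c y -> P x b c y -> P a x y d -> P x b y d -> P a b c d) ->
  (forall z, inrect a b c d z -> exists2 e : R, 0 < e &
     forall a' b' c' d', a <= a' -> a' <= b' -> b' <= b ->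
       c <= c' -> c' <= d' -> d' <= d -> inrect a' b' c' d' z ->
       (b' - a') + (d' - c') < e -> P a' b' c' d') ->
  P a b c d.
Proof.
move=> ab cd Pq Ploc; apply: contrapT => nP.
pose bad (q : rect) := [/\ q.1.1 <= q.1.2, q.2.1 <= q.2.2 & ~ P q.1.1 q.1.2 q.2.1 q.2.2].
(* The implication stands under the existential so that [choice] yields a total function on
   rectangles. *)
have step (q : rect) : exists q' : rect, bad q ->
   [/\ bad q', q.1.1 <= q'.1.1, q'.1.2 <= q.1.2,
     q.2.1 <= q'.2.1 & q'.2.2 <= q.2.2] /\
    q'.1.2 - q'.1.1 + (q'.2.2 - q'.2.1) = (q.1.2 - q.1.1 + (q.2.2 - q.2.1)) / 2.
  case: q => [[a0 b0] [c0 d0]].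
  have [bq|] := pselect (bad (a0, b0, (c0, d0))); last first.
    by move=> nb; exists (a0, b0, (c0, d0)).
  have [/= h1 h2 h3] := bq.
  pose x := (a0 + b0) / 2; pose y := (c0 + d0) / 2.
  have [a0x xb0 c0y yd0] : [/\ a0 <= x, x <= b0, c0 <= y & y <= d0].
    by rewrite /x /y; split; lra.
  have : ~ (P a0 x c0 y /\ P x b0 c0 y /\ P a0 x y d0 /\ P x b0 y d0).
    by move=> [q1 [q2 [q3 q4]]]; apply: h3; exact: Pq.
  move=> /not_andP[k|/not_andP[k|/not_andP[k|k]]].
  - by exists (a0, x, (c0, y)) => _; split; [split=> //=|rewrite /= /x /y; field].
  - by exists (x, b0, (c0, y)) => _; split; [split=> //=|rewrite /= /x /y; field].
  - by exists (a0, x, (y, d0)) => _; split; [split=> //=|rewrite /= /x /y; field].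
  - by exists (x, b0, (y, d0)) => _; split; [split=> //=|rewrite /= /x /y; field].
have [f fP] := choice step.
pose s n := iter n f (a, b, (c, d)).
have sbad n : bad (s n).
  by elim: n => [//|n IH]; have [[]] := fP _ IH.
have sS n : [/\ (s n).1.1 <= (s n.+1).1.1, (s n.+1).1.2 <= (s n).1.2,
     (s n).2.1 <= (s n.+1).2.1 & (s n.+1).2.2 <= (s n).2.2].
  by have [[]] := fP _ (sbad n).
have mono (u : nat -> R) : (forall n, u n <= u n.+1) -> forall n k, u n <= u (n + k)%N.
  by move=> uS n; elim=> [|k IH]; rewrite ?addn0 // addnS; exact: le_trans (uS _).
have cross (u v : nat -> R) : (forall n, u n <= u n.+1) -> (forall n, v n.+1 <= v n) ->
    (forall n, u n <= v n) -> forall n m, u n <= v m.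
  move=> uS vS uv n m.
  have h1 := mono _ uS n m.
  have h2 := mono (fun k => - v k) (fun k => ltac:(by rewrite lerN2)) m n.
  by rewrite (le_trans h1) // (le_trans (uv _)) // -lerN2 addnC.
have [x xP] := nested_sup (cross (fun n => (s n).1.1) (fun n => (s n).1.2)
  (fun n => ltac:(by have [] := sS n)) (fun n => ltac:(by have [] := sS n))
  (fun n => ltac:(by have [] := sbad n))).
have [y yP] := nested_sup (cross (fun n => (s n).2.1) (fun n => (s n).2.2)
  (fun n => ltac:(by have [] := sS n)) (fun n => ltac:(by have [] := sS n))
  (fun n => ltac:(by have [] := sbad n))).
have sw n : (s n).1.2 - (s n).1.1 + ((s n).2.2 - (s n).2.1) = (b - a + (d - c)) / 2 ^+ n.
  elim: n => [|n IH]; first by rewrite expr0 divr1.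
  by have [_ ->] := fP _ (sbad n); rewrite IH exprS invfM mulrA mulrAC.
have [e e0 H] := Ploc (Complex x y) (introT andP (conj (xP 0%N) (yP 0%N))).
pose n := Num.Def.archi_bound ((b - a + (d - c)) / e).
have hn : (b - a + (d - c)) / e < 2 ^+ n by exact: upper_nthrootP.
have [h1 h2 h3] := sbad n; apply: h3.
have inc (u : nat -> R) : (forall n, u n <= u n.+1) -> u 0%N <= u n.
  by move=> uS; have := mono _ uS 0%N n.
apply: H => //.
- by apply: (inc (fun n => (s n).1.1)) => k; have [] := sS k.
- by rewrite -lerN2; apply: (inc (fun n => - (s n).1.2)) => k; have [_ h _ _] := sS k; rewrite lerN2.
- by apply: (inc (fun n => (s n).2.1)) => k; have [] := sS k.
- by rewrite -lerN2; apply: (inc (fun n => - (s n).2.2)) => k; have [_ _ _ h] := sS k; rewrite lerN2.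
- by apply/andP; split; [exact: xP|exact: yP].
- by rewrite sw ltr_pdivrMr ?exprn_gt0 // mulrC -ltr_pdivrMr.
Qed.

End Cousin.

(** * Integrals of complex functions of a real variable *)

Section ComplexIntegral.
Variable R : realType.
Local Notation C := (Cx R).
Local Notation mu := (@lebesgue_measure R).
Implicit Types (g : R -> C) (D : set R).

Definition cintegrable D g :=
  mu.-integrable D (EFin \o (fun x => Re (g x))) /\
  mu.-integrable D (EFin \o (fun x => Im (g x))).

Lemma measurable_seg (a b : R) : borel [set y : R | a <= y <= b].
Proof. by rewrite -set_itvcc. Qed.

Lemma integrable_lin (D : set R) (f1 f2 : R -> R) (k1 k2 : R) : borel D ->
  mu.-integrable D (EFin \o f1) -> mu.-integrable D (EFin \o f2) ->
  mu.-integrable D (EFin \o (fun x => k1 * f1 x + k2 * f2 x)).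
Proof.
move=> mD i1 i2.
have -> : EFin \o (fun x => k1 * f1 x + k2 * f2 x) =
   ((fun x => (k1%:E * (EFin \o f1) x)%E) \+ (fun x => (k2%:E * (EFin \o f2) x)%E))%E.
  by apply/funext => x.
by apply: integrableD => //; exact: integrableZl.
Qed.

Lemma integrable_add (D : set R) (f1 f2 : R -> R) : borel D ->
  mu.-integrable D (EFin \o f1) -> mu.-integrable D (EFin \o f2) ->
  mu.-integrable D (EFin \o (fun x => f1 x + f2 x)).
Proof.
move=> mD i1 i2.
have -> : EFin \o (fun x => f1 x + f2 x) = ((EFin \o f1) \+ (EFin \o f2))%E.
  by apply/funext => x.
exact: integrableD.
Qed.

Lemma Rintegral_lin (D : set R) (f1 f2 : R -> R) (k1 k2 : R) : borel D ->
  mu.-integrable D (EFin \o f1) -> mu.-integrable D (EFin \o f2) ->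
  Rintegral mu D (fun x => k1 * f1 x + k2 * f2 x) =
  k1 * Rintegral mu D f1 + k2 * Rintegral mu D f2.
Proof.
move=> mD i1 i2; rewrite RintegralD ?RintegralZl //.
- by have := integrableZl mD k1 i1.
- by have := integrableZl mD k2 i2.
Qed.

Lemma cintegrableZ D (k : C) g : borel D -> cintegrable D g ->
  cintegrable D (fun x => k * g x).
Proof.
move=> mD [i1 i2]; split.
- under eq_fun do rewrite /= ReM -mulNr.
  exact: integrable_lin.
- under eq_fun do rewrite /= ImM.
  exact: integrable_lin.
Qed.

Lemma CintZ D (k : C) g : borel D -> cintegrable D g ->
  Cint D (fun x => k * g x) = k * Cint D g.
Proof.
move=> mD [i1 i2]; apply: cplx_eq; rewrite ?ReM ?ImM /=.
- under eq_Rintegral do rewrite ReM -mulNr.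
  by rewrite Rintegral_lin // mulNr.
- under eq_Rintegral do rewrite ImM.
  by rewrite Rintegral_lin.
Qed.

Lemma cintegrableD D g1 g2 : borel D -> cintegrable D g1 -> cintegrable D g2 ->
  cintegrable D (fun x => g1 x + g2 x).
Proof.
move=> mD [i1 i2] [j1 j2]; split.
- under eq_fun do rewrite /= ReD.
  exact: integrable_add.
- under eq_fun do rewrite /= ImD.
  exact: integrable_add.
Qed.

Lemma CintD D g1 g2 : borel D -> cintegrable D g1 -> cintegrable D g2 ->
  Cint D (fun x => g1 x + g2 x) = Cint D g1 + Cint D g2.
Proof.
move=> mD [i1 i2] [j1 j2]; apply: cplx_eq; rewrite ?ReD ?ImD /=.
- under eq_Rintegral do rewrite ReD.
  exact: RintegralD.
- under eq_Rintegral do rewrite ImD.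
  exact: RintegralD.
Qed.

Lemma cintegrableN D g : borel D -> cintegrable D g ->
  cintegrable D (fun x => - g x).
Proof. by move=> mD ig; under eq_fun do rewrite -mulN1r; exact: cintegrableZ. Qed.

Lemma CintN D g : borel D -> cintegrable D g -> Cint D (fun x => - g x) = - Cint D g.
Proof. by move=> mD ig; under eq_fun do rewrite -mulN1r; rewrite CintZ // mulN1r. Qed.

Lemma cintegrableB D g1 g2 : borel D -> cintegrable D g1 -> cintegrable D g2 ->
  cintegrable D (fun x => g1 x - g2 x).
Proof. by move=> mD i1 i2; apply: cintegrableD => //; exact: cintegrableN. Qed.

Lemma CintB D g1 g2 : borel D -> cintegrable D g1 -> cintegrable D g2 ->
  Cint D (fun x => g1 x - g2 x) = Cint D g1 - Cint D g2.
Proof. by move=> mD i1 i2; rewrite CintD ?CintN //; exact: cintegrableN. Qed.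

Lemma eq_Cint D g1 g2 : (forall x, D x -> g1 x = g2 x) -> Cint D g1 = Cint D g2.
Proof.
move=> h; apply: cplx_eq => /=; apply: eq_Rintegral => x /set_mem Dx; rewrite h //.
Qed.

(** Treating the two parts separately avoids rotating the integrand; the price is the factor 2 that
    appears in [absC_Cint_seg] and in the Taylor remainders. *)
Lemma absC_Cint_le D g (h : R -> R) : borel D -> cintegrable D g ->
  mu.-integrable D (EFin \o h) ->
  (forall x, D x -> `|Re (g x)| + `|Im (g x)| <= h x) ->
  absC (Cint D g) <= Rintegral mu D h.
Proof.
move=> mD [i1 i2] ih gh; apply: le_trans (absC_le_ReIm _) _ => /=.
apply: (@le_trans _ _ (Rintegral mu D (fun x => `|Re (g x)|) +
                      Rintegral mu D (fun x => `|Im (g x)|))).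
  by apply: lerD; exact: le_normr_Rintegral.
have j1 := integrable_norm i1; have j2 := integrable_norm i2.
rewrite -RintegralD //; apply: le_Rintegral => //.
have := integrableD mD j1 j2.
by congr (mu.-integrable D _); apply/funext => x.
Qed.

Lemma integrable_cst_seg (a b k : R) : mu.-integrable [set y : R | a <= y <= b] (EFin \o cst k).
Proof.
apply: measurable_bounded_integrable => //; first exact: measurable_seg.
- by rewrite -set_itvcc /= lebesgue_measure_itv /=; case: ifP => _; rewrite ?ltry //  -EFinB ltry.
- by exists `|k|; split; [exact: num_real|] => M kM x _ /=; exact: ltW.
Qed.

Lemma Rint_cst_seg (a b k : R) : a <= b ->
  Rintegral mu [set y : R | a <= y <= b] (fun=> k) = k * (b - a).
Proof.
move=> ab; rewrite Rintegral_cst; last exact: measurable_seg.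
rewrite -set_itvcc /= lebesgue_measure_itv /= lte_fin; case: ifPn => // nab.
have -> : a = b by apply/eqP; rewrite eq_le ab leNgt.
by rewrite subrr.
Qed.

Lemma absC_Cint_seg (a b B : R) g : a <= b -> cintegrable [set y : R | a <= y <= b] g ->
  (forall x, a <= x <= b -> absC (g x) <= B) ->
  absC (Cint [set y : R | a <= y <= b] g) <= 2 * B * (b - a).
Proof.
move=> ab ig gB.
rewrite -(@Rint_cst_seg a b) //; apply: absC_Cint_le => //.
- exact: measurable_seg.
- exact: integrable_cst_seg.
- move=> x /gB gx; rewrite mulr_natl mulr2n; apply: lerD.
    exact: le_trans (absC_Re _) _.
  exact: le_trans (absC_Im _) _.
Qed.

Lemma integrable_seg_sub (f : R -> R) (a b a' b' : R) : a <= a' -> b' <= b ->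
  mu.-integrable [set y : R | a <= y <= b] (EFin \o f) ->
  mu.-integrable [set y : R | a' <= y <= b'] (EFin \o f).
Proof.
move=> aa bb; apply: integrableS; try exact: measurable_seg.
by move=> x /= /andP[h1 h2]; rewrite (le_trans aa) // (le_trans h2).
Qed.

Lemma Rintegral_seg_cat (f : R -> R) (a b c : R) : a <= b -> b <= c ->
  mu.-integrable [set y : R | a <= y <= c] (EFin \o f) ->
  Rintegral mu [set y : R | a <= y <= c] f =
  Rintegral mu [set y : R | a <= y <= b] f + Rintegral mu [set y : R | b <= y <= c] f.
Proof.
move=> ab bc; rewrite -!set_itvcc => fi.
rewrite -[LHS](subrK (Rintegral mu `[a, b] f)) Rintegral_itvB ?bnd_simp //.
rewrite Rintegral_itv_obnd_cbnd; first by rewrite addrC.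
apply: integrableS fi => //; apply: subset_itv; rewrite bnd_simp //.
Qed.

Lemma cintegrable_seg_sub g (a b a' b' : R) : a <= a' -> b' <= b ->
  cintegrable [set y : R | a <= y <= b] g -> cintegrable [set y : R | a' <= y <= b'] g.
Proof. by move=> h1 h2 [i1 i2]; split; exact: (integrable_seg_sub h1 h2). Qed.

Lemma Cint_seg_cat g (a b c : R) : a <= b -> b <= c ->
  cintegrable [set y : R | a <= y <= c] g ->
  Cint [set y : R | a <= y <= c] g =
  Cint [set y : R | a <= y <= b] g + Cint [set y : R | b <= y <= c] g.
Proof.
move=> ab bc [i1 i2]; apply: cplx_eq; rewrite ?ReD ?ImD /=; exact: Rintegral_seg_cat.
Qed.

Definition rcont (h : R -> R) (x : R) := forall e : R, 0 < e ->
  exists2 d : R, 0 < d & forall y, `|y - x| < d -> `|h y - h x| <= e.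

Lemma rcont_continuous h x : rcont h x -> {for x, continuous h}.
Proof.
move=> hx; apply/cvgrPdist_le => e /hx[d d0 H].
apply/nbhs_ballP; exists d => //= y; rewrite /ball /= distrC => /H.
by rewrite distrC.
Qed.

Lemma rcont_integrable (h : R -> R) (a b : R) : (forall x, a <= x <= b -> rcont h x) ->
  mu.-integrable [set y : R | a <= y <= b] (EFin \o h).
Proof.
move=> hc; rewrite -set_itvcc; apply: continuous_compact_integrable.
  exact: segment_compact.
apply: continuous_in_subspaceT => x; rewrite inE /= in_itv /= => xab.
by apply: rcont_continuous; exact: hc.
Qed.

Definition ccont1 g (x : R) := forall e : R, 0 < e ->
  exists2 d : R, 0 < d & forall y, `|y - x| < d -> absC (g y - g x) <= e.

Lemma ccont1_Re g x : ccont1 g x -> rcont (fun x => Re (g x)) x.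
Proof.
move=> gx e /gx[d d0 H]; exists d => // y /H; apply: le_trans.
by rewrite -ReN -ReD absC_Re.
Qed.
Lemma ccont1_Im g x : ccont1 g x -> rcont (fun x => Im (g x)) x.
Proof.
move=> gx e /gx[d d0 H]; exists d => // y /H; apply: le_trans.
by rewrite -ImN -ImD absC_Im.
Qed.

Lemma ccont1_cintegrable g (a b : R) : (forall x, a <= x <= b -> ccont1 g x) ->
  cintegrable [set y : R | a <= y <= b] g.
Proof.
move=> gc; split; apply: rcont_integrable => x /gc.
- exact: ccont1_Re.
- exact: ccont1_Im.
Qed.

End ComplexIntegral.

(** * Goursat's theorem on rectangles *)

Section Goursat.
Variable R : realType.
Local Notation C := (Cx R).
Local Notation mu := (@lebesgue_measure R).
Implicit Types (f g : C -> C) (a b c d : R).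

Lemma Rint_ge_cst (h : R -> R) (a b m : R) : a <= b -> (forall x, a <= x <= b -> rcont h x) ->
  (forall x, a <= x <= b -> m <= h x) ->
  m * (b - a) <= Rintegral mu [set x | a <= x <= b] h.
Proof.
move=> ab hc hm; rewrite -(@Rint_cst_seg _ a b) //; apply: le_Rintegral => //.
- exact: measurable_seg.
- exact: integrable_cst_seg.
- exact: rcont_integrable.
Qed.

Lemma Rint_le_cst (h : R -> R) (a b m : R) : a <= b -> (forall x, a <= x <= b -> rcont h x) ->
  (forall x, a <= x <= b -> h x <= m) ->
  Rintegral mu [set x | a <= x <= b] h <= m * (b - a).
Proof.
move=> ab hc hm; rewrite -(@Rint_cst_seg _ a b) //; apply: le_Rintegral => //.
- exact: measurable_seg.
- exact: rcont_integrable.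
- exact: integrable_cst_seg.
Qed.

Lemma Rint_FTC (F h : R -> R) (a b : R) : a <= b ->
  (forall x : R, is_derive x 1 F (h x)) -> (forall x, rcont h x) ->
  Rintegral mu [set x | a <= x <= b] h = F b - F a.
Proof.
rewrite le_eqVlt => /predU1P[<-|ab] dF hc.
  by rewrite -set_itvcc set_itv1 Rintegral_set1 subrr.
have cF : continuous F.
  by move=> x; apply: differentiable_continuous; apply/derivable1_diffP; exact: ex_derive.
rewrite /Rintegral -set_itvcc (continuous_FTC2 (F := F)) //.
- by apply: continuous_subspaceT => x; exact: rcont_continuous.
- split.
  + by move=> x _; exact: ex_derive.
  + exact/cvg_at_right_filter/cF.
  + exact/cvg_at_left_filter/cF.
- by move=> x _; rewrite derive1E derive_val.
Qed.

Lemma absC_cplx (x y x' y' : R) :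
  absC (Complex x y - Complex x' y' : C) <= `|x - x'| + `|y - y'|.
Proof. by apply: le_trans (absC_le_ReIm _) _; rewrite ReD ImD ReN ImN. Qed.

Lemma ccontAt_h f x y : ccontAt f (Complex x y) -> ccont1 (fun x => f (Complex x y)) x.
Proof.
move=> fc e /fc[d d0 H]; exists d => // x' xx'; apply: H.
by apply: le_lt_trans (absC_cplx _ _ _ _) _; rewrite subrr normr0 addr0.
Qed.

Lemma ccontAt_v f x y : ccontAt f (Complex x y) -> ccont1 (fun y => f (Complex x y)) y.
Proof.
move=> fc e /fc[d d0 H]; exists d => // x' xx'; apply: H.
by apply: le_lt_trans (absC_cplx _ _ _ _) _; rewrite subrr normr0 add0r.
Qed.

Definition hint f a b y := Cint [set x | a <= x <= b] (fun x => f (Complex x y)).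
Definition vint f x c d := Cint [set y | c <= y <= d] (fun y => f (Complex x y)).
(** The counterclockwise boundary integral, with [dz = dx] on horizontal and [dz = i dy] on vertical
    sides. *)
Definition rectint f a b c d : C :=
  hint f a b c - hint f a b d + ic R * (vint f b c d - vint f a c d).

Definition hcont f a b y := forall x, a <= x <= b -> ccontAt f (Complex x y).
Definition vcont f x c d := forall y, c <= y <= d -> ccontAt f (Complex x y).
Definition sidecont f a b c d :=
  [/\ hcont f a b c, hcont f a b d, vcont f a c d & vcont f b c d].

Lemma hcont_int f a b y : hcont f a b y ->
  cintegrable [set x | a <= x <= b] (fun x => f (Complex x y)).
Proof. by move=> fc; apply: ccont1_cintegrable => x /fc/ccontAt_h. Qed.
Lemma vcont_int f x c d : vcont f x c d ->
  cintegrable [set y | c <= y <= d] (fun y => f (Complex x y)).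
Proof. by move=> fc; apply: ccont1_cintegrable => y /fc/ccontAt_v. Qed.

Lemma rectint_hcut f a m b c d : a <= m -> m <= b -> hcont f a b c -> hcont f a b d ->
  rectint f a b c d = rectint f a m c d + rectint f m b c d.
Proof.
move=> am mb fc fd; rewrite /rectint /hint.
rewrite (Cint_seg_cat am mb (hcont_int fc)) (Cint_seg_cat am mb (hcont_int fd)).
ring.
Qed.

Lemma rectint_vcut f a b c m d : c <= m -> m <= d -> vcont f a c d -> vcont f b c d ->
  rectint f a b c d = rectint f a b c m + rectint f a b m d.
Proof.
move=> am mb fc fd; rewrite /rectint /vint.
rewrite (Cint_seg_cat am mb (vcont_int fc)) (Cint_seg_cat am mb (vcont_int fd)).
ring.
Qed.

Lemma rectintD f g a b c d : sidecont f a b c d -> sidecont g a b c d ->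
  rectint (fun z => f z + g z) a b c d = rectint f a b c d + rectint g a b c d.
Proof.
move=> [f1 f2 f3 f4] [g1 g2 g3 g4]; rewrite /rectint /hint /vint.
rewrite !CintD; try exact: measurable_seg; try exact: hcont_int; try exact: vcont_int.
ring.
Qed.

Lemma rectintZ f (k : C) a b c d : sidecont f a b c d ->
  rectint (fun z => k * f z) a b c d = k * rectint f a b c d.
Proof.
move=> [f1 f2 f3 f4]; rewrite /rectint /hint /vint.
rewrite !CintZ; try exact: measurable_seg; try exact: hcont_int; try exact: vcont_int.
ring.
Qed.

Lemma rectint_bound f a b c d (B : R) : a <= b -> c <= d -> sidecont f a b c d ->
  (forall x, a <= x <= b -> absC (f (Complex x c)) <= B /\ absC (f (Complex x d)) <= B) ->
  (forall y, c <= y <= d -> absC (f (Complex a y)) <= B /\ absC (f (Complex b y)) <= B) ->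
  absC (rectint f a b c d) <= 4 * B * ((b - a) + (d - c)).
Proof.
move=> ab cd [f1 f2 f3 f4] hB vB.
apply: le_trans (absCD _ _) _; rewrite absCM absC_ic mul1r.
have -> : 4 * B * (b - a + (d - c)) = (2 * B * (b - a) + 2 * B * (b - a)) +
   (2 * B * (d - c) + 2 * B * (d - c)) by ring.
apply: lerD; apply: le_trans (absCB _ _) _; apply: lerD; apply: absC_Cint_seg => //;
  try exact: hcont_int; try exact: vcont_int.
- by move=> x /hB[].
- by move=> x /hB[].
- by move=> x /vB[].
- by move=> x /vB[].
Qed.

Lemma Cint_cst_seg a b (k : C) : a <= b -> Cint [set x | a <= x <= b] (fun=> k) = k * rc (b - a).
Proof.
move=> ab; apply: cplx_eq; rewrite ?ReM ?ImM /= Rint_cst_seg //; ring.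
Qed.

Lemma rcont_id (x : R) : rcont id x.
Proof. by move=> e e0; exists e => // y /ltW. Qed.

Lemma Cint_id_seg a b : a <= b -> Cint [set x | a <= x <= b] (fun x => rc x) = rc ((b ^+ 2 - a ^+ 2) / 2).
Proof.
move=> ab; apply: cplx_eq => /=; last by rewrite Rint_cst_seg // mul0r.
have dF (x : R) : is_derive x 1 (fun y : R => y ^+ 2 / 2) x.
  have -> : (fun y : R => y ^+ 2 / 2) = 2^-1 *: (@id R * @id R).
    by apply/funext => y; rewrite [RHS]mulrC expr2.
  apply: is_derive_eq; rewrite /GRing.scale /= mulr1. by field.
by rewrite (Rint_FTC ab dF) ?mulrBl //; exact: rcont_id.
Qed.

Lemma rectint_affine (k l : C) a b c d : a <= b -> c <= d ->
  rectint (fun z => k + l * z) a b c d = 0.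
Proof.
move=> ab cd.
have ci1 (p q : R) (u v : C) : cintegrable [set x | p <= x <= q] (fun x : R => u + v * rc x).
  apply: ccont1_cintegrable => x _ e e0.
  exists (e / (1 + absC v)); first by rewrite divr_gt0 // ltr_wpDr // absC_ge0.
  move=> y yx; have -> : u + v * rc y - (u + v * rc x) = v * rc (y - x).
    by rewrite rcD rcN; ring.
  rewrite absCM absC_rc; move: yx; rewrite ltr_pdivlMr; last by rewrite ltr_wpDr // absC_ge0.
  move=> /ltW; apply: le_trans; rewrite mulrC ler_wpM2l // lerDr ler01 //.
have E (p q : R) (u v : C) : p <= q -> Cint [set x | p <= x <= q] (fun x : R => u + v * rc x) =
    u * rc (q - p) + v * rc ((q ^+ 2 - p ^+ 2) / 2).
  move=> pq.
  have i1 : cintegrable [set x | p <= x <= q] (fun x : R => u).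
    have -> : (fun=> u) = (fun x : R => u + 0 * rc x) by apply/funext => x; rewrite mul0r addr0.
    exact: ci1.
  have i3 : cintegrable [set x | p <= x <= q] (fun x : R => rc x).
    have -> : (@rc R) = (fun x : R => 0 + 1 * rc x) by apply/funext => x; rewrite mul1r add0r.
    exact: ci1.
  rewrite CintD ?CintZ ?Cint_cst_seg ?Cint_id_seg //; try exact: measurable_seg.
  by apply: cintegrableZ => //; exact: measurable_seg.
have Eh (x y : R) : (Complex x y : C) = rc x + ic R * rc y.
  by apply: cplx_eq; rewrite ?ReD ?ImD ?ReM ?ImM /=; ring.
have hE y : hint (fun z => k + l * z) a b y =
    (k + l * ic R * rc y) * rc (b - a) + l * rc ((b ^+ 2 - a ^+ 2) / 2).
  rewrite -E //; apply: eq_Cint => x _; rewrite Eh; ring.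
have vE x : vint (fun z => k + l * z) x c d =
    (k + l * rc x) * rc (d - c) + l * ic R * rc ((d ^+ 2 - c ^+ 2) / 2).
  rewrite -E //; apply: eq_Cint => y _; rewrite Eh; ring.
rewrite /rectint !hE !vE !rcD !rcN; ring.
Qed.

Lemma cdiff_sidecont f a b c d : a <= b -> c <= d ->
  (forall z, inrect a b c d z -> cdiff f z) -> sidecont f a b c d.
Proof.
move=> ab cd fd; split=> [x xab|x xab|y yab|y yab]; apply/cdiff_cont/fd;
  by rewrite /inrect /= ?xab ?yab ?lexx ?ab ?cd.
Qed.

Lemma inrect_dist a b c d (z w : C) : inrect a b c d z -> inrect a b c d w ->
  absC (z - w) <= (b - a) + (d - c).
Proof.
move=> /andP[/andP[z1 z2] /andP[z3 z4]] /andP[/andP[w1 w2] /andP[w3 w4]].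
apply: le_trans (absC_le_ReIm _) _; rewrite ReD ReN ImD ImN.
by apply: lerD; rewrite ler_norml; apply/andP; split; lra.
Qed.

(** Subtracting the first-order expansion at a point, whose integral vanishes, leaves an integrand
    of size [e W] on a small rectangle of half-perimeter [W], hence an integral of size [e W^2].
    This bound survives quartering: four quarters of half-perimeter [W/2] contribute [W^2] in
    total. *)
Theorem goursat f a b c d : a <= b -> c <= d ->
  (forall z, inrect a b c d z -> cdiff f z) -> rectint f a b c d = 0.
Proof.
move=> ab cd fd.
pose W := (b - a) + (d - c).
have subr a' b' c' d' : a <= a' -> b' <= b -> c <= c' -> d' <= d ->
    forall z, inrect a' b' c' d' z -> cdiff f z.
  move=> h1 h2 h3 h4 z /andP[/andP[z1 z2] /andP[z3 z4]]; apply: fd.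
  by apply/andP; split; apply/andP; split; lra.
suff key : forall e : R, 0 < e -> absC (rectint f a b c d) <= 4 * e * W ^+ 2.
  apply/eqP; rewrite -absC_eq0 eq_le absC_ge0 andbT; apply/ler_addgt0Pr => e e0.
  rewrite add0r.
  have W0 : 0 <= W by rewrite /W addr_ge0 // subr_ge0.
  have k0 : 0 < 4 * (1 + W ^+ 2) by rewrite mulr_gt0 // ltr_wpDr // sqr_ge0.
  apply: le_trans (key (e / (4 * (1 + W ^+ 2))) _) _; first by rewrite divr_gt0.
  have -> : 4 * (e / (4 * (1 + W ^+ 2))) * W ^+ 2 = e * (4 * W ^+ 2) / (4 * (1 + W ^+ 2)).
    by field; have := sqr_ge0 W; lra.
  rewrite ler_pdivrMr // ler_wpM2l //; first exact: ltW.
  by rewrite ler_wpM2l // lerDr.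
move=> e e0.
pose P a' b' c' d' := a <= a' -> b' <= b -> c <= c' -> d' <= d ->
  absC (rectint f a' b' c' d') <= 4 * e * ((b' - a') + (d' - c')) ^+ 2.
suff : P a b c d by apply.
apply: rect_cousin => //.
- move=> p q r s pq rs x y P1 P2 P3 P4 ap qb cr sd.
  have [px xq ry ys] : [/\ p <= x, x <= q, r <= y & y <= s].
    by rewrite /x /y; split; lra.
  have sc a' b' c' d' : p <= a' -> a' <= b' -> b' <= q -> r <= c' -> c' <= d' -> d' <= s ->
      sidecont f a' b' c' d'.
    move=> *; apply: cdiff_sidecont => //; apply: subr; lra.
  have [s1 s2 s3 s4] := sc p q r s (lexx _) pq (lexx _) (lexx _) rs (lexx _).
  have [t1 t2 t3 t4] := sc p x r s (lexx _) px xq (lexx _) rs (lexx _).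
  rewrite (rectint_hcut px xq s1 s2) (rectint_vcut ry ys t3 t4) (rectint_vcut ry ys t4 s4).
  have -> : 4 * e * (q - p + (s - r)) ^+ 2 =
    4 * e * (x - p + (y - r)) ^+ 2 + 4 * e * (x - p + (s - y)) ^+ 2 +
    (4 * e * (q - x + (y - r)) ^+ 2 + 4 * e * (q - x + (s - y)) ^+ 2).
    by rewrite /x /y; field.
  apply: le_trans (absCD _ _) _; apply: lerD; apply: le_trans (absCD _ _) _; apply: lerD.
  + by apply: P1; lra.
  + by apply: P3; lra.
  + by apply: P2; lra.
  + by apply: P4; lra.
- move=> z zr; have [l fl] := fd z zr; have [dl dl0 H] := fl e e0.
  exists dl => // p q r s ap pq qb cr rs sd zpq small _ _ _ _.
  pose rem w := f w - f z - l * (w - z).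
  have fE : f = fun w => (f z - l * z + l * w) + rem w.
    by apply/funext => w; rewrite /rem; ring.
  have fpq : forall w, inrect p q r s w -> cdiff f w by apply: subr.
  have affd w : cdiff (fun w => f z - l * z + l * w) w.
    apply: cdiffD; first exact: cdiff_cst.
    by apply: cdiffM; [exact: cdiff_cst|exact: cdiff_id].
  have remd w : inrect p q r s w -> cdiff rem w.
    move=> wr; rewrite /rem; apply: cdiffB.
      by apply: cdiffB; [exact: fpq|exact: cdiff_cst].
    apply: cdiffM; first exact: cdiff_cst.
    by apply: cdiffB; [exact: cdiff_id|exact: cdiff_cst].
  rewrite [in X in X <= _]fE rectintD; [|exact: cdiff_sidecont|exact: cdiff_sidecont].
  rewrite rectint_affine // add0r.
  have -> : 4 * e * (q - p + (s - r)) ^+ 2 = 4 * (e * (q - p + (s - r))) * (q - p + (s - r)).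
    by ring.
  have remB w : inrect p q r s w -> absC (rem w) <= e * (q - p + (s - r)).
    move=> wr; have dist := inrect_dist wr zpq.
    apply: le_trans (H w (le_lt_trans dist small)) _.
    by rewrite ler_wpM2l // ltW.
  apply: rectint_bound => //; first exact: cdiff_sidecont.
  + by move=> x xpq; split; apply: remB; rewrite /inrect /= xpq ?lexx ?rs.
  + by move=> y yrs; split; apply: remB; rewrite /inrect /= yrs ?lexx ?pq.
Qed.

End Goursat.

(** * Maximum principle and identity theorem *)

Section MaximumPrinciple.
Variable R : realType.
Local Notation C := (Cx R).
Local Notation mu := (@lebesgue_measure R).
Implicit Types (f g : C -> C) (a b c d : R).

Lemma expr_unbounded (t K : R) : 1 < t -> exists n, K < t ^+ n.
Proof.
move=> t1; pose h := t - 1; have h0 : 0 < h by rewrite subr_gt0.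
have bern n : 1 + n%:R * h <= t ^+ n.
  elim: n => [|n IH]; first by rewrite mul0r addr0 expr0.
  rewrite exprS; apply: (@le_trans _ _ (t * (1 + n%:R * h))); last by rewrite ler_wpM2l //; lra.
  have -> : t = 1 + h by rewrite /h; ring.
  have : 0 <= n%:R * h ^+ 2 by rewrite mulr_ge0 // sqr_ge0.
  rewrite -natr1; nra.
exists (Num.Def.archi_bound (`|K| / h)).
apply: lt_le_trans (bern _); apply: le_lt_trans (ler_norm _) _.
have := @archi_boundP R (`|K| / h); rewrite divr_ge0 ?(ltW h0) // => /(_ isT).
by rewrite ltr_pdivrMr // => H; apply: lt_le_trans H _; rewrite lerDr.
Qed.

Definition onbdry a b c d (z : C) :=
  inrect a b c d z && [|| Re z == a, Re z == b, Im z == c | Im z == d].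

Definition inside a b c d (z : C) :=
  (a < Re z < b) && (c < Im z < d).

Definition cinv (z0 z : C) : C := (z - z0)^-1.

Lemma cdiff_cinv (z0 z : C) : z != z0 -> cdiff (cinv z0) z.
Proof.
move=> zz; apply: cdiffV; last by rewrite subr_eq0.
by apply: cdiffB; [exact: cdiff_id|exact: cdiff_cst].
Qed.

Lemma bdry_neq a b c d (z0 z : C) : inside a b c d z0 -> onbdry a b c d z -> z != z0.
Proof.
move=> /andP[/andP[h1 h2] /andP[h3 h4]] /andP[_ bd]; apply/eqP => zz.
move: bd; rewrite zz => /or4P[]/eqP E; move: h1 h2 h3 h4; rewrite E ?ltxx //.
Qed.

Lemma bdry_sidecont f a b c d : a <= b -> c <= d ->
  (forall z, onbdry a b c d z -> ccontAt f z) -> sidecont f a b c d.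
Proof.
move=> ab cd H; split=> [x xab|x xab|y yab|y yab]; apply: H;
  by rewrite /onbdry /inrect /= ?xab ?yab ?lexx ?ab ?cd ?eqxx ?orbT.
Qed.

(** Instead of computing [2 pi i], one looks at the imaginary part: each side contributes with a
    nonnegative sign, the bottom side strictly. *)
Lemma rectint_cinv_neq0 a b c d (z0 : C) : inside a b c d z0 ->
  rectint (cinv z0) a b c d != 0.
Proof.
move=> z0in; have [x0 y0] : exists x0, exists y0, z0 = Complex x0 y0.
  by case: (z0) => p q; exists p, q.
move: y0 => [y0 z0E]; have := z0in; rewrite z0E => /andP[/andP[/= h1 h2] /andP[/= h3 h4]].
have ab : a <= b by lra.
have cd : c <= d by lra.
have [s1 s2 s3 s4] : sidecont (cinv z0) a b c d.
  apply: bdry_sidecont => // z zb; apply/cdiff_cont/cdiff_cinv; exact: bdry_neq z0in zb.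
rewrite z0E in s1 s2 s3 s4 *.
suff : 0 < Im (rectint (cinv (Complex x0 y0)) a b c d).
  by apply: contraTneq => ->; rewrite ltxx.
rewrite /rectint !ImD ImN ImM ReD ReN /= mul0r add0r mul1r.
have imE x y : Im (cinv (Complex x0 y0) (Complex x y)) =
   (y0 - y) / ((x - x0) ^+ 2 + (y - y0) ^+ 2) by rewrite /= -mulNr opprB.
have reE x y : Re (cinv (Complex x0 y0) (Complex x y)) =
   (x - x0) / ((x - x0) ^+ 2 + (y - y0) ^+ 2) by [].
have q0 (u v : R) : 0 <= u ^+ 2 + v ^+ 2 by rewrite addr_ge0 // sqr_ge0.
have I1 : 0 < Rintegral mu [set x | a <= x <= b]
    (fun x => Im (cinv (Complex x0 y0) (Complex x c))).
  pose D := (b - a) ^+ 2 + (c - y0) ^+ 2.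
  have D0 : 0 < D.
    by rewrite /D ltr_wpDl ?sqr_ge0 // exprn_even_gt0 //= subr_eq0 lt_eqF.
  apply: lt_le_trans (@Rint_ge_cst _ _ a b ((y0 - c) / D) ab _ _).
  - by rewrite mulr_gt0 ?divr_gt0 //; lra.
  - by move=> x /s1/ccontAt_h/ccont1_Im.
  - move=> x /andP[xa xb]; rewrite imE ler_wpM2l //; first by lra.
    have h : 0 < (x - x0) ^+ 2 + (c - y0) ^+ 2.
      by rewrite ltr_wpDl ?sqr_ge0 // exprn_even_gt0 //= subr_eq0 lt_eqF.
    rewrite lef_pV2 ?posrE // /D lerD2r.
    by nra.
have I2 : Rintegral mu [set x | a <= x <= b]
    (fun x => Im (cinv (Complex x0 y0) (Complex x d))) <= 0.
  rewrite -(mul0r (b - a)); apply: Rint_le_cst => //.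
  - by move=> x /s2/ccontAt_h/ccont1_Im.
  - by move=> x _; rewrite imE mulr_le0_ge0 ?invr_ge0 //; lra.
have I3 : 0 <= Rintegral mu [set x | c <= x <= d]
    (fun x => Re (cinv (Complex x0 y0) (Complex b x))).
  apply: Rintegral_ge0 => x _; rewrite reE mulr_ge0 ?invr_ge0 //; lra.
have I4 : Rintegral mu [set x | c <= x <= d]
    (fun x => Re (cinv (Complex x0 y0) (Complex a x))) <= 0.
  rewrite -(mul0r (d - c)); apply: Rint_le_cst => //.
  - by move=> x /s3/ccontAt_v/ccont1_Re.
  - by move=> x _; rewrite reE mulr_le0_ge0 ?invr_ge0 //; lra.
by move: I1 I2 I3 I4; set A := Rintegral _ _ _; set B := Rintegral _ _ _; set D := Rintegral _ _ _; set E := Rintegral _ _ _ => *; lra.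
Qed.

(** The larger rectangle is the inner one plus four rectangles that miss [z0], whose integrals
    vanish by Goursat's theorem. *)
Lemma rectint_core g a b c d x1 x2 y1 y2 (z0 : C) :
  a <= x1 -> x1 < Re z0 -> Re z0 < x2 -> x2 <= b ->
  c <= y1 -> y1 < Im z0 -> Im z0 < y2 -> y2 <= d ->
  (forall z, inrect a b c d z -> z != z0 -> cdiff g z) ->
  rectint g a b c d = rectint g x1 x2 y1 y2.
Proof.
move=> ax x10 x02 xb cy y10 y02 yd gd.
have x12 : x1 <= x2 by exact/ltW/(lt_trans x10).
have y12 : y1 <= y2 by exact/ltW/(lt_trans y10).
have a2 : a <= x2 := le_trans ax x12.
have b1 : x1 <= b := le_trans x12 xb.
have c2 : c <= y2 := le_trans cy y12.
have d1 : y1 <= d := le_trans y12 yd.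
have cd : c <= d := le_trans c2 yd.
have out p q r t : a <= p -> p <= q -> q <= b -> c <= r -> r <= t -> t <= d ->
    ~~ inrect p q r t z0 -> rectint g p q r t = 0.
  move=> ap pq qb cr rt td z0out; apply: goursat => // z zr.
  have zz0 : z != z0 by apply: contraNneq z0out => <-.
  apply: gd zz0; move: zr => /andP[/andP[z1 z2] /andP[z3 z4]].
  by rewrite /inrect (le_trans ap z1) (le_trans z2 qb) (le_trans cr z3) (le_trans z4 td).
have gc x y : a <= x <= b -> c <= y <= d -> (x != Re z0) || (y != Im z0) ->
    ccontAt g (Complex x y).
  move=> xab ycd xy; apply/cdiff_cont/gd; first by rewrite /inrect /= xab ycd.
  by case: (z0) xy => p q /=; rewrite eq_complex /= negb_and.
have hc p q y : a <= p -> q <= b -> c <= y <= d -> y != Im z0 -> hcont g p q y.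
  move=> ap qb yy yn x /andP[xp xq]; apply: gc => //; last by rewrite yn orbT.
  by rewrite (le_trans ap xp) (le_trans xq qb).
have vc x : a <= x <= b -> x != Re z0 -> vcont g x c d.
  by move=> xx xn y yy; apply: gc => //; rewrite xn.
have cn : c != Im z0 by rewrite lt_eqF // (le_lt_trans cy).
have dn : d != Im z0 by rewrite gt_eqF // (lt_le_trans y02).
have ccd : c <= c <= d by rewrite lexx.
have cdd : c <= d <= d by rewrite cd lexx.
have x1n : x1 != Re z0 by rewrite lt_eqF.
have x2n : x2 != Re z0 by rewrite gt_eqF.
have ax1b : a <= x1 <= b by rewrite ax.
have ax2b : a <= x2 <= b by rewrite a2.
have vc' x r t : a <= x <= b -> x != Re z0 -> c <= r -> t <= d -> vcont g x r t.
  move=> xx xn cr td y /andP[yr yt]; apply: vc => //.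
  by rewrite (le_trans cr yr) (le_trans yt td).
rewrite (rectint_hcut ax b1 (hc a b c (lexx _) (lexx _) ccd cn) (hc a b d (lexx _) (lexx _) cdd dn)).
rewrite (out a x1) ?lexx // ?add0r; last by rewrite /inrect [_ <= x1]leNgt x10 !andbF.
rewrite (rectint_hcut x12 xb (hc x1 b c ax (lexx _) ccd cn) (hc x1 b d ax (lexx _) cdd dn)).
rewrite (out x2 b) ?lexx // ?addr0; last by rewrite /inrect leNgt x02.
rewrite (rectint_vcut cy d1 (vc x1 ax1b x1n) (vc x2 ax2b x2n)).
rewrite (out x1 x2 c y1) ?lexx // ?add0r; last by rewrite /inrect [_ <= y1]leNgt y10 !andbF.
rewrite (rectint_vcut y12 yd (vc' x1 y1 d ax1b x1n cy (lexx _)) (vc' x2 y1 d ax2b x2n cy (lexx _))).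
rewrite (out x1 x2 y2 d) ?lexx // ?addr0 //; by rewrite /inrect [y2 <= _]leNgt y02 !andbF.
Qed.

(** The contour can be shrunk to a square of half-side [s] about [z0], where the bounded integrand
    contributes at most [16 M s]. *)
Lemma rectint_excise g a b c d (z0 : C) (M e : R) : inside a b c d z0 -> 0 < e ->
  (forall z, inrect a b c d z -> z != z0 -> cdiff g z) ->
  (forall z, absC (z - z0) < e -> absC (g z) <= M) ->
  rectint g a b c d = 0.
Proof.
move=> z0in e0 gd gM.
have M0 : 0 <= M by apply: le_trans (absC_ge0 _) (gM z0 _); rewrite subrr absC0.
have /andP[/andP[h1 h2] /andP[h3 h4]] := z0in.
set x0 := Re z0 in h1 h2; set y0 := Im z0 in h3 h4.
pose s0 := Num.min (Num.min (x0 - a) (b - x0)) (Num.min (y0 - c) (d - y0)).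
have s00 : 0 < s0 by rewrite !lt_min !subr_gt0 h1 h2 h3 h4.
have key s : 0 < s -> s < s0 -> 2 * s < e -> absC (rectint g a b c d) <= 16 * M * s.
  move=> spos; rewrite !lt_min !ltrBrDl => /andP[/andP[k1 k2] /andP[k3 k4]] se.
  have lts (x : R) : x - s < x by rewrite ltrBlDr ltrDl.
  have gts (x : R) : x < x + s by rewrite ltrDl.
  have xx : x0 - s <= x0 + s by exact/ltW/(lt_trans (lts x0)).
  have yy : y0 - s <= y0 + s by exact/ltW/(lt_trans (lts y0)).
  have ax : a <= x0 - s by rewrite lerBrDl addrC ltW.
  have cy : c <= y0 - s by rewrite lerBrDl addrC ltW.
  rewrite (@rectint_core g a b c d (x0 - s) (x0 + s) (y0 - s) (y0 + s) z0) ?lts ?gts ?(ltW k2) ?(ltW k4) //.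
  have -> : 16 * M * s = 4 * M * ((x0 + s - (x0 - s)) + (y0 + s - (y0 - s))) by ring.
  have sub z : inrect (x0 - s) (x0 + s) (y0 - s) (y0 + s) z -> inrect a b c d z.
    move=> /andP[/andP[p1 p2] /andP[p3 p4]]; rewrite /inrect (le_trans ax p1) (le_trans cy p3).
    by rewrite (le_trans p2 (ltW k2)) (le_trans p4 (ltW k4)).
  have small z : inrect (x0 - s) (x0 + s) (y0 - s) (y0 + s) z -> absC (g z) <= M.
    move=> /andP[/andP[p1 p2] /andP[p3 p4]]; apply: gM; apply: le_lt_trans se.
    apply: le_trans (absC_le_ReIm _) _; rewrite ReD ReN ImD ImN -/x0 -/y0 mulr_natl mulr2n.
    by apply: lerD; rewrite ler_distl ?p1 ?p2 ?p3 ?p4.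
  have sc : sidecont g (x0 - s) (x0 + s) (y0 - s) (y0 + s).
    apply: bdry_sidecont => // z zb; have /andP[zr _] := zb; apply/cdiff_cont/gd; first exact: sub.
    by apply: bdry_neq zb; rewrite /inside -/x0 -/y0 !lts !gts.
  apply: rectint_bound => // [x xs|y ys]; split; apply: small;
    by rewrite /inrect /= ?xs ?ys ?lexx ?xx ?yy.
apply/eqP; rewrite -absC_eq0 eq_le absC_ge0 andbT; apply/ler_addgt0Pr => t t0; rewrite add0r.
have M1 : 0 < M + 1 by rewrite ltr_wpDl.
clear -key s00 e0 t0 M0 M1.
pose s := Num.min (s0 / 2) (Num.min (e / 4) (t / (16 * (M + 1)))).
have spos : 0 < s.
  by rewrite !lt_min; apply/and3P; split; rewrite divr_gt0 // mulr_gt0.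
have [s1 s2 s3] : [/\ s <= s0 / 2, s <= e / 4 & s <= t / (16 * (M + 1))].
  by rewrite /s; split; rewrite !ge_min lexx ?orbT.
have lt1 : s < s0 by lra.
have lt2 : 2 * s < e by lra.
apply: le_trans (key s spos lt1 lt2) _.
apply: (@le_trans _ _ (16 * (M + 1) * s)).
  by rewrite ler_wpM2r ?(ltW spos) // ler_wpM2l // lerDl.
by rewrite mulrC -ler_pdivlMr // mulr_gt0.
Qed.

(** Cauchy's formula with its normalising constant left as an integral. Differentiability at [z0]
    bounds the difference quotient nearby, which is what [rectint_excise] asks for. *)
Lemma cauchy_rect f a b c d (z0 : C) : inside a b c d z0 ->
  (forall z, inrect a b c d z -> cdiff f z) ->
  rectint (fun z => f z * cinv z0 z) a b c d = f z0 * rectint (cinv z0) a b c d.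
Proof.
move=> z0in fd; have := z0in => /andP[/andP[h1 h2] /andP[h3 h4]].
have ab : a <= b by lra.
have cd : c <= d by lra.
have z0r : inrect a b c d z0 by apply/andP; split; apply/andP; split; exact: ltW.
pose g z := (f z - f z0) * cinv z0 z.
have gd z : inrect a b c d z -> z != z0 -> cdiff g z.
  move=> zr zz; apply: cdiffM; last exact: cdiff_cinv.
  by apply: cdiffB; [exact: fd|exact: cdiff_cst].
have g0 : rectint g a b c d = 0.
  have [l /(_ 1 ltr01)[e e0 H]] := fd _ z0r.
  apply: (@rectint_excise g _ _ _ _ z0 (1 + absC l) e) => // z ze.
  have [->|zz] := eqVneq z z0.
    by rewrite /g subrr mul0r absC0 addr_ge0 // absC_ge0.
  rewrite /g absCM absCV ler_pdivrMr ?absC_gt0 ?subr_eq0 //.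
  have -> : f z - f z0 = (f z - f z0 - l * (z - z0)) + l * (z - z0) by rewrite subrK.
  apply: le_trans (absCD _ _) _; rewrite absCM mulrDl lerD2r; exact: H.
have bd (k : C -> C) : (forall z, inrect a b c d z -> z != z0 -> cdiff k z) -> sidecont k a b c d.
  move=> kd; apply: bdry_sidecont => // z zb; apply/cdiff_cont/kd; last exact: bdry_neq z0in zb.
  by case/andP: zb.
have bi : sidecont (cinv z0) a b c d by apply: bd => z _ zz; exact: cdiff_cinv.
have -> : (fun z => f z * cinv z0 z) = (fun z => g z + f z0 * cinv z0 z).
  by apply/funext => z; rewrite /g; ring.
rewrite rectintD ?rectintZ ?g0 ?add0r //; first exact: bd.
by apply: bd => z _ zz; apply: cdiffM; [exact: cdiff_cst|exact: cdiff_cinv].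
Qed.

(** A crude bound on Cauchy's formula; the point is that [K] is chosen before [f]. *)
Lemma weak_max a b c d (z0 : C) : inside a b c d z0 ->
  exists2 K : R, 0 < K & forall f (B : R),
  (forall z, inrect a b c d z -> cdiff f z) ->
  (forall z, onbdry a b c d z -> absC (f z) <= B) ->
  absC (f z0) <= K * B.
Proof.
move=> z0in; have := z0in => /andP[/andP[h1 h2] /andP[h3 h4]].
have ab : a < b by lra.
have cd : c < d by lra.
set x0 := Re z0 in h1 h2; set y0 := Im z0 in h3 h4.
pose dl := Num.min (Num.min (x0 - a) (b - x0)) (Num.min (y0 - c) (d - y0)).
have dl0 : 0 < dl by rewrite !lt_min; apply/andP; split; apply/andP; split; lra.
pose k := absC (rectint (cinv z0) a b c d).
have k0 : 0 < k by rewrite absC_gt0; exact: rectint_cinv_neq0.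
pose W := (b - a) + (d - c); have W0 : 0 < W by rewrite /W; lra.
exists (4 * dl^-1 * W / k).
  by rewrite divr_gt0 // mulr_gt0 // mulr_gt0 // invr_gt0.
move=> f B fd fB.
have := cauchy_rect z0in fd => E.
have side z : onbdry a b c d z -> absC (f z * cinv z0 z) <= B * dl^-1.
  move=> zb; rewrite absCM; apply: ler_pM; rewrite ?absC_ge0 ?fB //.
  rewrite absCV lef_pV2 ?posrE ?absC_gt0 ?subr_eq0 //; last exact: bdry_neq z0in zb.
  have hr := absC_Re (z - z0); have hi := absC_Im (z - z0).
  move: hr hi; rewrite ReD ReN ImD ImN -/x0 -/y0.
  case/andP : zb => _ /or4P[]/eqP -> hr hi.
  - by apply: le_trans hr; rewrite distrC !ge_min ler_norm.
  - by apply: le_trans hr; rewrite !ge_min ler_norm ?orbT.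
  - by apply: le_trans hi; rewrite distrC !ge_min ler_norm ?orbT.
  - by apply: le_trans hi; rewrite !ge_min ler_norm ?orbT.
have sc : sidecont (fun z => f z * cinv z0 z) a b c d.
  apply: bdry_sidecont; [lra|lra|] => z zb; apply/cdiff_cont/cdiffM.
    by apply: fd; case/andP: zb.
  apply: cdiff_cinv; exact: bdry_neq z0in zb.
have := @rectint_bound _ _ a b c d (B * dl^-1) (ltW ab) (ltW cd) sc.
rewrite E absCM -/k -/W => H.
have : absC (f z0) * k <= 4 * (B / dl) * W.
  apply: H => [x xab|y ycd]; split; apply: side;
  by rewrite /onbdry /inrect /= ?xab ?ycd ?lexx ?(ltW ab) ?(ltW cd) ?eqxx ?orbT.
rewrite -ler_pdivlMr // => /le_trans; apply.
by rewrite le_eqVlt; apply/orP; left; apply/eqP; field; rewrite !gt_eqF.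
Qed.

(** The constant of [weak_max] is removed by applying it to all powers of [f]: [|f z0|^n <= K B^n]
    for every [n] rules out [|f z0| > B]. *)
Theorem max_principle f a b c d (z0 : C) (B : R) : inside a b c d z0 ->
  (forall z, inrect a b c d z -> cdiff f z) ->
  (forall z, onbdry a b c d z -> absC (f z) <= B) ->
  absC (f z0) <= B.
Proof.
move=> z0in fd fB; have [K K0 H] := weak_max z0in.
have Hn n : absC (f z0) ^+ n <= K * B ^+ n.
  rewrite -absCX; apply: (H (fun z => f z ^+ n)) => z zr.
    by apply: cdiffX; exact: fd.
  by rewrite absCX lerXn2r ?nnegrE ?absC_ge0 ?fB // (le_trans (absC_ge0 _) (fB _ zr)).
have B0 : 0 <= B.
  have : 0 <= K * B by apply: le_trans (absC_ge0 _) (H f B fd fB).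
  by rewrite pmulr_rge0.
rewrite leNgt; apply/negP => Bf.
move: B0; rewrite le_eqVlt => /predU1P[B0|B0].
  by have := Hn 1%N; rewrite -B0 !expr1 mulr0 leNgt B0 Bf.
have [n] := @expr_unbounded (absC (f z0) / B) K (ltac:(by rewrite ltr_pdivlMr ?mul1r)).
by rewrite expr_div_n ltr_pdivlMr ?exprn_gt0 // ltNge Hn.
Qed.

Lemma inrect_cover a m b c k d (z : C) : inrect a b c d z ->
  [|| inrect a m c k z, inrect m b c k z, inrect a m k d z | inrect m b k d z].
Proof.
move=> /andP[/andP[h1 h2] /andP[h3 h4]]; rewrite /inrect h1 h2 h3 h4 /= !andbT.
by case: (leP (Re z) m) => [_|/ltW ->]; case: (leP (Im z) k) => [_|/ltW ->];
  rewrite ?orbT.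
Qed.

Lemma rect_bounded f a b c d : a <= b -> c <= d ->
  (forall z, inrect a b c d z -> ccontAt f z) ->
  exists M, forall z, inrect a b c d z -> absC (f z) <= M.
Proof.
move=> ab cd fc.
apply: (@rect_cousin _ (fun a b c d => exists M, forall z, inrect a b c d z -> absC (f z) <= M)) => //.
- move=> p q r s _ _ x y [M1 h1] [M2 h2] [M3 h3] [M4 h4].
  exists (Num.max (Num.max M1 M2) (Num.max M3 M4)) => z /(@inrect_cover p x q r y s).
  by rewrite !le_max => /or4P[/h1|/h2|/h3|/h4] ->; rewrite ?orbT.
- move=> z /fc /(_ 1 ltr01)[e e0 H]; exists e => // p q r s _ _ _ _ _ _ zr small.
  exists (1 + absC (f z)) => w wr.
  have -> : f w = (f w - f z) + f z by rewrite subrK.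
  apply: le_trans (absCD _ _) _; rewrite lerD2r; apply: H.
  exact: le_lt_trans (inrect_dist wr zr) small.
Qed.

Definition insq (c : C) (r : R) (z : C) :=
  inrect (Re c - r) (Re c + r) (Im c - r) (Im c + r) z.

Lemma bdry_sq (c : C) (r : R) z :
  onbdry (Re c - r) (Re c + r) (Im c - r) (Im c + r) z ->
  r <= absC (z - c).
Proof.
have hr := absC_Re (z - c); have hi := absC_Im (z - c).
move: hr hi; rewrite ReD ReN ImD ImN => hr hi.
case/andP => _ /or4P[]/eqP E; rewrite ?E in hr hi.
- by rewrite (le_trans _ hr) // addrAC subrr add0r normrN ler_norm.
- by rewrite (le_trans _ hr) // addrAC subrr add0r ler_norm.
- by rewrite (le_trans _ hi) // addrAC subrr add0r normrN ler_norm.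
- by rewrite (le_trans _ hi) // addrAC subrr add0r ler_norm.
Qed.

(** Since [q] vanishes near [c], it stays differentiable after division by any power of [z - c]. The
    maximum principle on the square gives [|q z| <= M (|z - c| / r)^n] for every [n]. *)
Lemma zero_spread q (c : C) (r s : R) : 0 < s -> 0 < r ->
  (forall z, insq c r z -> cdiff q z) ->
  (forall z, absC (z - c) < s -> q z = 0) ->
  forall z, absC (z - c) < r -> q z = 0.
Proof.
move=> s0 r0 qd qz z zc.
have [zs|zs] := ltP (absC (z - c)) s; first exact: qz.
have zc0 : 0 < absC (z - c) by exact: lt_le_trans s0 zs.
have [M qM] := @rect_bounded q _ _ _ _ (ltac:(lra) : Re c - r <= Re c + r)
  (ltac:(lra) : Im c - r <= Im c + r) (fun z zr => cdiff_cont (qd z zr)).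
have zin : inside (Re c - r) (Re c + r) (Im c - r) (Im c + r) z.
  have hr := le_lt_trans (absC_Re (z - c)) zc; have hi := le_lt_trans (absC_Im (z - c)) zc.
  move: hr hi; rewrite ReD ReN ImD ImN !ltr_norml => /andP[a1 a2] /andP[a3 a4].
  by apply/andP; split; apply/andP; split; lra.
have key n : absC (q z * cinv c z ^+ n) <= M * (r^-1) ^+ n.
  apply: (@max_principle (fun z => q z * cinv c z ^+ n) _ _ _ _ z _ zin) => w wr.
    have [ws|ws] := ltP (absC (w - c)) s.
      have d0 : 0 < s - absC (w - c) by rewrite subr_gt0.
      apply: (@cdiff_local _ (fun=> 0) _ _ _ d0); last exact: cdiff_cst.
      move=> v vw; rewrite qz ?mul0r //.
      have -> : v - c = (v - w) + (w - c) by rewrite addrA subrK.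
      by apply: le_lt_trans (absCD _ _) _; rewrite -ltrBrDr.
    apply: cdiffM; first exact: qd.
    apply: cdiffX; apply: cdiff_cinv; apply: contraTneq ws => ->.
    by rewrite subrr absC0 -ltNge.
  rewrite absCM absCX; apply: ler_pM; rewrite ?absC_ge0 ?exprn_ge0 ?absC_ge0 //.
    by apply: qM; case/andP: wr.
  rewrite lerXn2r ?nnegrE ?absC_ge0 ?invr_ge0 ?(ltW r0) // absCV.
  have := bdry_sq wr => h.
  by rewrite lef_pV2 // posrE //; exact: lt_le_trans r0 h.
apply/eqP; rewrite -absC_eq0 eq_le absC_ge0 andbT leNgt; apply/negP => qpos.
have [n] := @expr_unbounded (r / absC (z - c)) (M / absC (q z)) (ltac:(by rewrite ltr_pdivlMr ?mul1r)).
rewrite ltr_pdivrMr // expr_div_n mulrAC ltr_pdivlMr ?exprn_gt0 // ltNge => /negP; apply.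
have := key n; rewrite absCM absCX absCV !exprVn.
rewrite ler_pdivrMr ?exprn_gt0 // mulrAC ler_pdivlMr ?exprn_gt0 //.
by rewrite [r ^+ n * _]mulrC.
Qed.

(** The strip is narrowed once for each quarter; a small enough rectangle contains at most one point
    of [S], and the strip retreats to one side of it. It will be a corridor for the identity
    theorem. *)
Lemma strip_avoid (S : set C) a b c d :  a <= b -> c <= d ->
  (forall z : C, exists2 r : R, 0 < r & forall y, S y -> absC (y - z) < r -> y = z) ->
  forall al be : R, al < be -> exists al' be', [/\ al <= al', al' < be', be' <= be &
    forall z, inrect a b c d z -> S z -> ~~ (al' <= Re z <= be')].
Proof.
move=> ab cd Sd.
apply: (@rect_cousin _ (fun a b c d => forall al be : R, al < be ->
  exists al' be', [/\ al <= al', al' < be', be' <= be &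
    forall z, inrect a b c d z -> S z -> ~~ (al' <= Re z <= be')])) => //.
- move=> p q r s _ _ x y P1 P2 P3 P4 al be ab0.
  have [al1 [be1 [i1 j1 k1 H1]]] := P1 _ _ ab0.
  have [al2 [be2 [i2 j2 k2 H2]]] := P2 _ _ j1.
  have [al3 [be3 [i3 j3 k3 H3]]] := P3 _ _ j2.
  have [al4 [be4 [i4 j4 k4 H4]]] := P4 _ _ j3.
  exists al4, be4; split => //; [lra|lra|] => z zr Sz; apply/negP => /andP[z1 z2].
  have := @inrect_cover p x q r y s _ zr => /or4P[] zz.
  + by have := H1 _ zz Sz => /negP; apply; apply/andP; split; lra.
  + by have := H2 _ zz Sz => /negP; apply; apply/andP; split; lra.
  + by have := H3 _ zz Sz => /negP; apply; apply/andP; split; lra.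
  + by have := H4 _ zz Sz => /negP; apply; apply/andP; split; lra.
- move=> z zr; have [e e0 H] := Sd z; exists e => // p q r s _ _ _ _ _ _ zpq small al be ab0.
  pose m := (al + be) / 2.
  have uni w : inrect p q r s w -> S w -> w = z.
    by move=> wr Sw; apply: H => //; exact: le_lt_trans (inrect_dist wr zpq) small.
  have [zm|zm] := ltP (Re z) m.
    exists m, be; split; rewrite /m //; [lra|lra|] => w wr Sw.
    by rewrite (uni w wr Sw) negb_and -ltNge zm.
  (* The strip is closed and [z] may lie on the line [m], hence the retreat to the midpoint of [al]
     and [m]. *)
  exists al, ((al + m) / 2); split; rewrite /m //; [lra|lra|] => w wr Sw.
  by rewrite (uni w wr Sw) negb_and -!ltNge; apply/orP; right; rewrite /m in zm *; lra.
Qed.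

(** A chain of overlapping discs descends from the upper half-plane, inside a vertical strip free of
    [S], to the height of [z]. Points of [S] may lie on the vertical line through [z], so the strip
    only passes close to [z], and continuity at [z] gives the contradiction. *)
Theorem identity_upper (S : set C) q :
  (forall z : C, exists2 r : R, 0 < r & forall y, S y -> absC (y - z) < r -> y = z) ->
  (forall z, ~ S z -> cdiff q z) ->
  (forall z, ~ S z -> 0 < Im z -> q z = 0) ->
  forall z, ~ S z -> q z = 0.
Proof.
move=> Sd qd qup z Sz; apply/eqP; rewrite -absC_eq0; apply/negP => /negP q0.
have qpos : 0 < absC (q z) by rewrite lt_neqAle eq_sym q0 absC_ge0.
have [dl dl0 H] := cdiff_cont (qd z Sz) (divr_gt0 qpos (ltr0n _ 2)).
set x := Re z; set y := Im z.
(* Height of the first centre. It is at least 1 while the discs have radius [r / 2 <= 1 / 2], so the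
   first disc lies in the upper half-plane. *)
pose t0 := Num.max y 0 + 1.
have [t0y t00] : y + 1 <= t0 /\ 1 <= t0.
  by rewrite /t0; split; rewrite ?lerD2r ?lerDr le_max lexx ?orbT.
have [al [be [i j k strip]]] := @strip_avoid S (x - dl) (x + dl) (y - 1) (t0 + 1)
  (ltac:(lra)) (ltac:(lra)) Sd (x - dl / 2) (x + dl / 2) (ltac:(lra)).
pose r := Num.min ((be - al) / 2) 1.
have [r0 r1 r2] : [/\ 0 < r, r <= 1 & r <= (be - al) / 2].
  by rewrite /r; split; rewrite ?lt_min ?ge_min ?lexx ?orbT //; clear -j; apply/andP; split; lra.
pose xm := (al + be) / 2.
(* With steps [h <= r / 2], each disc of radius [r / 2] lies in the disc of radius [r] about the
   preceding centre, to which [zero_spread] applies. *)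
pose N := (Num.Def.archi_bound ((t0 - y) / (r / 2))).+1.
pose h := (t0 - y) / N%:R.
have N0 : (0 : R) < N%:R by rewrite ltr0n.
have hr : h <= r / 2.
  rewrite /h ler_pdivrMr // mulrC -ler_pdivrMr; last by lra.
  have := @archi_boundP R ((t0 - y) / (r / 2)); rewrite divr_ge0; [|lra|lra].
  move=> /(_ isT)/ltW h1; apply: le_trans h1 _.
  by rewrite ler_nat /N.
have h0 : 0 <= h by rewrite /h divr_ge0 //; lra.
have key n : (n <= N)%N -> forall w, absC (w - Complex xm (t0 - n%:R * h)) < r / 2 -> q w = 0.
  elim: n => [_ w|n IH nN w wn].
    rewrite mul0r subr0 => wn; have wr := le_lt_trans (absC_Re _) wn; have wi := le_lt_trans (absC_Im _) wn.
    move: wr wi; rewrite ReD ImD ReN ImN /= !ltr_norml => /andP[a1 a2] /andP[a3 a4].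
    apply: qup; last by clear -a3 r1 t00; lra.
    move=> Sw; have := strip w; rewrite /xm in a1 a2; rewrite /inrect => /(_ _ Sw) /negP; apply.
      clear -a1 a2 a3 a4 r0 r1 r2 i k dl0 t0y.
      by apply/andP; split; apply/andP; split; lra.
    by clear -a1 a2 r2 r0; apply/andP; split; lra.
  have hn : n%:R * h <= t0 - y.
    apply: (@le_trans _ _ (N%:R * h)); first by rewrite ler_wpM2r // ler_nat ltnW.
    by rewrite /h mulrC divfK // gt_eqF.
  apply: (@zero_spread q (Complex xm (t0 - n%:R * h)) r (r / 2)) => //.
  - by rewrite divr_gt0.
  - move=> v /andP[/= /andP[a1 a2] /andP[a3 a4]]; apply: qd => Sv.
    have nh0 : 0 <= n%:R * h by rewrite mulr_ge0.
    have := strip v; rewrite /xm in a1 a2; rewrite /inrect => /(_ _ Sv) /negP; apply.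
      clear -a1 a2 a3 a4 r0 r1 r2 i k dl0 t0y nh0 hn h0.
      by apply/andP; split; apply/andP; split; lra.
    by clear -a1 a2 r2 r0; apply/andP; split; lra.
  - by apply: IH; exact: ltnW.
  - have -> : w - Complex xm (t0 - n%:R * h) =
      (w - Complex xm (t0 - n.+1%:R * h)) + Complex 0 (- h).
      by rewrite -natr1; apply: cplx_eq; rewrite !(ReD, ImD, ReN, ImN) /=; ring.
    apply: le_lt_trans (absCD _ _) _.
    have : absC (Complex 0 (- h) : C) <= h.
      by apply: le_trans (absC_le_ReIm _) _; rewrite /= normr0 add0r normrN ger0_norm.
    by clear -wn hr; lra.
have qm : q (Complex xm y) = 0.
  apply: (key N) => //.
  have -> : N%:R * h = t0 - y by rewrite /h mulrC divfK // gt_eqF.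
  by rewrite subKr subrr absC0 divr_gt0.
have := H (Complex xm y); rewrite qm sub0r absCN => H'.
have : absC (q z) <= absC (q z) / 2.
  apply: H'; apply: le_lt_trans (absC_le_ReIm _) _.
  rewrite ReD ImD ReN ImN /= subrr normr0 addr0 -/x.
  have : `|xm - x| <= dl / 2.
    by rewrite ler_norml /xm; clear -i j k dl0; apply/andP; split; lra.
  by clear -dl0; lra.
by clear -qpos; lra.
Qed.

End MaximumPrinciple.

(** * The complex exponential and its Taylor remainder *)

Section ComplexExponential.
Variable R : realType.
Local Notation C := (Cx R).
Local Notation mu := (@lebesgue_measure R).

Definition expC (z : C) : C :=
  Complex (expR (Re z) * cos (Im z)) (expR (Re z) * sin (Im z)).

Lemma expCD (z w : C) : expC (z + w) = expC z * expC w.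
Proof.
by apply: cplx_eq; rewrite ?ReM ?ImM /= ReD ImD expRD ?cosD ?sinD; ring.
Qed.

Lemma expC0 : expC 0 = 1.
Proof. by apply: cplx_eq; rewrite /= expR0 mul1r ?cos0 ?sin0. Qed.

Lemma absC_expC (z : C) : absC (expC z) = expR (Re z).
Proof.
rewrite /absC /sqmod /= !exprMn -mulrDr cos2Dsin2 mulr1 sqrtr_sqr ger0_norm //.
Qed.

Lemma expC_neq0 (z : C) : expC z != 0.
Proof. by rewrite -absC_gt0 absC_expC expR_gt0. Qed.

Definition rdiff (G g : R -> C) := forall x : R,
  is_derive x 1 (fun t => Re (G t)) (Re (g x)) /\
  is_derive x 1 (fun t => Im (G t)) (Im (g x)).

Lemma is_derive_rcont (F : R -> R) (x l : R) : is_derive x 1 F l -> rcont F x.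
Proof.
move=> dF; have : {for x, continuous F}.
  by apply: differentiable_continuous; apply/derivable1_diffP; exact: ex_derive.
move=> /cvgrPdist_le cF e /cF /nbhs_ballP[d /= d0 H]; exists d => // y yx.
by rewrite distrC; apply: H; rewrite /ball /= distrC.
Qed.

Lemma rdiff_cintegrable G g a b : rdiff G g -> cintegrable [set x : R | a <= x <= b] G.
Proof.
by move=> dG; split; apply: rcont_integrable => x _; have [h1 h2] := dG x;
  apply: is_derive_rcont.
Qed.

Lemma Cint_FTC G g g' a b : a <= b -> rdiff G g -> rdiff g g' ->
  Cint [set x : R | a <= x <= b] g = G b - G a.
Proof.
move=> ab dG dg; apply: cplx_eq; rewrite ?ReD ?ImD ?ReN ?ImN /=.
- apply: (Rint_FTC (F := fun t => Re (G t)) ab) => x; first by have [] := dG x.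
  by have [h _] := dg x; exact: is_derive_rcont h.
- apply: (Rint_FTC (F := fun t => Im (G t)) ab) => x; first by have [] := dG x.
  by have [_ h] := dg x; exact: is_derive_rcont h.
Qed.

Lemma rdiffD G1 g1 G2 g2 : rdiff G1 g1 -> rdiff G2 g2 ->
  rdiff (fun x => G1 x + G2 x) (fun x => g1 x + g2 x).
Proof.
move=> d1 d2 x; have [h1 h2] := d1 x; have [h3 h4] := d2 x; split.
- rewrite ReD; have -> : (fun t => Re (G1 t + G2 t)) =
     (fun t => Re (G1 t)) + (fun t => Re (G2 t)).
    by apply/funext => t; rewrite ReD.
  exact: is_deriveD.
- rewrite ImD; have -> : (fun t => Im (G1 t + G2 t)) =
     (fun t => Im (G1 t)) + (fun t => Im (G2 t)).
    by apply/funext => t; rewrite ImD.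
  exact: is_deriveD.
Qed.

Lemma rdiffZ (k : C) G g : rdiff G g -> rdiff (fun x => k * G x) (fun x => k * g x).
Proof.
move=> d1 x; have [h1 h2] := d1 x; split.
- rewrite ReM; have -> : (fun t => Re (k * G t)) =
     Re k *: (fun t => Re (G t)) - Im k *: (fun t => Im (G t)).
    by apply/funext => t; rewrite ReM.
  exact: is_deriveB.
- rewrite ImM; have -> : (fun t => Im (k * G t)) =
     Re k *: (fun t => Im (G t)) + Im k *: (fun t => Re (G t)).
    by apply/funext => t; rewrite ImM.
  exact: is_deriveD.
Qed.

Lemma rdiff_cst (k : C) : rdiff (fun=> k) (fun=> 0).
Proof. by move=> x; split; exact: is_derive_cst. Qed.

Lemma rdiff_real (f f' : R -> R) : (forall x : R, is_derive x 1 f (f' x)) ->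
  rdiff (fun x => rc (f x)) (fun x => rc (f' x)).
Proof. by move=> df x; split => //=; exact: is_derive_cst. Qed.

Lemma is_derive_scalx (k x : R) : is_derive x 1 (fun t : R => k * t) k.
Proof.
have -> : (fun t : R => k * t) = k *: (@id R) by [].
by apply: is_derive_eq; rewrite /GRing.scale /= mulr1.
Qed.

Lemma rdiff_expC (c : C) : rdiff (fun t => expC (c * rc t)) (fun t => c * expC (c * rc t)).
Proof.
case: c => p q.
have E (t : R) : (Complex p q : C) * rc t = Complex (p * t) (q * t).
  by apply: cplx_eq; rewrite ?ReM ?ImM /=; ring.
have dE (x : R) : is_derive x 1 (fun t => expR (p * t)) (expR (p * x) * p).
  apply: (@is_derive1_comp _ expR (fun t : R => p * t)); exact: is_derive_scalx.
have dcos (x : R) : is_derive x 1 (fun t => cos (q * t)) (- sin (q * x) * q).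
  apply: (@is_derive1_comp _ cos (fun t : R => q * t)); exact: is_derive_scalx.
have dsin (x : R) : is_derive x 1 (fun t => sin (q * t)) (cos (q * x) * q).
  apply: (@is_derive1_comp _ sin (fun t : R => q * t)); exact: is_derive_scalx.
move=> x; rewrite E; split.
- have -> : (fun t : R => Re (expC (Complex p q * rc t))) =
     (fun t => expR (p * t)) * (fun t => cos (q * t)).
    by apply/funext => t; rewrite E.
  apply: (@is_derive_eq _ _ _ _ _ _ _ _ (is_deriveM (dE x) (dcos x))).
  rewrite ReM /= /GRing.scale /=; ring.
- have -> : (fun t : R => Im (expC (Complex p q * rc t))) =
     (fun t => expR (p * t)) * (fun t => sin (q * t)).
    by apply/funext => t; rewrite E.
  apply: (@is_derive_eq _ _ _ _ _ _ _ _ (is_deriveM (dE x) (dsin x))).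
  rewrite ImM /= /GRing.scale /=; ring.
Qed.

Lemma rdiff_expCZ (k c : C) :
  rdiff (fun t => k * expC (c * rc t)) (fun t => k * (c * expC (c * rc t))).
Proof. exact/rdiffZ/rdiff_expC. Qed.

Lemma Cint_expC (c : C) (a b : R) : a <= b ->
  c * Cint [set x : R | a <= x <= b] (fun x => expC (c * rc x)) =
  expC (c * rc b) - expC (c * rc a).
Proof.
move=> ab; rewrite -CintZ.
- by rewrite (Cint_FTC ab (@rdiff_expC c) (rdiffZ _ (@rdiff_expC c))).
- exact: measurable_seg.
- exact: rdiff_cintegrable (@rdiff_expC c).
Qed.

Definition expT n (w : C) : C := \sum_(k < n) w ^+ k * rc (k`!%:R^-1).

Lemma rdiff_expT n (w : C) :
  rdiff (fun t => expT n.+1 (w * rc t)) (fun t => w * expT n (w * rc t)).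
Proof.
elim: n => [|n IH].
  have -> : (fun t => expT 1 (w * rc t)) = fun=> 1.
    by apply/funext => t; rewrite /expT big_ord1 expr0 fact0 invr1 mul1r.
  have -> : (fun t => w * expT 0 (w * rc t)) = fun=> 0.
    by apply/funext => t; rewrite /expT big_ord0 mulr0.
  exact: rdiff_cst.
have -> : (fun t => expT n.+2 (w * rc t)) =
    (fun t => expT n.+1 (w * rc t) + w ^+ n.+1 * rc (t ^+ n.+1 / n.+1`!%:R)).
  by apply/funext => t; rewrite /expT big_ord_recr /= exprMn -rcX -mulrA -rcM.
have -> : (fun t => w * expT n.+1 (w * rc t)) =
    (fun t => w * expT n (w * rc t) + w ^+ n.+1 * rc (t ^+ n / n`!%:R)).
  by apply/funext => t; rewrite /expT big_ord_recr /= mulrDr exprMn -rcX -mulrA -rcM mulrA exprS.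
apply: rdiffD => //; apply: rdiffZ; apply: rdiff_real => x.
have -> : (fun t : R => t ^+ n.+1 / n.+1`!%:R) = (n.+1`!%:R^-1) *: ((@id R) ^+ n.+1).
  by apply/funext => t; rewrite mulrC -[X in _ = X]/(_ * _) exprfctE.
apply: is_derive_eq.
rewrite /GRing.scale /= mulr1 factS natrM.
have h1 : 1 + n%:R != 0 :> R by rewrite nat1r pnatr_eq0.
have h2 : n`!%:R != 0 :> R by rewrite pnatr_eq0 -lt0n fact_gt0.
by field; rewrite h2 h1.
Qed.

(** The remainder of order [n + 1] at [w] is the integral over [t] in [[0, 1]] of [w] times the
    remainder of order [n] at [w t]. Each integration costs a factor 2 from [absC_Cint_seg]; the
    factorial is given up. *)
Lemma expT_rem n (w : C) :
  absC (expC w - expT n w) <= 2 ^+ n * absC w ^+ n * expR (absC w).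
Proof.
elim: n w => [|n IH] w.
  rewrite /expT big_ord0 subr0 !expr0 !mul1r absC_expC ler_expR.
  by apply: le_trans (absC_Re _); exact: ler_norm.
pose G t := expC (w * rc t) - expT n.+1 (w * rc t).
pose g t := w * (expC (w * rc t) - expT n (w * rc t)).
have dG : rdiff G g.
  have -> : G = fun t => expC (w * rc t) + (-1) * expT n.+1 (w * rc t).
    by apply/funext => t; rewrite mulN1r.
  have -> : g = fun t => w * expC (w * rc t) + (-1) * (w * expT n (w * rc t)).
    by apply/funext => t; rewrite /g; ring.
  by apply: rdiffD; [exact: rdiff_expC|apply: rdiffZ; exact: rdiff_expT].
have [g' dg] : exists g', rdiff g g'.
  have [u du] : exists u, rdiff (fun t => expT n (w * rc t)) u.
    case: n {IH G g dG} => [|n]; last by eexists; exact: rdiff_expT.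
    exists (fun=> 0).
    have -> : (fun t => expT 0 (w * rc t)) = fun=> 0.
      by apply/funext => t; rewrite /expT big_ord0.
    exact: rdiff_cst.
  have -> : g = fun t => w * (expC (w * rc t) + (-1) * expT n (w * rc t)).
    by apply/funext => t; rewrite /g; ring.
  eexists; apply: rdiffZ; apply: rdiffD; first exact: rdiff_expC.
  apply: rdiffZ; exact: du.
have E : expC w - expT n.+1 w = Cint [set x : R | 0 <= x <= 1] g.
  rewrite (Cint_FTC ler01 dG dg) /G rc0 rc1 !mulr0 !mulr1 expC0.
  have -> : expT n.+1 0 = 1.
    rewrite /expT big_ord_recl /= expr0 fact0 invr1 mul1r big1 ?addr0 // => i _.
    by rewrite /= expr0n mul0r.
  by rewrite subrr subr0.
rewrite E; apply: (@le_trans _ _ (2 * (absC w * (2 ^+ n * absC w ^+ n * expR (absC w))) * (1 - 0))).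
  apply: absC_Cint_seg; [exact: ler01|exact: rdiff_cintegrable dg|] => x /andP[x0 x1].
  rewrite /g absCM ler_wpM2l ?absC_ge0 //; apply: le_trans (IH _) _.
  have h : absC (w * rc x) <= absC w.
    by rewrite absCM absC_rc ger0_norm // ler_piMr // absC_ge0.
  apply: ler_pM; rewrite ?mulr_ge0 ?exprn_ge0 ?absC_ge0 ?(ltW (expR_gt0 _)) ?ler_expR //.
  by rewrite ler_wpM2l ?exprn_ge0 // lerXn2r ?nnegrE ?absC_ge0.
by rewrite subr0 mulr1 !exprS le_eqVlt; apply/orP; left; apply/eqP; ring.
Qed.

Lemma expC_rem2 (w : C) : absC w <= 1 -> absC (expC w - 1 - w) <= 4 * expR 1 * absC w ^+ 2.
Proof.
move=> w1; have := expT_rem 2 w; rewrite /expT !big_ord_recr big_ord0 /= expr0 expr1 fact0.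
rewrite !invr1 rc1 !mulr1 add0r opprD addrA => /le_trans; apply.
have -> : (2 ^+ 2 : R) = 4 by ring.
rewrite mulrAC ler_wpM2r ?sqr_ge0 // ler_wpM2l //.
by rewrite ler_expR.
Qed.

Lemma cdiff_expC (z : C) : cdiff expC z.
Proof.
exists (expC z) => e e0.
pose K := expR (Re z) * (4 * expR 1).
have K0 : 0 < K by rewrite !mulr_gt0 ?expR_gt0.
exists (Num.min 1 (e / K)); first by rewrite lt_min ltr01 divr_gt0.
move=> w; rewrite lt_min => /andP[/ltW w1 w2].
have -> : expC w - expC z - expC z * (w - z) = expC z * (expC (w - z) - 1 - (w - z)).
  have E : expC w = expC z * expC (w - z) by rewrite -expCD addrC subrK.
  by rewrite E; ring.
rewrite absCM absC_expC; apply: (@le_trans _ _ (K * absC (w - z) ^+ 2)).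
  by rewrite /K -mulrA ler_wpM2l ?(ltW (expR_gt0 _)) //; exact: expC_rem2.
move: w2; rewrite ltr_pdivlMr // => /ltW w2.
by rewrite expr2 mulrA ler_wpM2r ?absC_ge0 // mulrC.
Qed.

Lemma cdiff_comp (g f : C -> C) (z : C) : cdiff f z -> cdiff g (f z) -> cdiff (fun w => g (f w)) z.
Proof.
move=> fz [m gm]; have [l fl] := fz.
exists (m * l) => e e0.
pose K := 1 + absC l; pose M := 1 + absC m.
have K0 : 0 < K by rewrite /K ltr_wpDr // absC_ge0.
have M0 : 0 < M by rewrite /M ltr_wpDr // absC_ge0.
have e1 : 0 < e / (2 * K) by rewrite divr_gt0 // mulr_gt0.
have e2 : 0 < e / (2 * M) by rewrite divr_gt0 // mulr_gt0.
have [d1 d10 H1] := gm _ e1.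
have [d2 d20 H2] := fl _ e2.
have [d3 d30 H3] := fl _ ltr01.
exists (Num.min (Num.min d2 d3) (d1 / K)).
  by rewrite !lt_min d20 d30 divr_gt0.
move=> w; rewrite !lt_min => /andP[/andP[w2 w3] w1].
have fK : absC (f w - f z) <= K * absC (w - z).
  have -> : f w - f z = (f w - f z - l * (w - z)) + l * (w - z) by rewrite subrK.
  apply: le_trans (absCD _ _) _; rewrite absCM mulrDl lerD2r; exact: H3.
have fd : absC (f w - f z) < d1.
  apply: le_lt_trans fK _; by rewrite mulrC -ltr_pdivlMr.
have -> : g (f w) - g (f z) - m * l * (w - z) =
   (g (f w) - g (f z) - m * (f w - f z)) + m * (f w - f z - l * (w - z)) by ring.
apply: le_trans (absCD _ _) _; rewrite absCM.
have -> : e * absC (w - z) = e / (2 * K) * (K * absC (w - z)) + M * (e / (2 * M) * absC (w - z)).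
  by field; rewrite !gt_eqF.
apply: lerD.
  by apply: le_trans (H1 _ fd) _; rewrite ler_wpM2l // ltW.
apply: ler_pM; rewrite ?absC_ge0 ?H2 //.
by rewrite /M lerDr.
Qed.

Lemma cdiff_expC_comp (f : C -> C) (z : C) : cdiff f z -> cdiff (fun w => expC (f w)) z.
Proof. by move=> fz; apply: (@cdiff_comp expC f) => //; exact: cdiff_expC. Qed.

Lemma expRN_le_inv (x : R) (k : nat) : 0 < x -> expR (- x) <= k.+1`!%:R / x ^+ k.+1.
Proof.
move=> x0; rewrite expRN -[leRHS]invrK lef_pV2 ?posrE ?expR_gt0 //; last first.
  by rewrite invf_div divr_gt0 ?exprn_gt0 // ltr0n fact_gt0.
rewrite invf_div; apply: le_trans (expR_ge1Dxn k (ltW x0)).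
by rewrite lerDr.
Qed.

End ComplexExponential.

(** * Determinant bounds, contractions and the matrix [T(z)] *)

Section DeterminantEstimates.
Variable R : realType.
Local Notation C := (Cx R).

Lemma cdiff_det n (A : C -> 'M[C]_n) (z : C) :
  (forall i j, cdiff (fun w => A w i j) z) -> cdiff (fun w => \det (A w)) z.
Proof.
move=> Ad; rewrite /determinant; apply: cdiff_sum => s.
by apply: cdiffM; [exact: cdiff_cst|apply: cdiff_prod => i; exact: Ad].
Qed.

Lemma cdiff_adj n (A : C -> 'M[C]_n) (z : C) :
  (forall i j, cdiff (fun w => A w i j) z) -> forall i j, cdiff (fun w => (\adj (A w)) i j) z.
Proof.
move=> Ad i j; under eq_fun do rewrite mxE /cofactor.
apply: cdiffM; first exact: cdiff_cst.
apply: cdiff_det => p q; under eq_fun do rewrite !mxE; exact: Ad.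
Qed.

Lemma absC_sign (b : bool) : absC ((-1) ^+ b : C) = 1.
Proof. by case: b; rewrite ?expr1 ?expr0 ?absCN absC1. Qed.

Lemma det_bound n (A : 'M[C]_n) (B : R) : (forall i j, absC (A i j) <= B) ->
  absC (\det A) <= n`!%:R * B ^+ n.
Proof.
move=> AB; apply: le_trans (absC_sum _ _ _) _.
apply: (@le_trans _ _ (\sum_(s : 'S_n) B ^+ n)).
  apply: ler_sum => s _; rewrite absCM absC_sign mul1r absC_prod.
  rewrite -[X in _ <= B ^+ X]card_ord -prodr_const; apply: ler_prod => i _.
  by rewrite absC_ge0 AB.
by rewrite sumr_const card_Sn mulr_natl.
Qed.

Lemma adj_bound n (A : 'M[C]_n) (B : R) : 1 <= B -> (forall i j, absC (A i j) <= B) ->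
  forall i j, absC ((\adj A) i j) <= n`!%:R * B ^+ n.
Proof.
case: n A => [|n] A B1 AB i j; first by case: i.
rewrite mxE /cofactor absCM absCX absCN absC1 expr1n mul1r /=.
apply: le_trans (@det_bound _ _ B _) _ => [p q|]; first by rewrite !mxE.
have B0 : 0 <= B by rewrite (le_trans ler01).
by apply: ler_pM; rewrite ?exprn_ge0 // ?ler_nat ?factS ?leq_pmull // exprS ler_peMl ?exprn_ge0.
Qed.

Lemma prod_lip (I : Type) (r : seq I) (F G : I -> C) (B dl : R) : 1 <= B ->
  (forall i, absC (F i) <= B) -> (forall i, absC (G i) <= B) ->
  (forall i, absC (F i - G i) <= dl) ->
  absC (\prod_(i <- r) F i - \prod_(i <- r) G i) <= (size r)%:R * B ^+ size r * dl.
Proof.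
move=> B1 FB GB FG; have B0 : 0 <= B by rewrite (le_trans ler01).
elim: r => [|i r IH]; first by rewrite !big_nil subrr absC0 !mul0r.
have dl0 : 0 <= dl := le_trans (absC_ge0 _) (FG i).
rewrite !big_cons /=.
have -> : F i * \prod_(j <- r) F j - G i * \prod_(j <- r) G j =
   F i * (\prod_(j <- r) F j - \prod_(j <- r) G j) + (F i - G i) * \prod_(j <- r) G j by ring.
apply: le_trans (absCD _ _) _; rewrite !absCM.
have GP : absC (\prod_(j <- r) G j) <= B ^+ size r.
  rewrite absC_prod; elim: (r) => [|k s IHs]; first by rewrite big_nil expr0.
  by rewrite big_cons /= exprS; apply: ler_pM; rewrite ?absC_ge0 ?prodr_ge0 //= => *; rewrite absC_ge0.
apply: (@le_trans _ _ (B * ((size r)%:R * B ^+ size r * dl) + dl * B ^+ size r)).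
  by apply: lerD; apply: ler_pM; rewrite ?absC_ge0.
rewrite -natr1 exprS.
have h : 0 <= dl * B ^+ size r by rewrite mulr_ge0 // exprn_ge0.
have h2 : dl * B ^+ size r <= B * (dl * B ^+ size r) by rewrite ler_peMl.
apply: (@le_trans _ _ (B * ((size r)%:R * B ^+ size r * dl) + B * (dl * B ^+ size r))).
  by rewrite lerD2l.
by rewrite le_eqVlt; apply/orP; left; apply/eqP; ring.
Qed.

Lemma det_lip n (A A' : 'M[C]_n) (B dl : R) : 1 <= B ->
  (forall i j, absC (A i j) <= B) -> (forall i j, absC (A' i j) <= B) ->
  (forall i j, absC (A i j - A' i j) <= dl) ->
  absC (\det A - \det A') <= n`!%:R * (n%:R * B ^+ n * dl).
Proof.
move=> B1 AB AB' AA; rewrite /determinant -sumrB.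
apply: le_trans (absC_sum _ _ _) _.
apply: (@le_trans _ _ (\sum_(s : 'S_n) (n%:R * B ^+ n * dl))).
  apply: ler_sum => s _; rewrite -mulrBr absCM absC_sign mul1r.
  have := @prod_lip _ (index_enum 'I_n) (fun i => A i (s i)) (fun i => A' i (s i)) B dl B1.
  have -> : size (index_enum 'I_n) = n.
    by rewrite -[RHS]card_ord cardE; congr size; rewrite enumT.
  by apply.
by rewrite sumr_const card_Sn [leRHS]mulr_natl.
Qed.

Definition sqnorm n (x : 'cV[C]_n) : R := \sum_i absC (x i 0) ^+ 2.

Lemma sqnorm_ge0 n (x : 'cV[C]_n) : 0 <= sqnorm x.
Proof. by apply: sumr_ge0 => i _; exact: sqr_ge0. Qed.

Lemma sqnorm_eq0 n (x : 'cV[C]_n) : sqnorm x = 0 -> x = 0.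
Proof.
move=> /eqP; rewrite psumr_eq0 => [|i _]; last exact: sqr_ge0.
move=> /allP h; apply/matrixP => i j; rewrite ord1 !mxE.
by have := h i; rewrite mem_index_enum => /(_ isT); rewrite sqrf_eq0 absC_eq0 => /eqP.
Qed.

Lemma sqnorm_entry n (x : 'cV[C]_n) i : absC (x i 0) ^+ 2 <= sqnorm x.
Proof. by rewrite /sqnorm (bigD1 i) //= lerDl sumr_ge0 // => j _; exact: sqr_ge0. Qed.

Lemma sqnorm_entry_le n (x : 'cV[C]_n) i (B : R) : 0 <= B -> sqnorm x <= B ^+ 2 -> absC (x i 0) <= B.
Proof.
move=> B0 xB; rewrite -(@ler_pXn2r _ 2) ?nnegrE ?absC_ge0 //.
exact: le_trans (sqnorm_entry _ _) xB.
Qed.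

Definition contraction n (S : 'M[C]_n) := forall x : 'cV[C]_n, sqnorm (S *m x) <= sqnorm x.

Lemma contraction_entry n (S : 'M[C]_n) i j : contraction S -> absC (S i j) <= 1.
Proof.
move=> cS; have := cS (delta_mx j 0).
have -> : sqnorm (delta_mx j 0) = 1.
  rewrite /sqnorm (bigD1 j) //= mxE !eqxx absC1 expr1n big1 ?addr0 // => k kj.
  by rewrite mxE (negPf kj) absC0 expr0n.
rewrite -colE -[leRHS](expr1n _ 2) => h.
by have := @sqnorm_entry_le _ (col j S) i 1 ler01 h; rewrite mxE.
Qed.

(* Weighted form of Minkowski's inequality, with the weights that make it sharp for the geometric series. *)
Lemma sqnorm_perturb n (x b y : 'cV[C]_n) (t : R) : 0 <= t -> t < 1 -> x = b + y ->
  sqnorm y <= t ^+ 2 * sqnorm x -> sqnorm x * (1 - t) ^+ 2 <= sqnorm b.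
Proof.
move=> t0 t1 xE yx.
have [tz|tz] := eqVneq t 0.
  have y0 : sqnorm y = 0 by apply/eqP; rewrite eq_le sqnorm_ge0 andbT (le_trans yx) // tz expr0n mul0r.
  by rewrite xE (sqnorm_eq0 y0) addr0 tz subr0 expr1n mulr1.
have tp : 0 < t by rewrite lt_neqAle eq_sym tz.
have key : sqnorm x <= sqnorm b / (1 - t) + sqnorm y / t.
  rewrite /sqnorm !mulr_suml -big_split /=; apply: ler_sum => i _.
  have : absC (x i 0) <= absC (b i 0) + absC (y i 0) by rewrite xE mxE absCD.
  have := absC_ge0 (x i 0); set p := absC (x i 0); set q := absC (b i 0); set r := absC (y i 0).
  move=> p0 pqr.
  have h1 : p ^+ 2 <= (q + r) ^+ 2 by rewrite lerXn2r ?nnegrE // (le_trans p0).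
  apply: le_trans h1 _.
  rewrite -subr_ge0.
  have -> : q ^+ 2 / (1 - t) + r ^+ 2 / t - (q + r) ^+ 2 = (t * q - (1 - t) * r) ^+ 2 / (t * (1 - t)).
    by field; rewrite tz subr_eq0 gt_eqF.
  by rewrite divr_ge0 ?sqr_ge0 // mulr_ge0 ?(ltW tp) // subr_ge0 ltW.
have h2 : sqnorm y / t <= t * sqnorm x by rewrite ler_pdivrMr // mulrAC -expr2.
have h3 : sqnorm x * (1 - t) <= sqnorm b / (1 - t) by lra.
have t1' : 0 < 1 - t by lra.
by rewrite expr2 mulrA -ler_pdivlMr.
Qed.

Definition Tmx n (S : 'M[C]_n) (L : 'I_n -> R) (z : C) : 'M[C]_n :=
  \matrix_(i, j) ((i == j)%:R - S i j * expC (ic R * rc (L j) * z)).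

Lemma cdiff_expZ (c z : C) : cdiff (fun w => expC (c * w)) z.
Proof. by apply: cdiff_expC_comp; apply: cdiffM; [exact: cdiff_cst|exact: cdiff_id]. Qed.

Lemma cdiff_Tmx n (S : 'M[C]_n) L (z : C) i j : cdiff (fun w => Tmx S L w i j) z.
Proof.
under eq_fun do rewrite mxE.
apply: cdiffB; first exact: cdiff_cst.
by apply: cdiffM; [exact: cdiff_cst|exact: cdiff_expZ].
Qed.

Lemma Re_iLz (x : R) (z : C) : Re (ic R * rc x * z) = - (x * Im z).
Proof. by rewrite !ReM !ImM /=; ring. Qed.

Lemma Tmx_mul n (S : 'M[C]_n) L (z : C) (x : 'cV[C]_n) :
  Tmx S L z *m x = x - S *m \col_j (expC (ic R * rc (L j) * z) * x j 0).
Proof.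
apply/colP => i; rewrite !mxE.
under eq_bigr do rewrite mxE mulrBl.
rewrite sumrB; congr (_ - _).
  by rewrite (bigD1 i) //= eqxx mul1r big1 ?addr0 // => j ji; rewrite eq_sym (negPf ji) mul0r.
by apply: eq_bigr => j _; rewrite mxE mulrA.
Qed.

(** For [Im z > 0] propagation shrinks every amplitude by at least [exp (- lmin Im z)], so [S D(z)]
    has norm below 1. This is the Neumann bound on the inverse, written as a lower bound on
    [T(z) x]. *)
Lemma Tmx_upper n (S : 'M[C]_n) L (z : C) (lmin : R) (x : 'cV[C]_n) : contraction S ->
  0 < lmin -> (forall j, lmin <= L j) -> 0 < Im z ->
  sqnorm x * (1 - expR (- (lmin * Im z))) ^+ 2 <= sqnorm (Tmx S L z *m x).
Proof.
move=> cS l0 lL z0; set t := expR _.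
pose y : 'cV[C]_n := S *m \col_j (expC (ic R * rc (L j) * z) * x j 0).
apply: (@sqnorm_perturb _ x (Tmx S L z *m x) y t).
- exact/ltW/expR_gt0.
- by rewrite /t -expR0 ltr_expR oppr_lt0 mulr_gt0.
- by rewrite Tmx_mul /y subrK.
- rewrite /y; apply: le_trans (cS _) _.
  rewrite /sqnorm mulr_sumr; apply: ler_sum => j _; rewrite mxE absCM exprMn.
  rewrite ler_wpM2r ?sqr_ge0 // lerXn2r ?nnegrE ?absC_ge0 ?(ltW (expR_gt0 _)) //.
  by rewrite absC_expC Re_iLz /t ler_expR lerN2 ler_pM2r.
Qed.

Lemma Tmx_det_neq0 n (S : 'M[C]_n) L (z : C) (lmin : R) : contraction S ->
  0 < lmin -> (forall j, lmin <= L j) -> 0 < Im z -> \det (Tmx S L z) != 0.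
Proof.
move=> cS l0 lL z0; rewrite -det_tr; apply/negP => /eqP/eqP/det0P[v v0 vA].
have E : Tmx S L z *m v^T = 0 by apply: trmx_inj; rewrite trmx_mul trmxK vA trmx0.
have := @Tmx_upper _ S L z lmin v^T cS l0 lL z0; rewrite E.
have -> : sqnorm (0 : 'cV[C]_n) = 0 by rewrite /sqnorm big1 // => i _; rewrite mxE absC0 expr0n.
set t := expR _.
have t1 : t < 1 by rewrite /t -expR0 ltr_expR oppr_lt0 mulr_gt0.
move=> h; have : sqnorm v^T = 0.
  apply/eqP; rewrite eq_le sqnorm_ge0 andbT.
  by move: h; rewrite pmulr_lle0 // exprn_gt0 // subr_gt0.
by move=> /sqnorm_eq0 vz; move: v0; rewrite -[v]trmxK vz trmx0 eqxx.
Qed.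

Lemma one_sub_expRN (t : R) : 0 <= t -> t <= 1 -> t / 2 <= 1 - expR (- t).
Proof.
move=> t0 t1; have h := expR_ge1Dx t; have e0 := expR_gt0 t.
rewrite expRN.
have : (expR t)^-1 <= (1 + t)^-1 by rewrite lef_pV2 ?posrE //; lra.
have : (1 + t)^-1 <= 1 - t / 2.
  rewrite -[leLHS]mul1r ler_pdivrMr; last by lra.
  nra.
lra.
Qed.

Lemma solve_det n (A : 'M[C]_n) (a b : 'cV[C]_n) i : \det A != 0 -> A *m a = b ->
  a i 0 = (\adj A *m b) i 0 / \det A.
Proof.
move=> d0 <-; rewrite mulmxA mul_adj_mx mul_scalar_mx mxE mulrC mulKf //.
Qed.

Lemma adj_solve n (A : 'M[C]_n) (b : 'cV[C]_n) : \det A != 0 ->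
  A *m ((\det A)^-1 *: (\adj A *m b)) = b.
Proof.
by move=> d0; rewrite -scalemxAr mulmxA mul_mx_adj mul_scalar_mx scalerA mulVf // scale1r.
Qed.

Lemma Tmx_entry n (S : 'M[C]_n) L (lmax : R) (z : C) i j : contraction S ->
  (forall j, 0 <= L j <= lmax) -> lmax * `|Im z| <= 1 ->
  absC (Tmx S L z i j) <= 1 + expR 1.
Proof.
move=> cS lL z1; rewrite mxE; apply: le_trans (absCB _ _) _; apply: lerD.
  by case: (i == j); rewrite ?absC1 ?absC0.
rewrite absCM absC_expC Re_iLz -[leRHS]mul1r; apply: ler_pM; rewrite ?absC_ge0 ?(ltW (expR_gt0 _)) //.
  exact: contraction_entry.
rewrite ler_expR; apply: le_trans (ler_norm _) _; rewrite normrN normrM.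
have /andP[h1 h2] := lL j; apply: le_trans z1; rewrite ler_wpM2r // ger0_norm //.
Qed.

End DeterminantEstimates.

(** * A square contour on which the determinant is bounded below *)

Section ZeroFreeContour.
Variable R : realType.
Local Notation C := (Cx R).

(** Pigeonhole: [N + 1] candidate radii spaced by [2 g] cannot all have one of the at most [N]
    points within distance less than [g]. *)
Lemma gap_radius (s : seq R) (N : nat) (rho : R) : 0 < rho -> (size s <= N)%N ->
  exists r, [/\ rho / 4 <= r, r <= rho / 2 &
    forall x, x \in s -> rho / (8 * N.+1%:R) <= `|x - r|].
Proof.
move=> rho0 sN.
have N0 : (0 : R) < N.+1%:R by rewrite ltr0n.
pose g := rho / (8 * N.+1%:R); have g0 : 0 < g by rewrite divr_gt0 // mulr_gt0.
(* The gap is chosen so that [N + 1] steps of [2 g] span exactly [[rho/4, rho/2]]; the candidates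
   use the indices [0] to [N]. *)
have gE : rho / 4 = 2 * g * N.+1%:R by rewrite /g; field; rewrite nat1r gt_eqF.
pose rr (k : 'I_N.+1) := rho / 4 + k%:R * (2 * g).
have rr1 k : rho / 4 <= rr k by rewrite /rr lerDl mulr_ge0 // mulr_ge0 // ltW.
have rr2 k : rr k <= rho / 2.
  have -> : rho / 2 = rho / 4 + rho / 4 by field.
  rewrite /rr lerD2l gE mulrC ler_pM2l ?mulr_gt0 // ler_nat; exact/ltnW/ltn_ord.
apply: contrapT => /forallNP nex.
have bad k : exists2 x, x \in s & `|x - rr k| < g.
  apply: contrapT => nk; apply: (nex (rr k)); split => // x xs.
  by rewrite leNgt; apply/negP => xg; apply: nk; exists x.
have [f fP] := choice (fun k => (let: ex_intro2 x h1 h2 := bad k in ex_intro _ x (conj h1 h2)) :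
   exists x, x \in s /\ `|x - rr k| < g).
have finj : injective f.
  move=> k k' kk; have [_ h1] := fP k; have [_ h2] := fP k'; rewrite -kk in h2.
  apply/val_inj/eqP; rewrite -(eqr_nat R) -subr_eq0 -normr_eq0.
  have : `|rr k - rr k'| < 2 * g.
    have -> : rr k - rr k' = (f k - rr k') - (f k - rr k) by ring.
    by apply: le_lt_trans (ler_normB _ _) _; lra.
  have -> : rr k - rr k' = (k%:R - k'%:R) * (2 * g) by rewrite /rr; ring.
  have g2 : 0 < 2 * g by lra.
  rewrite normrM (gtr0_norm g2) -[ltRHS]mul1r ltr_pM2r //.
  have -> : (k%:R - k'%:R : R) = (k%:Z - k'%:Z)%:~R by rewrite rmorphB.
  rewrite -intr_norm -[X in _ < X](mulr1z) ltr_int => h.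
  have -> : `|k%:Z - k'%:Z| = 0.
    by apply/eqP; rewrite eq_le normr_ge0 andbT -ltzD1 add0r.
  by [].
have : (size (map f (enum 'I_N.+1)) <= size s)%N.
  apply: uniq_leq_size; first by rewrite map_inj_uniq ?enum_uniq.
  by move=> x /mapP[k _ ->]; have [] := fP k.
rewrite size_map size_enum_ord => /leq_trans/(_ sN).
by rewrite ltnn.
Qed.

(** The sup norm of the plane, whose level sets are boundaries of squares, the contours to which the
    maximum principle applies. *)
Definition maxabs (z : C) : R := Num.max `|Re z| `|Im z|.

Lemma maxabs_lip (z w : C) : `|maxabs z - maxabs w| <= absC (z - w).
Proof.
suff H (u v : C) : maxabs u - maxabs v <= absC (u - v).
  by rewrite ler_norml lerNl opprB H andbT absCC H.
rewrite lerBlDr /maxabs ge_max; apply/andP; split.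
- apply: le_trans (_ : absC (u - v) + `|Re v| <= _); last by rewrite lerD2l le_max lexx.
  rewrite -lerBlDr; apply: le_trans (lerB_dist _ _) _.
  by rewrite -ReN -ReD absC_Re.
- apply: le_trans (_ : absC (u - v) + `|Im v| <= _); last by rewrite lerD2l le_max lexx orbT.
  rewrite -lerBlDr; apply: le_trans (lerB_dist _ _) _.
  by rewrite -ImN -ImD absC_Im.
Qed.

Lemma size_prod_le (I : Type) (r : seq I) (F : I -> {poly C}) (d : nat) :
  (forall i, (size (F i) <= d.+1)%N) -> (size (\prod_(i <- r) F i)%R <= (size r * d).+1)%N.
Proof.
move=> Fd; elim: r => [|i r IH]; first by rewrite big_nil size_polyC oner_eq0.
rewrite big_cons; apply: leq_trans (size_polyMleq _ _) _.
have := Fd i; rewrite /= mulSn; move: IH; set a := size _; set b := size _.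
by move=> h1 h2; rewrite -subn1 leq_subLR; apply: leq_trans (leq_add h2 h1) _; rewrite addSn addnS !add1n.
Qed.

Lemma size_det_le n (P : 'M[{poly C}]_n) d : (forall i j, (size (P i j) <= d.+1)%N) ->
  (size (\det P)%R <= (n * d).+1)%N.
Proof.
move=> Pd; apply: leq_trans (size_sum _ _ _) _; apply/bigmax_leqP => s _.
have -> : (-1) ^+ s * \prod_i P i (s i) = ((-1) ^+ s : C) *: \prod_i P i (s i).
  by rewrite -mul_polyC; congr (_ * _); case: (odd_perm s); rewrite ?expr1 ?expr0 ?polyCN.
apply: leq_trans (size_scale_leq _ _) _.
have sn : size (index_enum 'I_n) = n.
  by rewrite -[RHS]card_ord cardE; congr size; rewrite enumT.
by rewrite -[X in (X * d)%N]sn; apply: size_prod_le.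
Qed.

(** The comparison is made root by root. The square is chosen at distance at least
    [rho / (8 (N + 1))] from every root [x], so [|w - x| <= |w - z| + |z - x|] is at most
    [16 (N + 1) + 1] times [|z - x|]. *)
Lemma poly_ratio (p : {poly C}) (N : nat) (rho : R) : 0 < rho -> (size p <= N.+1)%N ->
  exists r, [/\ rho / 4 <= r, r <= rho / 2 &
   forall z w : C, maxabs z = r -> absC (w - z) <= 2 * rho ->
     absC p.[w] <= (16 * N.+1%:R + 1) ^+ N * absC p.[z]].
Proof.
move=> rho0 pN.
have [->|p0] := eqVneq p 0.
  exists (rho / 2); split; [lra|lra|] => z w _ _.
  by rewrite !horner0 absC0 mulr0.
have [s sE] := closed_field_poly_normal p.
have ss : (size s <= N)%N.
  rewrite -ltnS; apply: leq_trans pN; rewrite sE size_scale ?lead_coef_eq0 //.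
  by rewrite size_prod_XsubC.
have [r [r1 r2 H]] := @gap_radius (map maxabs s) N rho rho0 (ltac:(by rewrite size_map)).
exists r; split => // z w zr wz.
have N0 : (0 : R) < N.+1%:R by rewrite ltr0n.
pose k : R := 16 * N.+1%:R + 1.
have k1 : 1 <= k by rewrite /k lerDr mulr_ge0 // ltW.
have k0 : 0 <= k by lra.
have root x : x \in s -> absC (w - x) <= k * absC (z - x).
  move=> xs; have := H _ (map_f maxabs xs); rewrite -zr => g1.
  have g2 : rho / (8 * N.+1%:R) <= absC (z - x).
    by apply: le_trans g1 _; rewrite distrC; exact: maxabs_lip.
  have -> : w - x = (w - z) + (z - x) by ring.
  apply: le_trans (absCD _ _) _; rewrite /k mulrDl mul1r lerD2r.
  apply: le_trans wz _.
  have -> : 2 * rho = 16 * N.+1%:R * (rho / (8 * N.+1%:R)).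
    by field; rewrite nat1r gt_eqF.
  by rewrite ler_wpM2l // mulr_ge0 // ltW.
rewrite sE !hornerZ !absCM mulrCA ler_wpM2l ?absC_ge0 //.
rewrite !horner_prod !absC_prod.
apply: (@le_trans _ _ (\prod_(x <- s) (k * absC (z - x)))).
  rewrite big_seq [leRHS]big_seq; apply: ler_prod => x xs.
  by rewrite hornerXsubC absC_ge0 root.
rewrite big_split /=; under [X in _ * X <= _]eq_bigr do rewrite -hornerXsubC.
apply: ler_wpM2r; first by apply: prodr_ge0 => *; exact: absC_ge0.
have -> : \prod_(x <- s) k = k ^+ size s.
  by elim: (s) => [|x t IHt]; rewrite ?big_nil ?big_cons ?expr0 // IHt exprS.
exact: ler_weXn2l.
Qed.

(** The determinant is at least of order [rho^n] at a point above [lam], where the Neumann bound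
    holds. The Taylor polynomial differs from it by [O(rho^(n+1))], and [poly_ratio] carries the
    lower bound from that point to the square. *)
Lemma zero_free_contour n (lmin lmax : R) : 0 < lmin -> lmin <= lmax ->
  exists rho0 c1 : R, [/\ 0 < rho0, 0 < c1 &
   forall (S : 'M[C]_n) L (lam rho : R), contraction S -> (forall j, lmin <= L j <= lmax) ->
   0 < rho -> rho < rho0 ->
   exists r, [/\ rho / 4 <= r, r <= rho / 2 &
     forall z, maxabs (z - rc lam) = r -> c1 * rho ^+ n <= absC (\det (Tmx S L z))]].
Proof.
move=> l0 ll; have lx0 : 0 < lmax by lra.
pose e1 : R := expR 1; have e10 : 0 < e1 by exact: expR_gt0.
pose Ce := 2 ^+ n.+1 * lmax ^+ n.+1 * e1.
have Ce0 : 0 < Ce by rewrite !mulr_gt0 // exprn_gt0.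
pose B := 1 + e1 + Ce; have B1 : 1 <= B by rewrite /B; lra.
pose K := n`!%:R * (n%:R * B ^+ n * Ce).
have K0 : 0 <= K by rewrite !mulr_ge0 // ?exprn_ge0 //; lra.
pose k := lmin / 4; have k0 : 0 < k by rewrite /k; lra.
have nf0 : (0 : R) < n`!%:R by rewrite ltr0n fact_gt0.
pose c2 := k ^+ n / n`!%:R; have c20 : 0 < c2 by rewrite divr_gt0 // exprn_gt0.
pose N := (n * n)%N.
pose q : R := (16 * N.+1%:R + 1) ^+ N.
have q1 : 1 <= q by apply: exprn_ege1; rewrite lerDr mulr_ge0.
have q0 : 0 < q by lra.
(* The factor 4 leaves room for two truncation errors of at most [c1 rho^n] each, one at the
   reference point and one on the contour. *)
pose c1 := c2 / (4 * q); have c10 : 0 < c1 by rewrite divr_gt0 // mulr_gt0.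
exists (Num.min (Num.min 1 lmax^-1) (c1 / (K + 1))), c1; split => //.
  by rewrite !lt_min ltr01 invr_gt0 lx0 divr_gt0 //; lra.
move=> S L lam rho cS lL rho0; rewrite !lt_min => /andP[/andP[rho1 rhol] rhoc].
have lrho : lmax * rho <= 1 by rewrite mulrC -ler_pdivlMr // mul1r ltW.
have Krho : K * rho <= c1.
  move: rhoc; rewrite ltr_pdivlMr; last by lra.
  by move=> /ltW; apply: le_trans; rewrite mulrC ler_wpM2l ?(ltW rho0) // lerDl.
have lLn j : lmin <= L j by case/andP: (lL j).
have lL0 j : 0 <= L j <= lmax by case/andP: (lL j) => h1 ->; rewrite (le_trans _ h1) // ltW.
pose ph j := expC (ic R * rc (L j) * rc lam).
pose cf j := ic R * rc (L j).
(* The variable is [z - lam]; the phase at [lam] is a constant of modulus 1. Truncation at degree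
   [n] makes the error one order smaller than [rho^n], and the determinant has degree at most
   [n * n = N]. *)
pose P : 'M[{poly C}]_n := \matrix_(i, j)
  (((i == j)%:R : C)%:P - (S i j * ph j) *: \poly_(m < n.+1) (cf j ^+ m * rc (m`!%:R^-1))).
have Psize : (size (\det P)%R <= N.+1)%N.
  apply: size_det_le => i j; rewrite mxE.
  apply: leq_trans (size_polyD _ _) _; rewrite geq_max size_polyN; apply/andP; split.
    by apply: leq_trans (size_polyC_leq1 _) _.
  by apply: leq_trans (size_scale_leq _ _) (size_poly _ _).
have Phor (zt : C) : (\det P).[zt] = \det (\matrix_(i, j)
     ((i == j)%:R - S i j * ph j * expT n.+1 (cf j * zt))).
  rewrite -[LHS]/(horner_eval zt (\det P)) -det_map_mx; congr (\det _).
  apply/matrixP => i j; rewrite !mxE /= /horner_eval hornerD hornerN hornerC hornerZ horner_poly.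
  rewrite /expT (eq_bigr (fun m : 'I_n.+1 => (cf j * zt) ^+ m * rc (m`!%:R^-1))) // => m _.
  by rewrite [in RHS](exprMn m (cf j) zt) mulrAC.
have phabs j : absC (ph j) = 1 by rewrite absC_expC Re_iLz /= mulr0 oppr0 expR0.
have cfb j (zt : C) : absC zt <= rho -> absC (cf j * zt) <= lmax * rho.
  move=> zr; rewrite !absCM absC_ic mul1r absC_rc; have /andP[h1 h2] := lL0 j.
  by rewrite ger0_norm //; apply: ler_pM => //; exact: absC_ge0.
have rem j (zt : C) : absC zt <= rho ->
    absC (expC (cf j * zt) - expT n.+1 (cf j * zt)) <= Ce * rho ^+ n.+1.
  move=> zr; apply: le_trans (expT_rem _ _) _.
  have h := cfb j _ zr.
  have -> : Ce * rho ^+ n.+1 = 2 ^+ n.+1 * (lmax * rho) ^+ n.+1 * e1.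
    by rewrite /Ce exprMn; ring.
  apply: ler_pM; rewrite ?(ltW (expR_gt0 _)) //.
  - by rewrite mulr_ge0 // exprn_ge0 // absC_ge0.
  - by rewrite ler_wpM2l ?exprn_ge0 // lerXn2r ?nnegrE ?absC_ge0 // (le_trans _ h) ?absC_ge0.
  - by rewrite ler_expR (le_trans h).
have TE (zt : C) i j : Tmx S L (rc lam + zt) i j = (i == j)%:R - S i j * ph j * expC (cf j * zt).
  by rewrite mxE mulrDr expCD mulrA.
have diff (zt : C) : absC zt <= rho ->
    absC (\det (Tmx S L (rc lam + zt)) - (\det P).[zt]) <= K * rho ^+ n.+1.
  move=> zr; rewrite Phor.
  have -> : K * rho ^+ n.+1 = n`!%:R * (n%:R * B ^+ n * (Ce * rho ^+ n.+1)) by rewrite /K; ring.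
  have d1 i j : absC (Tmx S L (rc lam + zt) i j - ((i == j)%:R - S i j * ph j * expT n.+1 (cf j * zt)))
       <= Ce * rho ^+ n.+1.
    rewrite TE.
    have -> : (i == j)%:R - S i j * ph j * expC (cf j * zt) -
       ((i == j)%:R - S i j * ph j * expT n.+1 (cf j * zt)) =
       - (S i j * ph j * (expC (cf j * zt) - expT n.+1 (cf j * zt))) by ring.
    rewrite absCN !absCM phabs mulr1 -[leRHS]mul1r; apply: ler_pM; rewrite ?absC_ge0 ?rem //.
    exact: contraction_entry.
  have t1 i j : absC (Tmx S L (rc lam + zt) i j) <= 1 + e1.
    apply: Tmx_entry => //; rewrite ImD /= add0r; apply: le_trans lrho.
    rewrite ler_wpM2l ?(ltW lx0) //; exact: le_trans (absC_Im _) zr.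
  apply: det_lip => // i j; first by apply: le_trans (t1 i j) _; rewrite /B lerDl ltW.
    rewrite mxE; set Y := _ - _ * _.
    have -> : Y = Tmx S L (rc lam + zt) i j - (Tmx S L (rc lam + zt) i j - Y) by rewrite subKr.
    apply: le_trans (absCB _ _) _; rewrite /B; apply: lerD => //.
    apply: le_trans (d1 i j) _; rewrite ler_piMr ?(ltW Ce0) // exprn_ile1 ?(ltW rho0) //; exact: ltW.
  by rewrite [X in absC (_ - X)]mxE d1.
(* The reference point. At height [rho / 2] the entries of [T^-1] are at most [1 / (k rho)], so
   [det T^-1] is at most [n! / (k rho)^n], whence the constant [c2]. *)
pose zs : C := ic R * rc (rho / 2).
have zsabs : absC zs = rho / 2 by rewrite absCM absC_ic mul1r absC_rc gtr0_norm // divr_gt0.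
have low : c2 * rho ^+ n <= absC (\det (Tmx S L (rc lam + zs))).
  have imz : Im (rc lam + zs) = rho / 2 by rewrite ImD ImM /=; ring.
  have imp : 0 < Im (rc lam + zs) by rewrite imz divr_gt0.
  set T := Tmx _ _ _.
  have d0 : \det T != 0 by apply: Tmx_det_neq0 cS l0 lLn imp.
  have Tu : T \in unitmx by rewrite unitmxE unitfE.
  have inv i j : absC (invmx T i j) <= (k * rho)^-1.
    have := @Tmx_upper _ _ S L _ lmin (col j (invmx T)) cS l0 lLn imp.
    have -> : T *m col j (invmx T) = delta_mx j 0.
      by rewrite colE mulmxA mulmxV // mul1mx.
    have -> : sqnorm (delta_mx j 0 : 'cV[C]_n) = 1.
      rewrite /sqnorm (bigD1 j) //= mxE !eqxx absC1 expr1n big1 ?addr0 // => m mj.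
      by rewrite mxE (negPf mj) absC0 expr0n.
    rewrite imz.
    have kr : k * rho <= 1 - expR (- (lmin * (rho / 2))).
      apply: le_trans (_ : lmin * (rho / 2) / 2 <= _); first by rewrite /k; clear; lra.
      have rh : rho / 2 <= rho by clear -rho0; lra.
      apply: one_sub_expRN; first by rewrite mulr_ge0 ?divr_ge0 ?(ltW l0) ?(ltW rho0).
      by apply: le_trans lrho; apply: ler_pM; rewrite ?divr_ge0 ?(ltW l0) ?(ltW rho0).
    have kr0 : 0 < k * rho by rewrite mulr_gt0.
    move=> h; have h2 : sqnorm (col j (invmx T)) * (k * rho) ^+ 2 <= 1.
      apply: le_trans h; rewrite ler_wpM2l ?sqnorm_ge0 // lerXn2r ?nnegrE //; first exact: ltW.
      exact: le_trans (ltW kr0) kr.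
    have := @sqnorm_entry_le _ _ (col j (invmx T)) i (k * rho)^-1; rewrite mxE; apply.
      by rewrite invr_ge0 ltW.
    by rewrite exprVn -[leRHS]mul1r ler_pdivlMr // exprn_gt0.
  have := det_bound inv; rewrite det_inv absCV => h.
  have dp : 0 < absC (\det T) by rewrite absC_gt0.
  have kr0 : 0 < (k * rho) ^+ n by rewrite exprn_gt0 // mulr_gt0.
  move: h; rewrite exprVn -[leLHS]mul1r ler_pdivrMr // mulrAC ler_pdivlMr // mul1r => h.
  by rewrite /c2 mulrAC ler_pdivrMr // -exprMn [leRHS]mulrC.
have KKn : K * rho ^+ n.+1 <= c1 * rho ^+ n.
  by rewrite exprS mulrA ler_wpM2r // exprn_ge0 // ltW.
have c1c2 : c1 * (4 * q) = c2 by rewrite /c1 divfK // gt_eqF // mulr_gt0.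
have rn0 : 0 < rho ^+ n by rewrite exprn_gt0.
have plow : 3 * c1 * q * rho ^+ n <= absC (\det P).[zs].
  have h := diff zs (ltac:(rewrite zsabs; clear -rho0; lra)).
  have h2 : absC (\det (Tmx S L (rc lam + zs))) - K * rho ^+ n.+1 <= absC (\det P).[zs].
    by rewrite lerBlDr -lerBlDl; apply: le_trans h; exact: absC_sub.
  apply: le_trans h2; rewrite -c1c2 in low.
  have h3 : c1 * rho ^+ n <= c1 * q * rho ^+ n by rewrite ler_wpM2r ?(ltW rn0) // ler_peMr // ltW.
  have h4 : c1 * (4 * q) * rho ^+ n = 4 * (c1 * q * rho ^+ n) by ring.
  have h5 : 3 * c1 * q * rho ^+ n = 3 * (c1 * q * rho ^+ n) by ring.
  clear -low KKn h3 h4 h5; lra.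
have [r [r1 r2 H]] := poly_ratio rho0 Psize.
exists r; split; [exact: r1|exact: r2|move=> z zr].
pose zt := z - rc lam.
have ztb : absC zt <= rho.
  apply: le_trans (absC_le_ReIm _) _.
  have : `|Re zt| <= r by rewrite -zr le_max lexx.
  have : `|Im zt| <= r by rewrite -zr le_max lexx orbT.
  clear -r2 rho0; lra.
have := H zt zs zr (ltac:(apply: le_trans (absCB _ _) _; rewrite zsabs; clear -ztb rho0; lra)).
rewrite -/q => h.
have h1 : 3 * c1 * rho ^+ n <= absC (\det P).[zt].
  rewrite -(ler_pM2l q0); apply: le_trans h; apply: le_trans plow.
  by rewrite le_eqVlt; apply/orP; left; apply/eqP; ring.
have ztE : rc lam + zt = z by rewrite /zt addrC subrK.
have := diff zt ztb; rewrite ztE => h2.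
have h3 : absC (\det P).[zt] - K * rho ^+ n.+1 <= absC (\det (Tmx S L z)).
  by rewrite lerBlDr -lerBlDl; apply: le_trans h2; rewrite absCC absC_sub.
have h5 : 3 * c1 * rho ^+ n = 3 * (c1 * rho ^+ n) by ring.
have h6 : 0 < c1 * rho ^+ n by rewrite mulr_gt0.
clear -h1 h3 h5 h6 KKn; lra.
Qed.

End ZeroFreeContour.

(** * Existence of a zero near an approximate null vector *)

Section QuasiZero.
Variable R : realType.
Local Notation C := (Cx R).

(** The two terms of the bound come from the top side of the rectangle and from the three other
    sides. [Lam] is left free, to be balanced against [rho] afterwards. *)
Lemma zero_free_bound n (lmin lmax : R) : 0 < lmin -> lmin <= lmax ->
  exists rho0 K1 K2 : R, [/\ 0 < rho0, 0 <= K1, 0 <= K2 &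
   forall (S : 'M[C]_n) L (a : 'cV[C]_n) (lam rho Lam D : R), contraction S ->
   (forall j, lmin <= L j <= lmax) ->
   0 < rho -> rho < rho0 -> 4 <= Lam -> 0 <= D ->
   sqnorm (Tmx S L (rc lam) *m a) <= D ^+ 2 ->
   (forall z, absC (z - rc lam) <= rho -> \det (Tmx S L z) != 0) ->
   forall i, absC (a i 0) <= D * (K1 * (Lam / rho)) + D * (K2 / rho ^+ n * expR (- (Lam / 5)))].
Proof.
move=> l0 ll; have lx0 : 0 < lmax by lra.
have [rho1 [c1 [rho10 c10 H]]] := @zero_free_contour R n lmin lmax l0 ll.
pose B : R := 1 + expR 1; have e10 := expR_gt0 (1 : R).
have B1 : 1 <= B by rewrite /B; lra.
pose K1 : R := 8 * expR 2 / lmin.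
pose K2 : R := n%:R * (n`!%:R * B ^+ n) / c1.
have e20 := expR_gt0 (2 : R).
have K10 : 0 <= K1 by rewrite divr_ge0 ?(ltW l0) //; lra.
have K20 : 0 <= K2.
  by rewrite divr_ge0 ?(ltW c10) // mulr_ge0 // mulr_ge0 // exprn_ge0; lra.
exists (Num.min rho1 lmax^-1), K1, K2; split => //; first by rewrite lt_min rho10 invr_gt0.
move=> S L a lam rho Lam D cS lL rho0; rewrite lt_min => /andP[rhor rhol] Lam4 D0.
set b := Tmx S L (rc lam) *m a => bD nz i.
have lrho : lmax * rho <= 1 by rewrite mulrC -ler_pdivlMr // mul1r ltW.
have lLn j : lmin <= L j by case/andP: (lL j).
have lL0 j : 0 <= L j <= lmax by case/andP: (lL j) => h1 ->; rewrite (le_trans _ h1) // ltW.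
have [r [r1 r2 dlow]] := H S L lam rho cS lL rho0 rhor.
have rp : 0 < r by lra.
pose tau := r / Lam.
have L0 : 0 < Lam by lra.
have taup : 0 < tau by rewrite divr_gt0.
have taur : tau <= r / 4 by rewrite ler_pM2l // lef_pV2 ?posrE.
pose h z : C := (\adj (Tmx S L z) *m b) i 0 / \det (Tmx S L z).
(* With [(z - lam) / r = u + i v], the real part is [Lam (v - (u^2 - v^2) / 2)]. It is 0 at [lam]
   and at most 2 on the top side, where [v = 1 / Lam]; the quadratic term makes it negative on the
   vertical sides, where the linear one alone would not. *)
pose q (z : C) : C := rc Lam * (- (ic R * (z - rc lam) * rc r^-1) - (z - rc lam) ^+ 2 * rc ((2 * r ^+ 2)^-1)).
pose f z : C := h z * expC (q z).
have inr z : inrect (lam - r) (lam + r) (- r) tau z -> absC (z - rc lam) <= rho.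
  move=> /andP[/andP[z1 z2] /andP[z3 z4]]; apply: le_trans (absC_le_ReIm _) _.
  rewrite ReD ReN ImD ImN /=.
  have h1 : `|Re z - lam| <= r.
    by rewrite ler_norml; clear -z1 z2; apply/andP; split; lra.
  have h2 : `|Im z| <= r.
    by rewrite ler_norml; clear -z3 z4 taur rp; apply/andP; split; lra.
  by rewrite oppr0 addr0; clear -h1 h2 r2 rp; lra.
have fd z : inrect (lam - r) (lam + r) (- r) tau z -> cdiff f z.
  move=> zr; apply: cdiffM.
    apply: cdiffM.
      under eq_fun do rewrite mxE.
      apply: cdiff_sum => j; apply: cdiffM; last exact: cdiff_cst.
      by apply: cdiff_adj => p s; exact: cdiff_Tmx.
    by apply: cdiffV; [apply: cdiff_det => p s; exact: cdiff_Tmx|exact/nz/inr].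
  apply: cdiff_expC_comp; apply: cdiffM; first exact: cdiff_cst.
  have did : cdiff (fun w => w - rc lam) z by apply: cdiffB; [exact: cdiff_id|exact: cdiff_cst].
  apply: cdiffB.
    by apply: cdiffN; apply: cdiffM; [apply: cdiffM => //; exact: cdiff_cst|exact: cdiff_cst].
  by apply: cdiffM; [exact: cdiffX|exact: cdiff_cst].
have req z : Re (q z) = Lam * (Im z / r -
    ((Re z - lam) ^+ 2 - Im z ^+ 2) / (2 * r ^+ 2)).
  case: z => x y.
  rewrite /q expr2; rewrite !(ReM, ImM, ReD, ImD, ReN, ImN) /=; field; by rewrite gt_eqF.
have bb j : absC (b j 0) <= D by exact: sqnorm_entry_le bD.
have lamin : inside (lam - r) (lam + r) (- r) tau (rc lam).
  by rewrite /inside /=; clear -rp taup; apply/andP; split; apply/andP; split; lra.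
have lamd : absC (rc lam - rc lam) <= rho by rewrite subrr absC0 ltW.
have fl : f (rc lam) = a i 0.
  rewrite /f /q subrr expr0n /= mulr0 !mul0r oppr0 ?subr0 ?addr0 mulr0 expC0 mulr1 /h.
  by rewrite -(@solve_det _ _ _ a) // nz.
rewrite -fl; apply: max_principle lamin fd _ => z zb.
have /andP[zr bd] := zb.
have /andP[/andP[z1 z2] /andP[z3 z4]] := zr.
set x := Re z in z1 z2 bd; set y := Im z in z3 z4 bd.
pose u := (x - lam) / r; pose v := y / r.
have xE : x - lam = u * r by rewrite /u divfK // gt_eqF.
have yE : y = v * r by rewrite /v divfK // gt_eqF.
have qre : Re (q z) = Lam * (v - (u ^+ 2 - v ^+ 2) / 2).
  by rewrite req -/x -/y xE yE; field; by rewrite gt_eqF.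
have u1 : -1 <= u by rewrite /u ler_pdivlMr //; clear -z1; lra.
have u2 : u <= 1 by rewrite /u ler_pdivrMr //; clear -z2; lra.
have v1 : -1 <= v by rewrite /v ler_pdivlMr //; clear -z3; lra.
have v2 : v <= 1 / 4 by rewrite /v ler_pdivrMr //; clear -z4 taur; lra.
have T1 : 0 <= D * (K1 * (Lam / rho)).
  by apply: mulr_ge0 => //; apply: mulr_ge0 => //; rewrite divr_ge0 ?ltW.
have T2 : 0 <= D * (K2 / rho ^+ n * expR (- (Lam / 5))).
  apply: mulr_ge0 => //; apply: mulr_ge0; last exact/ltW/expR_gt0.
  by apply: divr_ge0 => //; apply: exprn_ge0; exact: ltW.
have zrho := inr z zr.
have dz := nz z zrho.
rewrite /f absCM absC_expC qre.
case: (boolP (y == tau)) => [/eqP ytau|ntau].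
  (* on the top side the Neumann series bounds the inverse of [Tmx] *)
  apply: (@le_trans _ _ (D * (K1 * (Lam / rho)))); last by rewrite lerDl.
  have vl : v = Lam^-1 by rewrite /v ytau /tau mulrAC divff ?mul1r // gt_eqF.
  have e2 : expR (Lam * (v - (u ^+ 2 - v ^+ 2) / 2)) <= expR 2.
    rewrite ler_expR; have : v - (u ^+ 2 - v ^+ 2) / 2 <= 2 * v.
      have v0 : 0 <= v by rewrite vl invr_ge0 ltW.
      by have := sqr_ge0 u; clear -v0 v2; nra.
    rewrite -(ler_pM2l L0) => /le_trans; apply.
    by rewrite vl mulrCA divff ?mulr1 // gt_eqF.
  pose X : 'cV[C]_n := (\det (Tmx S L z))^-1 *: (\adj (Tmx S L z) *m b).
  have hX : h z = X i 0 by rewrite /h /X [RHS]mxE mulrC.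
  have yp : 0 < Im z by rewrite -/y ytau.
  have := @Tmx_upper _ _ S L z lmin X cS l0 lLn yp; rewrite adj_solve // -/y ytau => XN.
  have kt : lmin * tau / 2 <= 1 - expR (- (lmin * tau)).
    apply: one_sub_expRN; first by rewrite mulr_ge0 // ltW.
    have tr : tau <= rho by clear -taur r2 rp; lra.
    by apply: le_trans lrho; apply: ler_pM => //; exact: ltW.
  have kt0 : 0 < lmin * tau / 2 by rewrite divr_gt0 // mulr_gt0.
  have hle : absC (h z) <= D / (lmin * tau / 2).
    rewrite hX; apply: sqnorm_entry_le; first by rewrite divr_ge0 // ltW.
    rewrite expr_div_n ler_pdivlMr ?exprn_gt0 //; apply: le_trans bD.
    apply: le_trans XN; rewrite ler_wpM2l ?sqnorm_ge0 // lerXn2r ?nnegrE //; first exact: ltW.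
    exact: le_trans (ltW kt0) kt.
  apply: (@le_trans _ _ (D / (lmin * tau / 2) * expR 2)).
    by apply: ler_pM; rewrite ?absC_ge0 ?(ltW (expR_gt0 _)).
  have -> : D / (lmin * tau / 2) * expR 2 = D * (2 * expR 2 / lmin * tau^-1).
    by field; rewrite !gt_eqF.
  rewrite ler_wpM2l // /K1.
  have -> : 8 * expR 2 / lmin * (Lam / rho) = 2 * expR 2 / lmin * (rho / (4 * Lam))^-1.
    by field; rewrite !gt_eqF.
  have w0 : 0 < rho / (4 * Lam) by rewrite divr_gt0 // mulr_gt0.
  rewrite ler_wpM2l //; first by rewrite divr_ge0 ?(ltW l0) // mulr_ge0 // ltW.
  rewrite lef_pV2 ?posrE //.
  have -> : rho / (4 * Lam) = (rho / 4) / Lam by field; by rewrite gt_eqF.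
  by rewrite /tau ler_pM2r // invr_gt0.
(* on the other sides the determinant is bounded below *)
apply: (@le_trans _ _ (D * (K2 / rho ^+ n * expR (- (Lam / 5))))); last by rewrite lerDr.
have zm : maxabs (z - rc lam) = r.
  rewrite /maxabs ReD ReN ImD ImN /= -/x -/y oppr0 addr0; apply/eqP; rewrite eq_le.
  apply/andP; split.
    rewrite ge_max !ler_norml; clear -z1 z2 z3 z4 taur rp.
    by apply/andP; split; apply/andP; split; lra.
  move: bd; rewrite (negPf ntau) orbF le_max => /or3P[]/eqP E; rewrite E.
  - by rewrite [X in `|X|](_ : _ = - r) ?normrN ?(gtr0_norm rp) ?lexx //; ring.
  - by rewrite [X in `|X|](_ : _ = r) ?(gtr0_norm rp) ?lexx //; ring.
  - by rewrite normrN (gtr0_norm rp) lexx orbT.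
have dl := dlow z zm.
(* On the vertical sides [u^2 = 1] and [v <= 1/4], which comes from [4 <= Lam], give at most
   [- 7/32]; on the bottom [v = -1] gives at most [- 1/2]. *)
have phi : v - (u ^+ 2 - v ^+ 2) / 2 <= - (1 / 5).
  move: bd; rewrite (negPf ntau) orbF => /or3P[]/eqP E.
  - have -> : u = -1 by rewrite /u E (_ : lam - r - lam = - r) ?mulNr ?divff ?gt_eqF //; ring.
    by clear -v1 v2; nra.
  - have -> : u = 1 by rewrite /u E (_ : lam + r - lam = r) ?divff ?gt_eqF //; ring.
    by clear -v1 v2; nra.
  - have -> : v = -1 by rewrite /v E mulNr divff // gt_eqF.
    by have := sqr_ge0 u; clear; nra.
have eL : expR (Lam * (v - (u ^+ 2 - v ^+ 2) / 2)) <= expR (- (Lam / 5)).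
  rewrite ler_expR; move: phi; rewrite -(ler_pM2l L0) => /le_trans; apply.
  by rewrite mulrN mul1r.
rewrite mulrA; apply: ler_pM; rewrite ?absC_ge0 ?(ltW (expR_gt0 _)) //.
have crho : 0 < c1 * rho ^+ n by rewrite mulr_gt0 // exprn_gt0.
rewrite /h absCM absCV ler_pdivrMr ?absC_gt0 //.
have zi : lmax * `|Im z| <= 1.
  apply: le_trans lrho; rewrite ler_wpM2l ?(ltW lx0) // -/y ler_norml.
  by clear -z3 z4 taur r2 rp; apply/andP; split; lra.
have num : absC ((\adj (Tmx S L z) *m b) i 0) <= n%:R * (n`!%:R * B ^+ n) * D.
  rewrite mxE; apply: le_trans (absC_sum _ _ _) _.
  apply: (@le_trans _ _ (\sum_(j < n) (n`!%:R * B ^+ n * D))).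
    apply: ler_sum => j _; rewrite absCM; apply: ler_pM; rewrite ?absC_ge0 //.
    by apply: adj_bound => // p s; exact: Tmx_entry.
  by rewrite sumr_const card_ord -[leLHS]mulr_natl !mulrA.
apply: le_trans num _.
apply: (@le_trans _ _ (D * (K2 / rho ^+ n) * (c1 * rho ^+ n))).
  rewrite le_eqVlt; apply/orP; left; apply/eqP; rewrite /K2; field.
  by rewrite !gt_eqF ?exprn_gt0.
apply: ler_wpM2l => //; apply: mulr_ge0 => //; apply: divr_ge0 => //.
by apply: exprn_ge0; exact: ltW.
Qed.

Lemma powR_small (be eta : R) : 0 < be -> 0 < eta ->
  exists2 e0 : R, 0 < e0 & forall e, 0 < e -> e < e0 -> e `^ be < eta.
Proof.
move=> be0 eta0; exists (eta `^ be^-1); first exact: powR_gt0.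
move=> e e0 ee; have -> : eta = (eta `^ be^-1) `^ be.
  by rewrite -powRrM mulVf ?powRr1 ?(ltW eta0) // gt_eqF.
by apply: gt0_ltr_powR; rewrite ?nnegrE ?(ltW e0) ?powR_ge0.
Qed.

Theorem quasi_zero n (lmin lmax c0 C0 gam : R) : 0 < lmin -> lmin <= lmax -> 0 < c0 ->
  0 <= C0 -> gam < 1 ->
  exists2 eps0 : R, 0 < eps0 &
  forall (S : 'M[C]_n) L (a : 'cV[C]_n) (lam eps : R), contraction S ->
   (forall j, lmin <= L j <= lmax) -> 0 < eps -> eps < eps0 ->
   c0 <= sqnorm a -> sqnorm (Tmx S L (rc lam) *m a) <= (C0 * eps) ^+ 2 ->
   exists z, \det (Tmx S L z) = 0 /\ absC (z - rc lam) < eps `^ gam.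
Proof.
move=> l0 ll c00 C00 gam1.
have [rho0 [K1 [K2 [rho00 K10 K20 H]]]] := @zero_free_bound n lmin lmax l0 ll.
(* With [g] in [[1/2, 1)] the radius [eps^g] tends to 0 and is at most [eps^gam]. The value of [be]
   makes [eps = s^2 eps^g] for [s = eps^be]: one factor [s] pays for [Lam = 1/s], the other
   remains. *)
pose g := Num.max gam (1 / 2); pose be := (1 - g) / 2.
have g1 : g < 1 by rewrite /g gt_max gam1 /=; lra.
have gh : 1 / 2 <= g by rewrite /g le_max lexx orbT.
have gg : gam <= g by rewrite /g le_max lexx.
have be0 : 0 < be by rewrite /be; lra.
have be1 : be <= 1 by rewrite /be; lra.
(* Since [be (m + 1) >= n], one has [s^(m+1) <= eps^n], so that [exp (- 1/(5 s)) = O(s^(m+1))]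
   absorbs [rho^-n]. *)
pose m := Num.Def.archi_bound (n%:R / be).
have mb : n%:R <= be * m.+1%:R.
  have := @archi_boundP R (n%:R / be); rewrite divr_ge0 ?(ltW be0) // => /(_ isT).
  rewrite ltr_pdivrMr // mulrC => /ltW h; apply: le_trans h _.
  by rewrite ler_pM2l // ler_nat.
pose K3 := C0 * (K1 * 2) + C0 * (K2 * 2 ^+ n * (m.+1`!%:R * 5 ^+ m.+1)).
have K30 : 0 <= K3.
  apply: addr_ge0; apply: mulr_ge0 => //; first by apply: mulr_ge0.
  by apply: mulr_ge0; apply: mulr_ge0 => //; apply: exprn_ge0.
(* The entries of [a] will be at most [K3 s], so [|a|^2 <= n K3^2 s^2 <= k s], which contradicts
   [c0 <= |a|^2] once [s < c0 / k]. *)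
pose k := n%:R * K3 ^+ 2 + 1; have k0 : 0 < k.
  by rewrite /k ltr_wpDl // mulr_ge0 // sqr_ge0.
have [e1 e10 E1] := @powR_small be (Num.min (1 / 4) (c0 / k)) be0
   (ltac:(by rewrite lt_min; apply/andP; split; [lra|exact: divr_gt0])).
have [e2 e20 E2] := @powR_small g rho0 (ltac:(lra)) rho00.
exists (Num.min 1 (Num.min e1 e2)); first by rewrite !lt_min ltr01 e10.
move=> S L a lam eps cS lL eps0; rewrite !lt_min => /and3P[eps1 epse1 epse2] ca Ta.
apply: contrapT => /forallNP nz.
pose s := eps `^ be; have s0 : 0 < s by exact: powR_gt0.
have := E1 eps eps0 epse1; rewrite -/s lt_min => /andP[s4 sk].
pose rho := eps `^ g / 2.
have pg0 : 0 < eps `^ g by exact: powR_gt0.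
have rp : 0 < rho by rewrite /rho; clear -pg0; lra.
have rr : rho < rho0 by have := E2 eps eps0 epse2; rewrite /rho; clear -pg0; lra.
have dnz z : absC (z - rc lam) <= rho -> \det (Tmx S L z) != 0.
  move=> zr; apply/eqP => dz; apply: (nz z); split => //.
  apply: le_lt_trans zr _; apply: (@lt_le_trans _ _ (eps `^ g)); first by rewrite /rho; clear -pg0; lra.
  by apply: ger_powR => //; rewrite eps0 /= ltW.
have D0 : 0 <= C0 * eps by rewrite mulr_ge0 // ltW.
have L4 : 4 <= s^-1 by rewrite -[leLHS]invrK lef_pV2 ?posrE //; clear -s4; lra.
have := H S L a lam rho s^-1 (C0 * eps) cS lL rp rr L4 D0 Ta dnz => Ha.
have epsE : eps = s ^+ 2 * eps `^ g.
  rewrite /s -powR_mulrn ?powR_ge0 // -powRrM -powRD; last by apply/implyP => _; rewrite gt_eqF.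
  have -> : be * 2%:R + g = 1 by rewrite /be; field.
  by rewrite powRr1 // ltW.
have first_term : C0 * eps * (K1 * (s^-1 / rho)) <= C0 * (K1 * 2) * s.
  rewrite le_eqVlt; apply/orP; left; apply/eqP; rewrite {1}epsE /rho; field.
  by rewrite !gt_eqF.
have sm : s ^+ m.+1 <= eps ^+ n.
  rewrite -!powR_mulrn ?(ltW eps0) ?powR_ge0 // /s -powRrM.
  by apply: ger_powR => //; rewrite eps0 /= ltW.
have rn : (rho ^+ n)^-1 <= 2 ^+ n * (eps ^+ n)^-1.
  rewrite -exprVn -exprVn -exprMn lerXn2r ?nnegrE ?invr_ge0 ?(ltW rp) ?mulr_ge0 ?invr_ge0 ?(ltW eps0) //.
  rewrite /rho invfM invrK [leLHS]mulrC ler_pM2l // lef_pV2 ?posrE //.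
  have : eps `^ 1 <= eps `^ g by apply: ger_powR; [rewrite eps0 ltW|exact: ltW].
  by rewrite powRr1 // ltW.
have ex : expR (- (s^-1 / 5)) <= m.+1`!%:R * 5 ^+ m.+1 * s ^+ m.+1.
  apply: le_trans (@expRN_le_inv _ _ m _) _; first by rewrite divr_gt0 // invr_gt0.
  rewrite le_eqVlt; apply/orP; left; apply/eqP; rewrite exprMn !exprVn; field.
  by rewrite !gt_eqF // exprn_gt0.
have epss : eps <= s.
  have : eps `^ 1 <= eps `^ be by apply: ger_powR => //; rewrite eps0 ltW.
  by rewrite powRr1 // ltW.
have second_term : C0 * eps * (K2 / rho ^+ n * expR (- (s^-1 / 5))) <=
    C0 * (K2 * 2 ^+ n * (m.+1`!%:R * 5 ^+ m.+1)) * s.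
  apply: (@le_trans _ _ (C0 * s * (K2 * (2 ^+ n * (eps ^+ n)^-1) * (m.+1`!%:R * 5 ^+ m.+1 * eps ^+ n)))).
    apply: ler_pM => //.
    - by rewrite !mulr_ge0 ?(ltW (expR_gt0 _)) // invr_ge0 exprn_ge0 // ltW.
    - by rewrite ler_wpM2l.
    - apply: ler_pM; rewrite ?(ltW (expR_gt0 _)) //.
      + by rewrite mulr_ge0 // invr_ge0 exprn_ge0 // ltW.
      + by rewrite ler_wpM2l.
      + by apply: le_trans ex _; rewrite ler_wpM2l // mulr_ge0 // exprn_ge0.
  rewrite le_eqVlt; apply/orP; left; apply/eqP; field.
  by rewrite gt_eqF // exprn_gt0.
have ai i : absC (a i 0) <= K3 * s.
  by apply: le_trans (Ha i) _; rewrite /K3 mulrDl; exact: lerD.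
have : sqnorm a <= n%:R * (K3 * s) ^+ 2.
  apply: (@le_trans _ _ (\sum_(i < n) (K3 * s) ^+ 2)).
    by apply: ler_sum => i _; rewrite lerXn2r ?nnegrE ?absC_ge0 // mulr_ge0 // ltW.
  by rewrite sumr_const card_ord mulr_natl.
move=> h; have {h} := le_trans ca h; rewrite leNgt => /negP; apply.
apply: (@le_lt_trans _ _ (k * s)); last by rewrite mulrC -ltr_pdivlMr.
rewrite exprMn mulrA; apply: (@le_trans _ _ (n%:R * K3 ^+ 2 * s)).
  rewrite ler_wpM2l ?mulr_ge0 ?sqr_ge0 // expr2 ler_piMr ?(ltW s0) //; clear -s4; lra.
by rewrite ler_wpM2r ?(ltW s0) // /k lerDl.
Qed.

End QuasiZero.

(** * Square-integrable functions and the perturbed transport equation *)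

Section SquareIntegrable.
Variable R : realType.
Local Notation C := (Cx R).
Local Notation mu := (@lebesgue_measure R).

Lemma sqmod_ge0 (z : C) : 0 <= sqmod z.
Proof. by rewrite sqmodE sqr_ge0. Qed.

Lemma sqmod_Re (z : C) : Re z ^+ 2 <= sqmod z.
Proof. by rewrite /sqmod lerDl sqr_ge0. Qed.
Lemma sqmod_Im (z : C) : Im z ^+ 2 <= sqmod z.
Proof. by rewrite /sqmod lerDr sqr_ge0. Qed.

Lemma sqint_sqmod_integrable (D : set R) (f : R -> C) : borel D ->
  sqint D f -> mu.-integrable D (EFin \o (fun x => sqmod (f x))).
Proof.
move=> mD [m1 m2 fin]; apply/integrableP; split.
  apply/measurable_EFinP; apply: measurable_funD; exact: measurable_funX.
apply: le_lt_trans fin; apply: ge0_le_integral => //.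
- apply: measurableT_comp => //; apply/measurable_EFinP; apply: measurable_funD; exact: measurable_funX.
- apply/measurable_EFinP; apply: measurable_funD; exact: measurable_funX.
- by move=> x _; rewrite /= ger0_norm // sqmod_ge0.
Qed.

Lemma sqint_sub (D D' : set R) (f : R -> C) : borel D ->
  borel D' -> D' `<=` D -> sqint D f -> sqint D' f.
Proof.
move=> mD mD' sub [m1 m2 fin]; split.
- exact: measurable_funS m1.
- exact: measurable_funS m2.
- apply: le_lt_trans fin; apply: ge0_subset_integral => //.
    apply/measurable_EFinP; apply: measurable_funD; exact: measurable_funX.
  by move=> x _; rewrite lee_fin sqmod_ge0.
Qed.

Lemma sqint_cintegrable (a b : R) (f : R -> C) : sqint [set x | a <= x <= b] f ->
  cintegrable [set x | a <= x <= b] f.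
Proof.
move=> fs; have mD := @measurable_seg R a b; have si := sqint_sqmod_integrable mD fs.
have [m1 m2 _] := fs.
have i1 : mu.-integrable [set x | a <= x <= b] (EFin \o (fun x => 1 + sqmod (f x))).
  by apply: (@integrable_add R _ (cst 1)) => //; exact: integrable_cst_seg.
have H (h : R -> R) : measurable_fun [set x | a <= x <= b] h ->
    (forall x, h x ^+ 2 <= sqmod (f x)) -> mu.-integrable [set x | a <= x <= b] (EFin \o h).
  move=> mh hs; apply: le_integrable i1 => //; first exact/measurable_EFinP.
  move=> x _ /=; rewrite lee_fin; have h0 := sqmod_ge0 (f x).
  rewrite [leRHS]ger0_norm; last by lra.
  have := hs x; rewrite -real_normK ?num_real // => h1.
  have := normr_ge0 (h x); nra.
by split; apply: H => // x; [exact: sqmod_Re|exact: sqmod_Im].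
Qed.

Lemma sqint_lin (D : set R) (f g : R -> C) (k1 k2 : C) : borel D ->
  sqint D f -> sqint D g -> sqint D (fun x => k1 * f x + k2 * g x).
Proof.
move=> mD fs gs; have [f1 f2 _] := fs; have [g1 g2 _] := gs.
have m1 : measurable_fun D (fun x => Re (k1 * f x + k2 * g x)).
  under eq_fun do rewrite ReD !ReM.
  by apply: measurable_funD; apply: measurable_funB; apply: measurable_funM => //; exact: measurable_cst.
have m2 : measurable_fun D (fun x => Im (k1 * f x + k2 * g x)).
  under eq_fun do rewrite ImD !ImM.
  by apply: measurable_funD; apply: measurable_funD; apply: measurable_funM => //; exact: measurable_cst.
split => //.
have i1 := sqint_sqmod_integrable mD fs; have i2 := sqint_sqmod_integrable mD gs.
have i3 := @integrable_lin R D _ _ (2 * sqmod k1) (2 * sqmod k2) mD i1 i2.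
have /integrableP[_] := i3; apply: le_lt_trans.
apply: ge0_le_integral => //.
- by move=> x _; rewrite lee_fin sqmod_ge0.
- apply/measurable_EFinP; apply: measurable_funD; exact: measurable_funX.
- by apply: measurableT_comp => //; case/integrableP : i3.
- move=> x _; rewrite /= lee_fin.
  apply: le_trans (ler_norm _).
  have -> : 2 * sqmod k1 * sqmod (f x) + 2 * sqmod k2 * sqmod (g x) =
      2 * absC (k1 * f x) ^+ 2 + 2 * absC (k2 * g x) ^+ 2.
    by rewrite !sqmodE !absCM; ring.
  rewrite sqmodE.
  have := absCD (k1 * f x) (k2 * g x); set p := absC _; set q := absC (k1 * _); set r := absC (k2 * _).
  have p0 : 0 <= p by exact: absC_ge0.
  have q0 : 0 <= q by exact: absC_ge0.
  have r0 : 0 <= r by exact: absC_ge0.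
  move=> h; apply: (@le_trans _ _ ((q + r) ^+ 2)); first by rewrite lerXn2r ?nnegrE // (le_trans p0).
  by have := sqr_ge0 (q - r); nra.
Qed.

Lemma Rintegral_sub (D D' : set R) (h : R -> R) : borel D ->
  borel D' -> D' `<=` D -> (forall x, 0 <= h x) ->
  mu.-integrable D (EFin \o h) -> Rintegral mu D' h <= Rintegral mu D h.
Proof.
move=> mD mD' sub h0 hi; rewrite /Rintegral fine_le //.
- by apply: integrable_fin_num => //; exact: integrableS hi.
- exact: integrable_fin_num.
- apply: ge0_subset_integral => //; first by case/integrableP : hi.
  by move=> x _; rewrite lee_fin.
Qed.

Definition norm1 (z : C) : R := `|Re z| + `|Im z|.

Lemma norm1_integrable (D : set R) (f : R -> C) : borel D ->
  cintegrable D f -> mu.-integrable D (EFin \o (fun x => norm1 (f x))).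
Proof.
by move=> mD [i1 i2]; apply: integrable_add => //; exact: integrable_norm.
Qed.

Lemma absC_Cint_norm1 (D : set R) (f : R -> C) : borel D ->
  cintegrable D f -> absC (Cint D f) <= Rintegral mu D (fun x => norm1 (f x)).
Proof. by move=> mD fi; apply: absC_Cint_le => //; exact: norm1_integrable. Qed.

(** Young's inequality [|p| <= t/2 + p^2 / (2 t)], applied to both parts, takes the place of
    Cauchy-Schwarz. *)
Lemma norm1_sqmod_bound (a b t : R) (f : R -> C) : a <= b -> 0 < t ->
  sqint [set x | a <= x <= b] f ->
  Rintegral mu [set x | a <= x <= b] (fun x => sqmod (f x)) <= t ^+ 2 ->
  Rintegral mu [set x | a <= x <= b] (fun x => norm1 (f x)) <= t * (b - a + 1).
Proof.
move=> ab t0 fs ft; have mD := @measurable_seg R a b.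
have si := sqint_sqmod_integrable mD fs.
have ci := integrable_cst_seg a b t.
have i1 := @integrable_lin R _ (cst t) _ 1 (2 * t)^-1 mD ci si.
apply: (@le_trans _ _ (Rintegral mu [set x | a <= x <= b] (fun x => 1 * cst t x + (2 * t)^-1 * sqmod (f x)))).
  apply: le_Rintegral => //; first exact/norm1_integrable/sqint_cintegrable.
  move=> x _; rewrite mul1r /cst /norm1 /sqmod.
  have key (p : R) : `|p| <= t / 2 + (2 * t)^-1 * p ^+ 2.
    rewrite -subr_ge0; have -> : p ^+ 2 = `|p| ^+ 2 by rewrite real_normK ?num_real.
    have -> : t / 2 + (2 * t)^-1 * `|p| ^+ 2 - `|p| = (2 * t)^-1 * (`|p| - t) ^+ 2.
      by field; rewrite gt_eqF.
    by rewrite mulr_ge0 ?sqr_ge0 // invr_ge0; lra.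
  rewrite mulrDr; have := key (Re (f x)); have := key (Im (f x)); lra.
rewrite (@Rintegral_lin R _ (cst t)) // mul1r Rint_cst_seg //.
have -> : t * (b - a + 1) = t * (b - a) + t by ring.
rewrite lerD2l.
rewrite mulrC ler_pdivrMr; last by lra.
apply: le_trans ft _; have := sqr_ge0 t; nra.
Qed.

(* Summing over ever finer partitions, the products of increments of [id] and [V] disappear. *)
Lemma partition_bound (Psi : R -> C) (A V : R -> R) (X : R) : 0 <= X ->
  (forall x y, 0 <= x -> x <= y -> y <= X ->
     absC (Psi y - Psi x) <= (A y - A x) + (y - x) * (V y - V x)) ->
  absC (Psi X - Psi 0) <= A X - A 0.
Proof.
move=> X0 H.
have key n : absC (Psi X - Psi 0) <= (A X - A 0) + X / n.+1%:R * (V X - V 0).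
  pose h := X / n.+1%:R.
  have n0 : (0 : R) < n.+1%:R by rewrite ltr0n.
  have h0 : 0 <= h by rewrite divr_ge0 // ltW.
  have hX : n.+1%:R * h = X by rewrite mulrC divfK // gt_eqF.
  rewrite -/h; rewrite -{1 2 3}hX.
  suff S k : (k <= n.+1)%N -> absC (Psi (k%:R * h) - Psi 0) <=
      (A (k%:R * h) - A 0) + h * (V (k%:R * h) - V 0) by exact: S.
  elim: k => [_|k IH kn]; first by rewrite mul0r !subrr absC0 mulr0 addr0.
  have -> : Psi (k.+1%:R * h) - Psi 0 =
     (Psi (k%:R * h) - Psi 0) + (Psi (k.+1%:R * h) - Psi (k%:R * h)) by ring.
  apply: le_trans (absCD _ _) _.
  have e : k.+1%:R * h - k%:R * h = h by rewrite -natr1; ring.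
  have := H (k%:R * h) (k.+1%:R * h); rewrite e => /(_ _ _ _).
  have := IH (ltnW kn).
  set a1 := absC _; set a2 := absC _ => h1 h2.
  have : a2 <= A (k.+1%:R * h) - A (k%:R * h) + h * (V (k.+1%:R * h) - V (k%:R * h)).
    apply: h2; first by rewrite mulr_ge0.
      by rewrite ler_wpM2r // ler_nat.
    by rewrite -hX ler_wpM2r // ler_nat.
  have E : h * (V (k.+1%:R * h) - V (k%:R * h)) = h * (V (k.+1%:R * h) - V 0) - h * (V (k%:R * h) - V 0).
    by ring.
  rewrite E; lra.
apply/ler_addgt0Pr => e e0.
pose n := Num.Def.archi_bound (`|X * (V X - V 0)| / e).
apply: le_trans (key n) _; rewrite lerD2l mulrAC ler_pdivrMr ?ltr0n //.
apply: le_trans (ler_norm _) _; rewrite [leRHS]mulrC -ler_pdivrMr //.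
have := @archi_boundP R (`|X * (V X - V 0)| / e); rewrite divr_ge0 ?(ltW e0) // => /(_ isT)/ltW h.
by apply: le_trans h _; rewrite ler_nat.
Qed.

(** Formally the derivative of [g exp (- i k x)] is [F exp (- i k x)]. As [g] is only the primitive
    of an integrable function, the product rule is replaced by increments over small intervals,
    summed by [partition_bound]. *)
Lemma ode_bound (g F : R -> C) (k X : R) : 0 <= X ->
  cintegrable [set x | 0 <= x <= X] g -> cintegrable [set x | 0 <= x <= X] F ->
  (forall x, 0 <= x <= X -> g x = g 0 + Cint [set y | 0 <= y <= x] (fun y => ic R * rc k * g y + F y)) ->
  absC (g X * expC (- (ic R * rc k) * rc X) - g 0) <=
    Rintegral mu [set x | 0 <= x <= X] (fun x => norm1 (F x)).
Proof.
move=> X0 gi Fi gE.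
set m := ic R * rc k.
pose G x := m * g x + F x.
have mS a b := @measurable_seg R a b.
have Gi : cintegrable [set x | 0 <= x <= X] G.
  by apply: cintegrableD => //; exact: cintegrableZ.
pose W x := Rintegral mu [set y | 0 <= y <= x] (fun y => norm1 (G y)).
pose A x := Rintegral mu [set y | 0 <= y <= x] (fun y => norm1 (F y)).
have catl1 f x y : cintegrable [set x | 0 <= x <= X] f -> 0 <= x -> x <= y -> y <= X ->
    Rintegral mu [set z | 0 <= z <= y] (fun y => norm1 (f y)) -
    Rintegral mu [set z | 0 <= z <= x] (fun y => norm1 (f y)) =
    Rintegral mu [set z | x <= z <= y] (fun y => norm1 (f y)).
  move=> fi x0 xy yX; rewrite (@Rintegral_seg_cat _ _ 0 x y) //; first by ring.
  by apply: norm1_integrable => //; exact: cintegrable_seg_sub fi.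
have gd x y : 0 <= x -> x <= y -> y <= X -> g y - g x = Cint [set z | x <= z <= y] G.
  move=> x0 xy yX; rewrite gE; last by rewrite (le_trans x0).
  rewrite [g x]gE; last by rewrite x0 (le_trans xy).
  rewrite (@Cint_seg_cat _ _ 0 x y) //; first by ring.
  exact: cintegrable_seg_sub Gi.
have gdb x y : 0 <= x -> x <= y -> y <= X -> absC (g y - g x) <= W y - W x.
  move=> x0 xy yX; rewrite gd // /W catl1 //; apply: absC_Cint_norm1 => //.
  exact: cintegrable_seg_sub Gi.
have Wmono x y : 0 <= x -> x <= y -> y <= X -> W x <= W y.
  by move=> x0 xy yX; rewrite -subr_ge0; exact: le_trans (absC_ge0 _) (gdb x y x0 xy yX).
pose Gs := absC (g 0) + (W X - W 0).
have gb x : 0 <= x -> x <= X -> absC (g x) <= Gs.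
  move=> x0 xX; have -> : g x = g 0 + (g x - g 0) by ring.
  apply: le_trans (absCD _ _) _; rewrite lerD2l; apply: le_trans (gdb 0 x _ _ _) _ => //.
  by rewrite lerD2r; exact: Wmono.
have Gs0 : 0 <= Gs by exact: le_trans (absC_ge0 _) (gb 0 (lexx _) X0).
pose Cw := 4 * expR (absC m * X).
have Cw0 : 0 <= Cw by rewrite mulr_ge0 // ltW // expR_gt0.
pose e x := expC (- m * rc x).
have ea x : absC (e x) = 1.
  by rewrite /e absC_expC /m !ReM !ReN !ImN !ReM !ImM /=; rewrite [X in expR X](_ : _ = 0) ?expR0 //; ring.
(* The second-order errors on an interval: the first term accounts for the variation of [g] there,
   the second for the quadratic remainder of the exponential. *)
pose V x := 2 * absC m * W x + Gs * Cw * absC m ^+ 2 * x.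
have A0 : A 0 = 0.
  rewrite /A; have -> : [set y : R | 0 <= y <= 0] = [set 0].
    by apply/seteqP; split => [y /= /andP[h1 h2]|y /= ->]; [apply/eqP; rewrite eq_le h1 h2|rewrite lexx].
  by rewrite Rintegral_set1.
have e0 : e 0 = 1 by rewrite /e mulr0 expC0.
have -> : Rintegral mu [set x | 0 <= x <= X] (fun x => norm1 (F x)) = A X - A 0.
  by rewrite A0 subr0.
have -> : g X * expC (- m * rc X) - g 0 = g X * e X - g 0 * e 0 by rewrite e0 mulr1.
apply: (@partition_bound (fun x => g x * e x) A V X X0) => x y x0 xy yX.
have subi f : cintegrable [set x | 0 <= x <= X] f -> cintegrable [set z | x <= z <= y] f.
  by apply: cintegrable_seg_sub.
pose rem := expC (m * rc (y - x)) - 1 - m * rc (y - x).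
have remb : absC rem <= Cw * absC m ^+ 2 * (y - x) ^+ 2.
  have := expT_rem 2 (m * rc (y - x)).
  rewrite /expT !big_ord_recr big_ord0 /= expr0 expr1 fact0 !invr1 rc1 !mulr1 add0r opprD addrA -/rem.
  have yx : `|y - x| = y - x by rewrite ger0_norm // subr_ge0.
  rewrite absCM absC_rc yx exprMn => /le_trans; apply.
  have -> : (2 ^+ 2 : R) = 4 by ring.
  rewrite /Cw; have h1 : expR (absC m * (y - x)) <= expR (absC m * X).
    by rewrite ler_expR ler_wpM2l ?absC_ge0 //; lra.
  have h2 : 0 <= 4 * (absC m ^+ 2 * (y - x) ^+ 2) by rewrite mulr_ge0 // mulr_ge0 // sqr_ge0.
  have -> : 4 * expR (absC m * X) * absC m ^+ 2 * (y - x) ^+ 2 =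
     4 * (absC m ^+ 2 * (y - x) ^+ 2) * expR (absC m * X) by ring.
  by rewrite ler_wpM2l.
have ey : e x = e y * expC (m * rc (y - x)).
  rewrite /e -expCD; congr expC; rewrite rcD rcN; ring.
pose R1 := Cint [set z | x <= z <= y] (fun s => g s - g x).
have cstI (c : C) : cintegrable [set z | x <= z <= y] (fun=> c).
  by split; exact: integrable_cst_seg.
have R1b : absC R1 <= 2 * (W y - W x) * (y - x).
  apply: absC_Cint_seg => //; first by apply: cintegrableB => //; exact: subi.
  move=> s /andP[xs sy]; apply: le_trans (gdb x s _ _ _) _ => //; first exact: le_trans yX.
  by rewrite lerD2r; apply: Wmono => //; exact: le_trans xs.
have gI : Cint [set z | x <= z <= y] g = rc (y - x) * g x + R1.
  rewrite /R1 CintB //; last exact: subi.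
  rewrite Cint_cst_seg //; ring.
have Gd : g y - g x = m * (rc (y - x) * g x + R1) + Cint [set z | x <= z <= y] F.
  rewrite gd // /G CintD //; [|apply: cintegrableZ => //; exact: subi|exact: subi].
  by rewrite CintZ ?gI //; exact: subi.
have -> : g y * e y - g x * e x = e y * (m * R1 + Cint [set z | x <= z <= y] F - g x * rem).
  rewrite ey /rem; have -> : g y = g x + (g y - g x) by ring.
  rewrite Gd; ring.
rewrite absCM ea mul1r.
have FA : absC (Cint [set z | x <= z <= y] F) <= A y - A x.
  by rewrite /A catl1 //; apply: absC_Cint_norm1 => //; exact: subi.
have h1 : absC (m * R1) <= absC m * (2 * (W y - W x) * (y - x)).
  by rewrite absCM ler_wpM2l ?absC_ge0.
have h2 : absC (g x * rem) <= Gs * (Cw * absC m ^+ 2 * (y - x) ^+ 2).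
  by rewrite absCM; apply: ler_pM; rewrite ?absC_ge0 // gb //; exact: le_trans yX.
have := absCB (m * R1 + Cint [set z | x <= z <= y] F) (g x * rem).
have := absCD (m * R1) (Cint [set z | x <= z <= y] F).
have -> : (y - x) * (V y - V x) = absC m * (2 * (W y - W x) * (y - x)) + Gs * (Cw * absC m ^+ 2 * (y - x) ^+ 2).
  by rewrite /V; ring.
lra.
Qed.

End SquareIntegrable.

(** * Vertex scattering and the matrix of the graph *)

Section Scattering.
Variables (R : realType) (J K M : nat) (v0 v1 : 'I_(K + M) -> 'I_J).
Local Notation C := (Cx R).
Local Notation End := ('I_(K + M) * bool)%type.

Lemma Re_sum (I : Type) (r : seq I) (P : pred I) (F : I -> C) :
  Re (\sum_(i <- r | P i) F i) = \sum_(i <- r | P i) Re (F i).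
Proof. by elim/big_rec2 : _ => [//|i y x _ <-]; rewrite ReD. Qed.
Lemma Im_sum (I : Type) (r : seq I) (P : pred I) (F : I -> C) :
  Im (\sum_(i <- r | P i) F i) = \sum_(i <- r | P i) Im (F i).
Proof. by elim/big_rec2 : _ => [//|i y x _ <-]; rewrite ImD. Qed.

(** Twice the mean minus the identity is the reflection in the line of constant vectors, hence an
    isometry. *)
Lemma reflect_real (I : finType) (P : pred I) (a : I -> R) :
  \sum_(i | P i) (2 / #|P|%:R * (\sum_(k | P k) a k) - a i) ^+ 2 = \sum_(i | P i) a i ^+ 2.
Proof.
set A := \sum_(k | P k) a k; set d : R := #|P|%:R.
have [d0|d0] := eqVneq #|P| 0%N.
  by rewrite !big_pred0 // => i; move: (card0_eq d0 i); rewrite -topredE.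
have dn : d != 0 by rewrite pnatr_eq0.
have E i : (2 / d * A - a i) ^+ 2 = (2 / d * A) ^+ 2 + (- (2 * (2 / d * A)) * a i + a i ^+ 2) by ring.
under eq_bigr do rewrite E.
have cst : \sum_(i | P i) (2 / d * A) ^+ 2 = d * (2 / d * A) ^+ 2.
  by rewrite sumr_const /d [RHS]mulr_natl.
have s2 : \sum_(i | P i) - (2 * (2 / d * A)) * a i = - (2 * (2 / d * A)) * A by rewrite -mulr_sumr.
rewrite big_split big_split /= cst s2.
rewrite addrA [X in X + _](_ : _ = 0) ?add0r //.
by field.
Qed.

(** The common value [U] at a vertex with [d] ends: continuity gives outgoing plus incoming equal to
    [U] at each end, and Kirchhoff's condition equates the two sums, so [d U] is twice the sum of
    the incoming amplitudes. *)
Definition vval (x : End -> C) (j : 'I_J) : C :=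
  let P := [pred q : End | validEnd q && (vertexOf v0 v1 q == j)] in
  rc (2 / #|P|%:R) * \sum_(q | P q) x q.

(* Outgoing amplitudes at the ends produced by the incoming ones under the Kirchhoff conditions. *)
Definition scatter (x : End -> C) (p : End) : C :=
  if validEnd p then vval x (vertexOf v0 v1 p) - x p else 0.

(** At each vertex the real and imaginary parts undergo the reflection above; only the amplitudes at
    invalid ends are lost. *)
Lemma scatter_contr (x : End -> C) :
  \sum_p absC (scatter x p) ^+ 2 <= \sum_p absC (x p) ^+ 2.
Proof.
have -> : \sum_p absC (scatter x p) ^+ 2 =
   \sum_(p : End | validEnd p) absC (vval x (vertexOf v0 v1 p) - x p) ^+ 2.
  rewrite [RHS]big_mkcond; apply: eq_bigr => p _; rewrite /scatter.
  by case: ifP => // _; rewrite absC0 expr0n.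
apply: (@le_trans _ _ (\sum_(p : End | validEnd p) absC (x p) ^+ 2)); last first.
  rewrite [leRHS](bigID (@validEnd K M)) /= lerDl; apply: sumr_ge0 => p _; exact: sqr_ge0.
rewrite (partition_big (vertexOf v0 v1) xpredT) //= [leRHS](partition_big (vertexOf v0 v1) xpredT) //=.
apply: ler_sum => j _.
pose P := [pred q : End | validEnd q && (vertexOf v0 v1 q == j)].
have E : \sum_(p : End | validEnd p && (vertexOf v0 v1 p == j)) absC (vval x (vertexOf v0 v1 p) - x p) ^+ 2 =
  \sum_(p | P p) ((2 / #|P|%:R * (\sum_(k | P k) Re (x k)) - Re (x p)) ^+ 2 +
    (2 / #|P|%:R * (\sum_(k | P k) Im (x k)) - Im (x p)) ^+ 2).
  apply: eq_bigr => p /andP[_ /eqP ->].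
  rewrite -sqmodE /sqmod ReD ReN ImD ImN /vval ReM ImM /= !mul0r subr0 addr0 Re_sum Im_sum //.
rewrite E big_split /= !reflect_real -big_split /=.
rewrite le_eqVlt; apply/orP; left; apply/eqP; apply: eq_bigr => p _.
by rewrite -sqmodE.
Qed.

Lemma scatter_sum (I : finType) (y : I -> End -> C) (c : I -> C) p :
  scatter (fun q => \sum_i y i q * c i) p = \sum_i scatter (y i) p * c i.
Proof.
rewrite /scatter; case: ifP => _; last by rewrite big1 // => i _; rewrite mul0r.
rewrite /vval exchange_big /= mulr_sumr -sumrB; apply: eq_bigr => i _.
by rewrite mulrBl -mulrA -mulr_suml.
Qed.

Lemma scatterB (x y : End -> C) p : scatter (fun q => x q - y q) p = scatter x p - scatter y p.
Proof.
rewrite /scatter; case: ifP => _; last by rewrite subrr.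
by rewrite /vval sumrB; ring.
Qed.

Lemma eq_scatter (x y : End -> C) p : (forall q, validEnd q -> x q = y q) -> scatter x p = scatter y p.
Proof.
move=> xy; rewrite /scatter; case: ifP => // vp; rewrite xy // /vval.
by congr (_ * _ - _); apply: eq_bigr => q /andP[vq _]; exact: xy.
Qed.

Definition flip (p : End) : End := (p.1, ~~ p.2).
Lemma flipK : involutive flip. Proof. by case=> m b; rewrite /flip /= negbK. Qed.

(** The invalid far ends of leads are kept as coordinates. [scatter] vanishes there and [inc0]
    ignores the amplitudes on leads, so [T(z)] acts as the identity on them. *)
Definition nE := #|{: End}|.
Definition end_col (a : End -> C) : 'cV[C]_nE := \col_i a (enum_val i).

Lemma sum_end_col (F : End -> R) : \sum_(i < nE) F (enum_val i) = \sum_p F p.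
Proof.
rewrite [RHS](reindex (fun i : 'I_nE => enum_val i)) //=.
by exists enum_rank => x _; [exact: enum_valK|exact: enum_rankK].
Qed.

Lemma sqnorm_end_col (a : End -> C) : sqnorm (end_col a) = \sum_p absC (a p) ^+ 2.
Proof. by rewrite /sqnorm -sum_end_col; apply: eq_bigr => i _; rewrite mxE. Qed.

Lemma end_col_surj (x : 'cV[C]_nE) : x = end_col (fun p => x (enum_rank p) 0).
Proof. by apply/colP => i; rewrite mxE enum_valK. Qed.

Definition inc0 (a : End -> C) (q : End) : C := if isLead q.1 then 0 else a (flip q).

Definition Smx : 'M[C]_nE :=
  \matrix_(i, j) scatter (inc0 (fun q => (q == enum_val j)%:R)) (enum_val i).

Lemma Smx_mul (a : End -> C) : Smx *m end_col a = end_col (scatter (inc0 a)).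
Proof.
apply/colP => i; rewrite !mxE.
under eq_bigr do rewrite !mxE.
rewrite -(scatter_sum (fun j : 'I_nE => inc0 (fun q => (q == enum_val j)%:R)) (fun j => a (enum_val j))).
apply: eq_scatter => q _; rewrite /inc0; case: ifP => _.
  by rewrite big1 // => k _; rewrite mul0r.
rewrite (bigD1 (enum_rank (flip q))) //= enum_rankK eqxx mul1r big1 ?addr0 // => k kq.
case: eqP => [E|_]; last by rewrite mul0r.
by move: kq; rewrite E enum_valK eqxx.
Qed.

Lemma Smx_contraction : contraction Smx.
Proof.
move=> x; rewrite (end_col_surj x) Smx_mul !sqnorm_end_col; set a := fun p => _.
apply: le_trans (scatter_contr _) _.
rewrite [leRHS](reindex_inj (inv_inj flipK)) /=; apply: ler_sum => q _.
by rewrite /inc0; case: ifP => // _; rewrite absC0 expr0n sqr_ge0.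
Qed.

Definition incz (len : 'I_(K + M) -> R) (z : C) (a : End -> C) (q : End) : C :=
  if isLead q.1 then 0 else expC (ic R * rc (len q.1) * z) * a (flip q).

Definition Tgraph (len : 'I_(K + M) -> R) (z : C) : 'M[C]_nE :=
  Tmx Smx (fun j => len (enum_val j).1) z.

Lemma Tgraph_mul len z (a : End -> C) :
  Tgraph len z *m end_col a = end_col (fun p => a p - scatter (incz len z a) p).
Proof.
rewrite /Tgraph Tmx_mul.
have -> : \col_j (expC (ic R * rc (len (enum_val j).1) * z) * end_col a j 0) =
   end_col (fun p => expC (ic R * rc (len p.1) * z) * a p).
  by apply/colP => i; rewrite !mxE.
by rewrite Smx_mul; apply/colP => i; rewrite !mxE.
Qed.

End Scattering.

(** * Quasimodes on a single edge *)

Section EdgeEstimates.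
Variable R : realType.
Local Notation C := (Cx R).
Local Notation mu := (@lebesgue_measure R).
Local Notation seg X := [set x : R | 0 <= x <= X].

Definition lap (lam : R) (u w : R -> C) (x : R) : C := - w x - Complex (lam ^+ 2) 0 * u x.

(** Twice the component of [u] travelling as [exp (i s lam x)], for [s = 1] or [s = -1] and
    [v = u']. *)
Definition wave (s lam : R) (u v : R -> C) (x : R) : C := u x - rc (s / lam) * ic R * v x.

Lemma H2on_sub (D : set R) (X : R) (u v w : R -> C) : borel D ->
  seg X `<=` D -> H2on D u v w -> H2on (seg X) u v w.
Proof.
move=> mD sub [h1 h2 h3 h4 h5]; have mS := @measurable_seg R 0 X.
split; [exact: sqint_sub h1|exact: sqint_sub h2|exact: sqint_sub h3| |].
- by move=> x /sub; exact: h4.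
- by move=> x /sub; exact: h5.
Qed.

Lemma norm1_ic (k : R) (z : C) : norm1 (rc k * ic R * z) = `|k| * norm1 z.
Proof.
have e1 : Re (rc k * ic R * z) = - (k * Im z) by rewrite !(ReM, ImM) /=; ring.
have e2 : Im (rc k * ic R * z) = k * Re z by rewrite !(ReM, ImM) /=; ring.
by rewrite /norm1 e1 e2 normrN !normrM; ring.
Qed.

(** The function [wave s lam u v] satisfies [g' = i s lam g + (i s / lam) f] with [f] the residual,
    so [ode_bound] controls its drift by the [L^1] norm of [f]. *)
Lemma edge_estimate (X lam eps s : R) (u v w : R -> C) : 0 < lam -> 0 < eps -> s ^+ 2 = 1 ->
  H2on (seg X) u v w ->
  Rintegral mu (seg X) (fun x => sqmod (lap lam u w x)) <= eps ^+ 2 ->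
  forall x, 0 <= x <= X ->
  absC (wave s lam u v x * expC (- (ic R * rc (s * lam)) * rc x) - wave s lam u v 0)
    <= eps * (X + 1) / lam.
Proof.
move=> lam0 eps0 s1 [us vs ws uE vE] fe x xX; have /andP[x0 xX'] := xX.
have mS := @measurable_seg R 0 X.
have sub : seg x `<=` seg X by move=> y /= /andP[-> h]; rewrite (le_trans h).
have msx := @measurable_seg R 0 x.
have cu := sqint_cintegrable us; have cvv := sqint_cintegrable vs; have cw := sqint_cintegrable ws.
pose k : C := rc (s / lam) * ic R.
pose f := lap lam u w.
have fs : sqint (seg X) f.
  have -> : f = fun x => (-1) * w x + (- Complex (lam ^+ 2) 0) * u x.
    by apply/funext => y; rewrite /f /lap; ring.
  exact: sqint_lin.
have cf := sqint_cintegrable fs.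
pose F y := k * f y.
have cF : cintegrable (seg X) F by exact: cintegrableZ.
have cg : cintegrable (seg X) (wave s lam u v).
  by apply: cintegrableB => //; exact: cintegrableZ.
have subc g : cintegrable (seg X) g -> cintegrable (seg x) g by exact: cintegrable_seg_sub.
have lamn : lam != 0 by rewrite gt_eqF.
have gE y : 0 <= y <= x -> wave s lam u v y =
    wave s lam u v 0 + Cint [set z | 0 <= z <= y] (fun z => ic R * rc (s * lam) * wave s lam u v z + F z).
  move=> /andP[y0 yx]; have yX : 0 <= y <= X by rewrite y0 (le_trans yx).
  have csub g : cintegrable (seg X) g -> cintegrable (seg y) g.
    by apply: cintegrable_seg_sub => //; exact: le_trans xX'.
  have -> : (fun z => ic R * rc (s * lam) * wave s lam u v z + F z) = (fun z => v z - k * w z).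
    apply/funext => z; rewrite /F /f /lap /wave /k.
    have -> : Complex (lam ^+ 2) 0 = rc lam * rc lam by rewrite -rcM expr2.
    have e1 : rc (s / lam) * rc lam = rc s by rewrite -rcM divfK.
    have e2 : rc s * rc s = 1 by rewrite -rcM -expr2 s1.
    have e3 := sqr_ic R.
    rewrite rcM.
    have -> : ic R * (rc s * rc lam) * (u z - rc (s / lam) * ic R * v z) +
       rc (s / lam) * ic R * (- w z - rc lam * rc lam * u z) =
       ic R * rc s * rc lam * u z - (ic R * ic R) * rc s * (rc (s / lam) * rc lam) * v z -
       rc (s / lam) * ic R * w z - (rc (s / lam) * rc lam) * ic R * rc lam * u z by ring.
    rewrite e1 e3.
    have -> : ic R * rc s * rc lam * u z - -1 * rc s * rc s * v z - rc (s / lam) * ic R * w z -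
      rc s * ic R * rc lam * u z = (rc s * rc s) * v z - rc (s / lam) * ic R * w z by ring.
    by rewrite e2 mul1r.
  have my := @measurable_seg R 0 y.
  rewrite CintB //; [|exact: csub|by apply: cintegrableZ => //; exact: csub].
  rewrite CintZ //; last exact: csub.
  rewrite /wave (uE y yX) (vE y yX) -/k; ring.
have := @ode_bound R (wave s lam u v) F (s * lam) x x0 (subc _ cg) (subc _ cF) gE.
move=> /le_trans; apply.
have -> : Rintegral mu (seg x) (fun x => norm1 (F x)) = lam^-1 * Rintegral mu (seg x) (fun x => norm1 (f x)).
  rewrite -RintegralZl //; last by apply: norm1_integrable => //; exact: subc.
  apply: eq_Rintegral => y _; rewrite /F /k norm1_ic; congr (_ * _).
  rewrite normrM; have -> : `|s| = 1.
    by apply/eqP; rewrite -sqrp_eq1 ?normr_ge0 // real_normK ?num_real // s1.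
  by rewrite mul1r gtr0_norm // invr_gt0.
rewrite mulrC; apply: ler_wpM2r; first by rewrite invr_ge0 ltW.
apply: (@le_trans _ _ (eps * (x - 0 + 1))); last first.
  by apply: ler_wpM2l; [exact: ltW|lra].
apply: norm1_sqmod_bound => //; first exact: sqint_sub fs.
apply: le_trans fe; apply: Rintegral_sub => //.
- by move=> y; exact: sqmod_ge0.
- exact: sqint_sqmod_integrable.
Qed.

(** Beyond [Rr] the integrals of [v] vanish because [u] does, while [v] varies by no more than the
    increment of [W]. Hence [|v x0|] is at most twice that increment over arbitrarily short
    intervals, and [W] is continuous. *)
Lemma lead_vanish (Rr : R) (u v w : R -> C) : 0 < Rr ->
  H2on [set x | 0 <= x] u v w -> (forall x, Rr < x -> u x = 0) ->
  forall x0, Rr < x0 -> v x0 = 0.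
Proof.
move=> Rr0 H uz x0 x0R.
have x00 : 0 < x0 by exact: lt_trans x0R.
pose b := x0 + 1; have b0 : 0 < b by rewrite /b; lra.
have mD : borel [set x : R | 0 <= x].
  by rewrite -set_itvcy.
have sub : seg b `<=` [set x : R | 0 <= x] by move=> y /= /andP[].
have [us vs ws uE vE] := H2on_sub mD sub H.
have cw := sqint_cintegrable ws; have cvv := sqint_cintegrable vs.
have msb := @measurable_seg R 0 b.
pose W x := Rintegral mu (seg x) (fun y => norm1 (w y)).
have iw : mu.-integrable (seg b) (EFin \o (fun y => norm1 (w y))) by exact: norm1_integrable.
have vd x y : 0 <= x -> x <= y -> y <= b -> absC (v y - v x) <= W y - W x.
  move=> h0 xy yb; have subc : cintegrable (seg y) w by exact: cintegrable_seg_sub cw.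
  have ey := vE y (introT andP (conj (le_trans h0 xy) yb)).
  have ex := vE x (introT andP (conj h0 (le_trans xy yb))).
  rewrite ey ex.
  rewrite (@Cint_seg_cat _ _ 0 x y) // /W (@Rintegral_seg_cat _ _ 0 x y) //; last first.
    exact: integrable_seg_sub iw.
  have -> (p q r : C) : p + (q + r) - (p + q) = r by ring.
  have -> (p q : R) : p + q - p = q by ring.
  apply: absC_Cint_norm1; first exact: measurable_seg.
  exact: cintegrable_seg_sub cw.
have vb y : x0 < y -> y <= b -> absC (v x0) <= 2 * (W y - W x0).
  move=> xy yb; have yx : 0 < y - x0 by rewrite subr_gt0.
  have cs g : cintegrable (seg b) g -> cintegrable [set z | x0 <= z <= y] g.
    by apply: cintegrable_seg_sub => //; exact: ltW.
  have mxy := @measurable_seg R x0 y.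
  have cI (c : C) : cintegrable [set z | x0 <= z <= y] (fun=> c).
    by split; exact: integrable_cst_seg.
  have z1 : Cint [set z | x0 <= z <= y] v = 0.
    have h1 := uE y; have h2 := uE x0.
    have e1 : u y = 0 by apply: uz; exact: lt_trans xy.
    have e2 : u x0 = 0 by exact: uz.
    have x0in : 0 <= x0 <= b by rewrite (ltW x00) (le_trans (ltW xy)).
    have yin : 0 <= y <= b by rewrite yb andbT ltW // (lt_trans x00).
    have cvy : cintegrable (seg y) v by exact: cintegrable_seg_sub cvv.
    have := h1 yin; rewrite e1 (@Cint_seg_cat _ _ 0 x0 y (ltW x00) (ltW xy)) //.
    by rewrite addrA -(h2 x0in) e2 add0r => <-.
  have E : v x0 * rc (y - x0) = - Cint [set z | x0 <= z <= y] (fun s => v s - v x0).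
    rewrite CintB //; last exact: cs.
    by rewrite z1 sub0r opprK Cint_cst_seg ?(ltW xy).
  have B : absC (Cint [set z | x0 <= z <= y] (fun s => v s - v x0)) <= 2 * (W y - W x0) * (y - x0).
    apply: absC_Cint_seg; [exact: ltW|by apply: cintegrableB => //; exact: cs|].
    move=> s /andP[xs sy]; apply: le_trans (vd x0 s _ _ _) _ => //; [exact: ltW|exact: le_trans yb|].
    rewrite lerD2r -subr_ge0; apply: le_trans (absC_ge0 (v y - v s)) (vd s y _ _ _) => //.
    by apply: le_trans xs; exact: ltW.
  have := congr1 (@absC R) E; rewrite absCN absCM absC_rc gtr0_norm // => E'.
  by rewrite -(ler_pM2r yx) E'.
apply/eqP; rewrite -absC_eq0 eq_le absC_ge0 andbT; apply/ler_addgt0Pr => e e0; rewrite add0r.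
have iw' : mu.-integrable `[0, b] (EFin \o (fun y => norm1 (w y))).
  by rewrite set_itvcc.
have cW := parameterized_integral_continuous (ltW b0) iw'.
have : {for x0, continuous W}.
  have EW : W = parameterized_integral mu 0 ^~ (fun y => norm1 (w y)).
    by apply/funext => x; rewrite /W /parameterized_integral set_itvcc.
  have /continuous_within_itvP := cW => /(_ b0) [h _ _].
  by rewrite EW; apply: h; rewrite in_itv /= x00 /b; lra.
move=> /cvgrPdist_le => /(_ (e / 2)); rewrite divr_gt0 // => /(_ isT) /nbhs_ballP[d /= d0 dP].
pose y := x0 + Num.min (d / 2) 1.
have m0 : 0 < Num.min (d / 2) 1 by rewrite lt_min ltr01 andbT divr_gt0.
have m1 : Num.min (d / 2) 1 <= 1 by rewrite ge_min lexx orbT.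
have m2 : Num.min (d / 2) 1 <= d / 2 by rewrite ge_min lexx.
apply: le_trans (vb y _ _) _; [by rewrite /y; lra|by rewrite /y /b; lra|].
have := dP y; rewrite /ball /= => /(_ _).
have yd : `|x0 - y| < d.
  by rewrite /y opprD addrA subrr sub0r normrN gtr0_norm //; lra.
move=> /(_ yd); rewrite ler_norml => /andP[h1 h2]; lra.
Qed.

End EdgeEstimates.

(** * From a quasimode to an approximate null vector *)

Section QuasiVector.
Variables (R : realType) (J K M : nat) (v0 v1 : 'I_(K + M) -> 'I_J).
Local Notation C := (Cx R).
Local Notation mu := (@lebesgue_measure R).
Local Notation End := ('I_(K + M) * bool)%type.
Local Notation seg X := [set x : R | 0 <= x <= X].

Lemma measurable_edom (l : 'I_(K + M) -> R) m : borel (edom l m).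
Proof. by rewrite /edom; case: ifP => _; [rewrite -set_itvcy|exact: measurable_seg]. Qed.

Lemma waveD (lam : R) (u v : R -> C) x :
  u x = rc (1 / 2) * wave 1 lam u v x + rc (1 / 2) * wave (-1) lam u v x.
Proof.
have h : rc (1 / 2 : R) + rc (1 / 2) = 1 by rewrite -rcD -rc1; congr rc; field.
have e : rc (-1 / lam) = - rc (1 / lam) by rewrite mulN1r rcN mul1r.
by rewrite /wave e -[LHS]mul1r -h; ring.
Qed.

(** The vertex conditions hold exactly for [u]; only propagation is inexact, by [eta], and on a lead
    the incoming amplitude is within [eta] of 0 because [u] vanishes far out. The second conclusion
    is a lower bound on [a] in contrapositive form: small amplitudes and small [eta] are
    incompatible with [u] having norm 1. *)
Lemma quasi_vector (l len : 'I_(K + M) -> R) (Rr Xm lam eps : R) (u w : 'I_(K + M) -> R -> C) :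
  0 < lam -> 0 < eps -> 0 < Rr -> Rr + 1 <= Xm ->
  (forall m, ~~ isLead m -> 0 < l m <= Xm) -> (forall m, ~~ isLead m -> len m = l m) ->
  inDP v0 v1 l u w -> inHR Rr u -> L2norm l u = 1 ->
  L2norm l (fun m => lap lam (u m) (w m)) = eps ->
  let eta := eps * (Xm + 1) / lam in
  exists a : End -> C,
    sqnorm (Tgraph v0 v1 len (rc lam) *m end_col a) <= ((nE K M)%:R * eta) ^+ 2 /\
    forall q, 0 <= q -> sqnorm (end_col a) <= q ^+ 2 -> 1 <= (K + M)%:R * (Xm * (2 * q + 2 * eta) ^+ 2).
Proof.
move=> lam0 eps0 Rr0 RX lX lenE [v [uH ucont ukir]] uR u1 feps eta.
(* A lead is cut past [Rr], at a point where both [u] and its derivative vanish. *)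
pose Xof m : R := if isLead m then Rr + 1 else l m.
have Xof0 m : 0 < Xof m.
  by rewrite /Xof; case: ifPn => [_|/lX/andP[]//]; lra.
have XofX m : Xof m <= Xm by rewrite /Xof; case: ifPn => [_|/lX/andP[]].
have Xsub m : seg (Xof m) `<=` edom l m.
  by rewrite /Xof /edom; case: ifP => _ x //= /andP[].
have mE := measurable_edom l.
have mS m := @measurable_seg R 0 (Xof m).
have uHs m : H2on (seg (Xof m)) (u m) (v m) (w m) by exact: H2on_sub (mE m) (Xsub m) (uH m).
have eta0 : 0 < eta by rewrite /eta divr_gt0 // mulr_gt0 //; lra.
have L2E (g : 'I_(K + M) -> R -> C) (c : R) : 0 <= c -> L2norm l g = c ->
    \sum_m Rintegral mu (edom l m) (fun x => sqmod (g m x)) = c ^+ 2.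
  move=> c0 <-; rewrite /L2norm sqr_sqrtr // sumr_ge0 // => m _.
  by apply: Rintegral_ge0 => x _; exact: sqmod_ge0.
have fs m : sqint (edom l m) (lap lam (u m) (w m)).
  have [us _ ws _ _] := uH m.
  have -> : lap lam (u m) (w m) = fun x => (-1) * w m x + (- Complex (lam ^+ 2) 0) * u m x.
    by apply/funext => y; rewrite /lap; ring.
  exact: sqint_lin.
have fe m : Rintegral mu (seg (Xof m)) (fun x => sqmod (lap lam (u m) (w m) x)) <= eps ^+ 2.
  rewrite -(L2E _ _ (ltW eps0) feps) (bigD1 m) //=.
  apply: (@le_trans _ _ (Rintegral mu (edom l m) (fun x => sqmod (lap lam (u m) (w m) x)))).
    apply: Rintegral_sub => //; first by move=> x; exact: sqmod_ge0.
    exact: sqint_sqmod_integrable.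
  rewrite lerDl; apply: sumr_ge0 => k _; apply: Rintegral_ge0 => x _; exact: sqmod_ge0.
have est m s x : s ^+ 2 = 1 -> 0 <= x <= Xof m ->
    absC (wave s lam (u m) (v m) x * expC (- (ic R * rc (s * lam)) * rc x) -
      wave s lam (u m) (v m) 0) <= eta.
  move=> s1 xX; apply: le_trans (edge_estimate lam0 eps0 s1 (uHs m) (fe m) xX) _.
  rewrite /eta ler_wpM2r ?invr_ge0 ?(ltW lam0) // ler_wpM2l ?(ltW eps0) //.
  by rewrite lerD2r XofX.
have phase s x : absC (expC (- (ic R * rc (s * lam)) * rc x)) = 1.
  rewrite absC_expC [Re _](_ : _ = 0) ?expR0 //.
  by rewrite !(ReM, ReN, ImN, ImM) /=; ring.
pose kk : C := rc (1 / lam) * ic R.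
(* Amplitudes leaving ([lv]) and reaching ([iv]) the vertex at an end. Written with the outward
   derivative, the formulas are the same at both ends, and [wave 1] and [wave (-1)] exchange roles
   between them. *)
pose lv (p : End) : C := rc (1 / 2) * (u p.1 (posOf l p) + kk * dnu l v p).
pose iv (p : End) : C := rc (1 / 2) * (u p.1 (posOf l p) - kk * dnu l v p).
pose a (p : End) : C := if validEnd p then lv p else 0.
have half1 : absC (rc (1 / 2) : C) = 1 / 2 by rewrite absC_rc ger0_norm //; lra.
have kN : rc (-1 / lam) = - rc (1 / lam) by rewrite mulN1r rcN mul1r.
have lvf m : lv (m, false) = rc (1 / 2) * wave 1 lam (u m) (v m) 0.
  by rewrite /lv /wave /dnu /posOf /= mulrN.
have ivf m : iv (m, false) = rc (1 / 2) * wave (-1) lam (u m) (v m) 0.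
  by rewrite /iv /wave /dnu /posOf /= mulrN /kk kN !mulNr.
have lvt m : lv (m, true) = rc (1 / 2) * wave (-1) lam (u m) (v m) (l m).
  by rewrite /lv /wave /dnu /posOf /= /kk kN !mulNr opprK.
have ivt m : iv (m, true) = rc (1 / 2) * wave 1 lam (u m) (v m) (l m).
  by rewrite /iv /wave /dnu /posOf /=.
have vert p : validEnd p -> lv p = scatter v0 v1 iv p.
  move=> vp; rewrite /scatter vp /vval.
  set P := [pred q : End | _].
  have dP : #|P|%:R != 0 :> R.
    rewrite pnatr_eq0 -lt0n; apply/card_gt0P; exists p.
    by rewrite inE vp /=.
  have sumiv : \sum_(q | P q) iv q = rc (1 / 2 * #|P|%:R) * u p.1 (posOf l p).
    rewrite /iv -mulr_sumr sumrB -mulr_sumr (ukir (vertexOf v0 v1 p)) mulr0 subr0 (rcM (1 / 2)) -mulrA.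
    congr (_ * _); rewrite (eq_bigr (fun=> u p.1 (posOf l p))); last first.
      by move=> q /andP[vq /eqP vqp]; exact: ucont.
    have rcn n : (rc n%:R : C) = n%:R.
      by elim: n => [//|n IH]; rewrite -!natr1 rcD IH.
    by rewrite sumr_const -[LHS]mulr_natl rcn.
  rewrite sumiv mulrA -rcM (_ : 2 / #|P|%:R * (1 / 2 * #|P|%:R) = 1); last by field.
  have h : rc (1 / 2 : R) + rc (1 / 2) = 1 by rewrite -rcD -rc1; congr rc; field.
  rewrite rc1 -[X in X * u _ _]h /lv /iv; ring.
(* The propagation defect. As the vertex conditions are exact, [T a] is the image of [y] under
   [scatter]. *)
pose y q : C := if validEnd q then iv q - incz len (rc lam) a q else 0.
have yb q : absC (y q) <= eta.
  rewrite /y; case: ifPn => vq; last by rewrite absC0 ltW.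
  rewrite /incz; case: q vq => m b; rewrite /validEnd /= => vq.
  have [lead|fin] := boolP (isLead m).
    move: vq; rewrite lead orbF => /negPf bf; rewrite bf subr0 ivf absCM half1.
    have x0 : Rr < Rr + 1 by lra.
    have vz : v m (Rr + 1) = 0.
      by apply: (@lead_vanish R Rr (u m) (v m) (w m)) => //;
        [have := uH m; rewrite /edom lead|exact: uR].
    have := est m (-1) (Rr + 1) (ltac:(by rewrite sqrrN expr1n))
      (ltac:(by rewrite /Xof lead lexx andbT; lra)).
    rewrite {1}/wave uR // vz mulr0 subr0 mul0r sub0r absCN => h.
    by have := absC_ge0 (wave (-1) lam (u m) (v m) 0); lra.
  have lm : 0 <= l m <= Xof m by rewrite /Xof (negPf fin) lexx andbT ltW //; have /andP[] := lX m fin.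
  rewrite /a /flip /validEnd /= fin orbT (lenE m fin).
  case: b vq => _ /=.
    rewrite lvf ivt.
    have := est m 1 (l m) (expr1n _ _) lm; rewrite mul1r.
    set e := expC (- (ic R * rc lam) * rc (l m)); set e' := expC _.
    have ee : e' * e = 1 by rewrite /e /e' -expCD -expC0; congr expC; ring.
    have e1 : absC e' = 1.
      by rewrite absC_expC Re_iLz /= mulr0 oppr0 expR0.
    have -> : rc (1 / 2) * wave 1 lam (u m) (v m) (l m) - e' * (rc (1 / 2) * wave 1 lam (u m) (v m) 0) =
       rc (1 / 2) * (e' * (wave 1 lam (u m) (v m) (l m) * e - wave 1 lam (u m) (v m) 0)).
      rewrite -[X in _ * X - _]mul1r -[X in _ * (X * _) - _]ee; ring.
    rewrite !absCM half1 e1 mul1r => h.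
    have := absC_ge0 (wave 1 lam (u m) (v m) (l m) * e - wave 1 lam (u m) (v m) 0); lra.
  rewrite lvt ivf.
  have := est m (-1) (l m) (ltac:(by rewrite sqrrN expr1n)) lm.
  have -> : - (ic R * rc (-1 * lam)) * rc (l m) = ic R * rc (l m) * rc lam.
    by rewrite mulN1r rcN; ring.
  set e' := expC _.
  have -> : rc (1 / 2) * wave (-1) lam (u m) (v m) 0 - e' * (rc (1 / 2) * wave (-1) lam (u m) (v m) (l m)) =
     - (rc (1 / 2) * (wave (-1) lam (u m) (v m) (l m) * e' - wave (-1) lam (u m) (v m) 0)) by ring.
  rewrite absCN !absCM half1 => h.
  have := absC_ge0 (wave (-1) lam (u m) (v m) (l m) * e' - wave (-1) lam (u m) (v m) 0); lra.
exists a; split.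
  rewrite Tgraph_mul sqnorm_end_col.
  have E p : a p - scatter v0 v1 (incz len (rc lam) a) p = scatter v0 v1 y p.
    rewrite (@eq_scatter _ _ _ _ v0 v1 y (fun q => iv q - incz len (rc lam) a q)); last first.
      by move=> q vq; rewrite /y vq.
    rewrite scatterB; congr (_ - _); rewrite /a; case: ifPn => vp; first exact: vert.
    by rewrite /scatter (negPf vp).
  under eq_bigr do rewrite E.
  apply: le_trans (scatter_contr _ _ _) _.
  apply: (@le_trans _ _ (\sum_(p : End) eta ^+ 2)).
    by apply: ler_sum => p _; rewrite lerXn2r ?nnegrE ?absC_ge0 // ltW.
  rewrite sumr_const -[leLHS]mulr_natl (exprMn 2 (nE K M)%:R eta) ler_wpM2r ?sqr_ge0 //.
  rewrite -natrX ler_nat -/(nE K M) expnS expn1.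
  by case: (nE K M) => // n; rewrite leq_pmulr.
move=> q q0 aq.
have ab p : absC (a p) <= q.
  have := @sqnorm_entry_le _ _ (end_col a) (enum_rank p) q q0 aq.
  by rewrite mxE enum_rankK.
have ub m x : 0 <= x <= Xof m -> absC (u m x) <= 2 * q + 2 * eta.
  move=> xX.
  have wb s : s ^+ 2 = 1 -> absC (wave s lam (u m) (v m) x) <= absC (wave s lam (u m) (v m) 0) + eta.
    move=> s1; have := est m s x s1 xX.
    set e := expC _ => h; have e1 : absC e = 1 by exact: phase.
    have := absC_sub (wave s lam (u m) (v m) x * e) (wave s lam (u m) (v m) 0).
    rewrite absCM e1 mulr1; lra.
  rewrite (@waveD lam (u m) (v m)); apply: le_trans (absCD _ _) _.
  rewrite !absCM half1.
  have h1 := wb 1 (expr1n _ _); have h2 := wb (-1) (ltac:(by rewrite sqrrN expr1n)).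
  have a1 : absC (wave 1 lam (u m) (v m) 0) <= 2 * q.
    have := ab (m, false); rewrite /a /validEnd /= lvf absCM half1; lra.
  have a2 : absC (wave (-1) lam (u m) (v m) 0) <= 2 * q + 2 * eta.
    have := yb (m, false); rewrite /y /validEnd /= ivf => h.
    have ib : absC (incz len (rc lam) a (m, false)) <= q.
      rewrite /incz; case: ifP => _; first by rewrite absC0.
      by rewrite absCM absC_expC Re_iLz /= mulr0 oppr0 expR0 mul1r.
    have := absC_sub (rc (1 / 2) * wave (-1) lam (u m) (v m) 0) (incz len (rc lam) a (m, false)).
    rewrite absCM half1; lra.
  lra.
pose B := (2 * q + 2 * eta) ^+ 2.
have B0 : 0 <= B by exact: sqr_ge0.
have Ib m : Rintegral mu (edom l m) (fun x => sqmod (u m x)) <= Xm * B.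
  have -> : Rintegral mu (edom l m) (fun x => sqmod (u m x)) =
      Rintegral mu (seg (Xof m)) (fun x => sqmod (u m x)).
    rewrite Rintegral_mkcond [RHS]Rintegral_mkcond; congr Rintegral; apply/funext => x.
    rewrite !patchE; case: (boolP (x \in seg (Xof m))) => xs.
      by rewrite (mem_set (Xsub m _ (set_mem xs))).
    case: ifP => // xe; move: xs xe; rewrite /Xof /edom; have [lead|_ /negPf-> //] := boolP (isLead m).
    move=> xs /set_mem /= x0; rewrite uR //; first by rewrite /sqmod /= expr0n addr0.
    rewrite ltNge; apply/negP => xR; move/negP : xs; apply; apply/mem_set => /=.
    by rewrite x0 (le_trans xR) // lerDl.
  apply: (@le_trans _ _ (B * (Xof m - 0))); last first.
    by rewrite subr0 mulrC; apply: ler_wpM2r.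
  rewrite -(@Rint_cst_seg _ 0 (Xof m)) ?(ltW (Xof0 m)) //.
  have [us _ _ _ _] := uHs m.
  apply: le_Rintegral => //; first exact: sqint_sqmod_integrable.
    exact: integrable_cst_seg.
  move=> x xX; rewrite sqmodE /B lerXn2r ?nnegrE ?absC_ge0 //; last exact: ub.
  by rewrite addr_ge0 // mulr_ge0 // ltW.
have S1 := L2E u 1 ler01 u1; rewrite -[leLHS](expr1n _ 2) -S1.
apply: (@le_trans _ _ (\sum_(m < K + M) (Xm * B))); first exact: ler_sum.
by rewrite sumr_const card_ord [leRHS]mulr_natl.
Qed.

End QuasiVector.

(** * Outgoing solutions for an exponential source *)

Section ExponentialSolutions.
Variable R : realType.
Local Notation C := (Cx R).
Local Notation mu := (@lebesgue_measure R).
Local Notation seg X := [set x : R | 0 <= x <= X].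

Lemma rdiff_measurable (G g : R -> C) (D : set R) : rdiff G g -> borel D ->
  measurable_fun D (fun x => Re (G x)) /\ measurable_fun D (fun x => Im (G x)).
Proof.
move=> dG mD; split; apply: measurable_funTS; apply: continuous_measurable_fun => x;
  have [h1 h2] := dG x; apply: rcont_continuous; [exact: is_derive_rcont h1|exact: is_derive_rcont h2].
Qed.

Lemma rdiff_sqint (G g : R -> C) (L : R) : rdiff G g -> sqint (seg L) G.
Proof.
move=> dG; have [m1 m2] := rdiff_measurable dG (@measurable_seg R 0 L).
split => //.
have : mu.-integrable (seg L) (EFin \o (fun x => sqmod (G x))).
  apply: rcont_integrable => x _; have [h1 h2] := dG x.
  have := is_deriveD (is_deriveX 2 h1) (is_deriveX 2 h2).
  have -> : (fun t => Re (G t)) ^+ 2 + (fun t => Im (G t)) ^+ 2 =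
     (fun x => sqmod (G x)).
    by apply/funext => t; rewrite /sqmod.
  exact: is_derive_rcont.
move=> /integrableP[_]; apply: le_lt_trans; apply: ge0_le_integral => //.
- exact: measurable_seg.
- by move=> x _; rewrite lee_fin sqmod_ge0.
- by apply/measurable_EFinP; apply: measurable_funD; exact: measurable_funX.
- apply: measurableT_comp => //; apply/measurable_EFinP; apply: measurable_funD; exact: measurable_funX.
- by move=> x _; rewrite /= lee_fin ler_norm.
Qed.

(** The square modulus is a multiple of the exponential density of rate [- 2 Re c]. *)
Lemma exp_sqint (c k : C) : Re c < 0 ->
  sqint [set x : R | 0 <= x] (fun x => k * expC (c * rc x)).
Proof.
move=> c0; have mD : borel [set x : R | 0 <= x] by rewrite -set_itvcy.
have [m1 m2] := rdiff_measurable (@rdiff_expCZ R k c) mD.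
split => //.
pose r := - (2 * Re c); have r0 : 0 < r by rewrite /r; lra.
have I := integrable_exponential_pdf r0.
have I2 : mu.-integrable [set x : R | 0 <= x]
   (EFin \o (fun x => (absC k ^+ 2 / r) * exponential_pdf r x + 0 * exponential_pdf r x)).
  by apply: integrable_lin => //; apply: integrableS I.
have /integrableP[_] := I2; apply: le_lt_trans; apply: ge0_le_integral => //.
- by move=> x _; rewrite lee_fin sqmod_ge0.
- by apply/measurable_EFinP; apply: measurable_funD; exact: measurable_funX.
- by apply: measurableT_comp => //; case/integrableP: I2.
- move=> x /= x0; rewrite lee_fin; apply: le_trans (ler_norm _).
  rewrite mul0r addr0 exponential_pdfE // mulrA divfK ?gt_eqF //.
  rewrite sqmodE absCM exprMn ler_wpM2l ?sqr_ge0 // absC_expC.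
  rewrite expr2 -expRD ler_expR /r ReM /= mulr0 subr0.
  by rewrite le_eqVlt; apply/orP; left; apply/eqP; ring.
Qed.

Definition exp3 (c1 c2 c3 k1 k2 k3 : C) (x : R) : C :=
  k1 * expC (c1 * rc x) + k2 * expC (c2 * rc x) + k3 * expC (c3 * rc x).

Lemma rdiff_exp3 c1 c2 c3 k1 k2 k3 :
  rdiff (exp3 c1 c2 c3 k1 k2 k3) (exp3 c1 c2 c3 (k1 * c1) (k2 * c2) (k3 * c3)).
Proof.
have -> : exp3 c1 c2 c3 (k1 * c1) (k2 * c2) (k3 * c3) = fun x =>
   k1 * (c1 * expC (c1 * rc x)) + k2 * (c2 * expC (c2 * rc x)) + k3 * (c3 * expC (c3 * rc x)).
  by apply/funext => x; rewrite /exp3; ring.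
by apply: rdiffD; [apply: rdiffD|]; exact: rdiff_expCZ.
Qed.

Lemma H2on_exp3 (L : R) c1 c2 c3 k1 k2 k3 :
  H2on (seg L) (exp3 c1 c2 c3 k1 k2 k3) (exp3 c1 c2 c3 (k1 * c1) (k2 * c2) (k3 * c3))
    (exp3 c1 c2 c3 (k1 * c1 * c1) (k2 * c2 * c2) (k3 * c3 * c3)).
Proof.
have d := @rdiff_exp3 c1 c2 c3.
split; try (by apply: rdiff_sqint; exact: d).
- move=> x /andP[x0 _]; rewrite (Cint_FTC x0 (d _ _ _) (d _ _ _)); ring.
- move=> x /andP[x0 _]; rewrite (Cint_FTC x0 (d _ _ _) (d _ _ _)); ring.
Qed.

Lemma H2on_exp3_lead c1 c2 c3 k1 : Re c1 < 0 ->
  H2on [set x : R | 0 <= x] (exp3 c1 c2 c3 k1 0 0) (exp3 c1 c2 c3 (k1 * c1) (0 * c2) (0 * c3))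
    (exp3 c1 c2 c3 (k1 * c1 * c1) (0 * c2 * c2) (0 * c3 * c3)).
Proof.
move=> c0; have d := @rdiff_exp3 c1 c2 c3.
have E k : exp3 c1 c2 c3 k 0 0 = fun x => k * expC (c1 * rc x).
  by apply/funext => x; rewrite /exp3 !mul0r !addr0.
split.
- by rewrite E; exact: exp_sqint.
- by rewrite !mul0r E; exact: exp_sqint.
- by rewrite !mul0r E; exact: exp_sqint.
- move=> x /= x0; rewrite (Cint_FTC x0 (d _ _ _) (d _ _ _)); ring.
- move=> x /= x0; rewrite (Cint_FTC x0 (d _ _ _) (d _ _ _)); ring.
Qed.

Lemma Cint_exp3 (a b : R) c1 c2 c3 k1 k2 k3 : a <= b ->
  Cint [set x : R | a <= x <= b] (exp3 c1 c2 c3 k1 k2 k3) =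
  k1 * Cint [set x | a <= x <= b] (fun x => expC (c1 * rc x)) +
  k2 * Cint [set x | a <= x <= b] (fun x => expC (c2 * rc x)) +
  k3 * Cint [set x | a <= x <= b] (fun x => expC (c3 * rc x)).
Proof.
move=> ab; have mS := @measurable_seg R a b.
have ci c : cintegrable [set x | a <= x <= b] (fun x => expC (c * rc x)).
  exact: rdiff_cintegrable (@rdiff_expC R c).
have cz k c : cintegrable [set x | a <= x <= b] (fun x => k * expC (c * rc x)).
  exact: cintegrableZ.
rewrite /exp3 CintD // ?CintD // ?CintZ //; exact: cintegrableD.
Qed.

Variables (J K M : nat) (v0 v1 : 'I_(K + M) -> 'I_J) (l len : 'I_(K + M) -> R).
Local Notation End := ('I_(K + M) * bool)%type.
Local Notation E := 'I_(K + M).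

Definition wavenum (z : C) : C := ic R * z.

(* Amplitudes, leaving and reaching the vertices, of [x |-> expC (i kap x)] on the
   edge [m0] at frequency [z], multiplied by [z] to avoid the division. *)
Definition srcout (z kap : C) (m0 : E) (p : End) : C :=
  if p.1 == m0 then
    if p.2 then rc (1 / 2) * (z - kap) * expC (wavenum kap * rc (l m0)) else rc (1 / 2) * (z + kap)
  else 0.
Definition srcin (z kap : C) (m0 : E) (p : End) : C :=
  if p.1 == m0 then
    if p.2 then rc (1 / 2) * (z + kap) * expC (wavenum kap * rc (l m0)) else rc (1 / 2) * (z - kap)
  else 0.

(** The particular solution is [s exp (i kap x)]; the free waves carry the same factor [s], which
    keeps the linear system for [a] regular at [z = kap] and [z = - kap]. The amplitude
    [a (m, true)] is measured at [x = l m], hence its phase. *)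
Definition solU (z kap : C) (m0 : E) (a : End -> C) (m : E) : R -> C :=
  let s := (kap ^+ 2 - z ^+ 2)^-1 in
  exp3 (wavenum z) (- wavenum z) (wavenum kap) (s * a (m, false))
    (s * (if isLead m then 0 else a (m, true) * expC (wavenum z * rc (l m))))
    (s * (m == m0)%:R).

(** The last hypothesis says that the total leaving amplitudes, source included, are the scattered
    reaching ones, which encodes both vertex conditions. [Im z > 0] makes the outgoing waves on the
    leads square integrable. *)
Lemma graph_solution (z kap : C) (m0 : E) (a : End -> C) :
  0 < Im z -> kap ^+ 2 - z ^+ 2 != 0 -> ~~ isLead m0 ->
  (forall m, ~~ isLead m -> len m = l m) ->
  (forall p, z * (a p - scatter v0 v1 (incz len z a) p) =
     scatter v0 v1 (srcin z kap m0) p - srcout z kap m0 p) ->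
  solves v0 v1 l z (fun m x => (m == m0)%:R * expC (wavenum kap * rc x)) (solU z kap m0 a).
Proof.
move=> z0 kz m0f lenE aE.
have zn : z != 0 by apply: contraTneq z0 => ->; rewrite ltxx.
set s := (kap ^+ 2 - z ^+ 2)^-1.
pose A m := s * a (m, false).
pose B m := s * (if isLead m then 0 else a (m, true) * expC (wavenum z * rc (l m))).
pose D m : C := s * (m == m0)%:R.
pose c1 := wavenum z; pose c2 := - wavenum z; pose c3 := wavenum kap.
exists (fun m => exp3 c1 c2 c3 (A m * c1 * c1) (B m * c2 * c2) (D m * c3 * c3)); split; last first.
  move=> m; apply: aeW => x _.
  rewrite /solU -/s -/c1 -/c2 -/c3 -/(A m) -/(B m) -/(D m) /exp3.
  have s1 : s * (kap ^+ 2 - z ^+ 2) = 1 by rewrite mulVf.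
  have i2 := sqr_ic R.
  transitivity ((- (ic R * ic R) - 1) * z ^+ 2 * (A m * expC (c1 * rc x) + B m * expC (c2 * rc x)) +
     (- (ic R * ic R) * kap ^+ 2 - z ^+ 2) * (D m * expC (c3 * rc x))).
    by rewrite /c1 /c2 /c3 /wavenum; ring.
  rewrite i2 opprK subrr !mul0r add0r mul1r /D.
  transitivity (s * (kap ^+ 2 - z ^+ 2) * ((m == m0)%:R * expC (c3 * rc x))); first by ring.
  by rewrite s1 mul1r.
exists (fun m => exp3 c1 c2 c3 (A m * c1) (B m * c2) (D m * c3)).
(* Total amplitudes multiplied by [z], leaving ([ot]) and reaching ([it]): the value at an end is
   [s (ot + it) / z], the outward derivative [s i (it - ot)]. *)
pose ot p := z * a p + srcout z kap m0 p.
pose it p := z * incz len z a p + srcin z kap m0 p.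
have otit p : ot p = scatter v0 v1 it p.
  have -> : scatter v0 v1 it p = z * scatter v0 v1 (incz len z a) p + scatter v0 v1 (srcin z kap m0) p.
    rewrite /scatter /it; case: ifP => _; last by rewrite mulr0 addr0.
    by rewrite /vval big_split /= -mulr_sumr; ring.
  rewrite /ot; have := aE p; rewrite mulrBr => h.
  have -> : z * a p = scatter v0 v1 (srcin z kap m0) p - srcout z kap m0 p + z * scatter v0 v1 (incz len z a) p.
    by rewrite -h; ring.
  ring.
have h2 : rc (1 / 2 : R) + rc (1 / 2) = 1 by rewrite -rcD -rc1; congr rc; field.
have i2 := sqr_ic R.
have val (p : End) : validEnd p -> z * solU z kap m0 a p.1 (posOf l p) = s * (ot p + it p).
  case: p => m [] /=; rewrite /validEnd /= /posOf /= => lm.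
    rewrite /solU -/s /exp3 (negPf lm) /ot /it /srcout /srcin /incz (negPf lm) /flip /= lenE //.
    have e1 : expC (ic R * rc (l m) * z) = expC (wavenum z * rc (l m)).
      by congr expC; rewrite /wavenum; ring.
    rewrite e1; set e := expC (wavenum z * rc (l m)).
    have e2 : e * expC (- wavenum z * rc (l m)) = 1.
      by rewrite -expCD -expC0; congr expC; ring.
    set e' := expC (- _ * _) in e2 *.
    case: eqP => [->|_]; rewrite ?mulr1n ?mulr0n.
      set P := expC (wavenum kap * _).
      transitivity (s * (z * (a (m0, false) * e) + z * (a (m0, true) * (e * e')) + 1 * z * P)); first by ring.
      rewrite e2 -[X in X * z * P]h2; ring.
    transitivity (s * (z * (a (m, false) * e) + z * (a (m, true) * (e * e')))); first by ring.
    rewrite e2; ring.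
  rewrite /solU -/s /exp3 rc0 !mulr0 expC0 !mulr1 /ot /it /srcout /srcin /incz /flip /=.
  case: eqP => [->|_]; rewrite ?mulr1n ?mulr0n.
    rewrite (negPf m0f) lenE //.
    have e1 : expC (ic R * rc (l m0) * z) = expC (wavenum z * rc (l m0)).
      by congr expC; rewrite /wavenum; ring.
    rewrite e1.
    transitivity (s * (z * a (m0, false) + z * (a (m0, true) * expC (wavenum z * rc (l m0))) + 1 * z)); first by ring.
    rewrite -h2; ring.
  case: ifPn => [_|lm']; first by ring.
  have e1 : expC (ic R * rc (l m) * z) = expC (wavenum z * rc (l m)).
    by congr expC; rewrite /wavenum; ring.
  rewrite lenE // e1; ring.
have der (p : End) : validEnd p ->
    dnu l (fun m => exp3 c1 c2 c3 (A m * c1) (B m * c2) (D m * c3)) p = s * ic R * (it p - ot p).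
  case: p => m [] /=; rewrite /validEnd /= /dnu /= => lm.
    rewrite /exp3 /A /B /D (negPf lm) /ot /it /srcout /srcin /incz (negPf lm) /flip /= lenE //.
    have e1 : expC (ic R * rc (l m) * z) = expC (wavenum z * rc (l m)).
      by congr expC; rewrite /wavenum; ring.
    rewrite e1 /c1 /c2 /c3; set e := expC (wavenum z * rc (l m)).
    have e2 : e * expC (- wavenum z * rc (l m)) = 1.
      by rewrite -expCD -expC0; congr expC; ring.
    set e' := expC (- _ * _) in e2 *.
    case: eqP => [->|_]; rewrite ?mulr1n ?mulr0n.
      set P := expC (wavenum kap * _).
      transitivity (s * ic R * (z * (a (m0, false) * e) - z * (a (m0, true) * (e * e')) + 1 * kap * P)).
        by rewrite /wavenum; ring.
      rewrite e2 -[X in X * kap * P]h2; ring.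
    transitivity (s * ic R * (z * (a (m, false) * e) - z * (a (m, true) * (e * e')))).
      by rewrite /wavenum; ring.
    rewrite e2; ring.
  rewrite /exp3 /A /B /D rc0 !mulr0 expC0 !mulr1 /ot /it /srcout /srcin /incz /flip /= /c1 /c2 /c3.
  case: eqP => [->|_]; rewrite ?mulr1n ?mulr0n.
    rewrite (negPf m0f) lenE //.
    have e1 : expC (ic R * rc (l m0) * z) = expC (wavenum z * rc (l m0)).
      by congr expC; rewrite /wavenum; ring.
    rewrite e1.
    transitivity (s * ic R * (z * (a (m0, true) * expC (wavenum z * rc (l m0))) - z * a (m0, false) - 1 * kap)).
      by rewrite /wavenum; ring.
    rewrite -h2; ring.
  case: ifPn => [_|lm']; first by rewrite /wavenum; ring.
  have e1 : expC (ic R * rc (l m) * z) = expC (wavenum z * rc (l m)).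
    by congr expC; rewrite /wavenum; ring.
  rewrite lenE // e1 /wavenum; ring.
have tot p : validEnd p -> ot p + it p = vval v0 v1 it (vertexOf v0 v1 p).
  by move=> vp; rewrite otit /scatter vp subrK.
split.
- move=> m; rewrite /edom /solU -/s -/c1 -/c2 -/c3 -/(A m) -/(B m) -/(D m).
  case: ifPn => lm.
    have Bm : B m = 0 by rewrite /B lm mulr0.
    have Dm : D m = 0.
      rewrite /D; case: eqP => [mm|_]; last by rewrite mulr0.
      by move: m0f; rewrite -mm lm.
    rewrite Bm Dm; apply: H2on_exp3_lead.
    by rewrite /c1 /wavenum ReM /= mul0r sub0r mul1r oppr_lt0.
  exact: H2on_exp3.
- move=> p q vp vq pq; apply: (mulfI zn).
  by rewrite !val // !tot // pq.
- move=> j; rewrite (eq_bigr (fun p => s * ic R * (2 * it p - vval v0 v1 it j))); last first.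
    move=> p /andP[vp /eqP pj]; rewrite der // -pj -tot //; ring.
  rewrite -mulr_sumr sumrB -mulr_sumr.
  have rcn n : (rc n%:R : C) = n%:R.
    by elim: n => [//|n IH]; rewrite -!natr1 rcD IH.
  set P := [pred q : End | validEnd q && (vertexOf v0 v1 q == j)].
  have -> : \sum_(p : End | validEnd p && (vertexOf v0 v1 p == j)) vval v0 v1 it j =
      rc #|P|%:R * vval v0 v1 it j.
    by rewrite sumr_const rcn [RHS]mulr_natl.
  rewrite /vval -/P; set X := \sum_(q | P q) it q.
  have [d0|d0] := eqVneq #|P| 0%N.
    have -> : X = 0 by rewrite /X big_pred0 // => p; move: (card0_eq d0 p); rewrite -topredE.
    by rewrite !mulr0 subrr mulr0.
  have dP : #|P|%:R != 0 :> R by rewrite pnatr_eq0.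
  have -> : rc #|P|%:R * (rc (2 / #|P|%:R) * X) = rc 2 * X.
    by rewrite mulrA [rc #|P|%:R * _]mulrC -rcM divfK.
  by rewrite (rcn 2%N) subrr mulr0.
Qed.

End ExponentialSolutions.

(** * Test functions and left null vectors *)

Section ResonanceOfZero.
Variables (R : realType) (J K M : nat) (v0 v1 : 'I_(K + M) -> 'I_J) (l len : 'I_(K + M) -> R).
Local Notation C := (Cx R).
Local Notation mu := (@lebesgue_measure R).
Local Notation seg X := [set x : R | 0 <= x <= X].
Local Notation End := ('I_(K + M) * bool)%type.
Local Notation E := 'I_(K + M).

Definition gtest (m : E) (a b : R) : E -> R -> C :=
  fun m' x => if (m' == m) && (a <= x <= b) then 1 else 0.

Lemma sqint0 (D : set R) : sqint D (fun=> 0 : C).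
Proof.
split; [exact: measurable_cst|exact: measurable_cst|].
have -> : (fun=> (sqmod (0 : C))%:E) = cst 0%:E :> (R -> \bar R).
  by apply/funext => x; rewrite /sqmod /= expr0n addr0.
by rewrite integral0 ltry.
Qed.

Lemma gtest_L2comp m a b : ~~ isLead m -> L2comp l (gtest m a b).
Proof.
move=> lm; split; last first.
  exists 0 => m' lm' x _; rewrite /gtest; case: eqP => // mm.
  by move: lm; rewrite -mm lm'.
move=> m'; rewrite /gtest; have [->|mm] := eqVneq m' m; last exact: sqint0.
rewrite /edom (negPf lm) /=; pose A := [set x : R | a <= x <= b].
have mA : borel A by exact: measurable_seg.
have mS := @measurable_seg R 0 (l m).
have AE x : (x \in A) = (a <= x <= b).
  by apply/idP/idP => [/set_mem//|h]; exact/mem_set.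
have E1 : (fun x => Re (if a <= x <= b then 1 else 0 : C)) = \1_A.
  by apply/funext => x; rewrite indicE AE; case: (a <= x <= b).
have E2 : (fun x => Im (if a <= x <= b then 1 else 0 : C)) = cst 0.
  by apply/funext => x; case: (a <= x <= b).
have sq1 : sqmod (1 : C) = 1 by rewrite sqmodE absC1 expr1n.
have sq0 : sqmod (0 : C) = 0 by rewrite sqmodE absC0 expr0n.
split; [by rewrite E1; exact: measurable_indic|by rewrite E2; exact: measurable_cst|].
have : mu.-integrable (seg (l m)) (EFin \o \1_A).
  apply: (le_integrable mS _ _ (integrable_cst_seg 0 (l m) 1)).
    by apply/measurable_EFinP; exact: measurable_indic.
  by move=> x _; rewrite /= lee_fin indicE AE; case: (a <= x <= b); rewrite ?normr1 ?normr0.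
move=> /integrableP[_]; apply: le_lt_trans; apply: ge0_le_integral => //.
- by move=> x _; rewrite lee_fin sqmod_ge0.
- apply/measurable_EFinP; rewrite (_ : (fun x => sqmod _) = \1_A) ?measurable_indic //.
  by apply/funext => x; rewrite indicE AE; case: (a <= x <= b); rewrite ?sq1 ?sq0.
- by apply: measurableT_comp => //; apply/measurable_EFinP; exact: measurable_indic.
- move=> x _; rewrite /= lee_fin indicE AE.
  by case: (a <= x <= b); rewrite ?sq1 ?sq0 ?normr1 ?normr0.
Qed.

Lemma pairing_gtest (U : E -> R -> C) m a b : ~~ isLead m -> 0 <= a -> b <= l m ->
  pairing l U (gtest m a b) = Cint [set x | a <= x <= b] (U m).
Proof.
have c0 : conjc (0 : C) = 0 by apply: cplx_eq; rewrite /= ?oppr0.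
have c1 : conjc (1 : C) = 1 by apply: cplx_eq; rewrite /= ?oppr0.
move=> lm a0 bl; rewrite /pairing (bigD1 m) //= big1 ?addr0; last first.
  move=> m' mm; rewrite (@eq_Cint _ _ _ (fun=> 0)); last first.
    by move=> x _; rewrite /gtest (negPf mm) andFb c0 mulr0.
  by apply: cplx_eq; rewrite /= /Rintegral integral0.
have H (h : R -> R) (k : R -> R) : (forall x, a <= x <= b -> k x = h x) ->
    (forall x, ~~ (a <= x <= b) -> k x = 0) ->
    Rintegral mu (edom l m) k = Rintegral mu [set x | a <= x <= b] h.
  move=> k1 k0; rewrite Rintegral_mkcond [RHS]Rintegral_mkcond; congr Rintegral; apply/funext => x.
  rewrite !patchE; have [xs|xs] := boolP (a <= x <= b).
    have m1 : x \in edom l m.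
      apply/mem_set; rewrite /edom (negPf lm) /=; case/andP: xs => h1 h2.
      by rewrite (le_trans a0) // (le_trans h2).
    have m2 : x \in [set x | a <= x <= b] by exact/mem_set.
    by rewrite m1 m2 k1.
  have m2 : (x \in [set x | a <= x <= b]) = false by apply: memNset; exact/negP.
  by rewrite m2; case: ifP => // _; rewrite k0.
apply: cplx_eq => /=; apply: H => x xs; rewrite /gtest eqxx andTb.
- by rewrite xs c1 mulr1.
- by rewrite (negPf xs) c0 mulr0.
- by rewrite xs c1 mulr1.
- by rewrite (negPf xs) c0 mulr0.
Qed.

Lemma source_L2comp (kap : C) (m0 : E) : ~~ isLead m0 ->
  L2comp l (fun m x => (m == m0)%:R * expC (wavenum kap * rc x)).
Proof.
move=> m0f; split; last first.
  exists 0 => m lm x _; case: eqP => [mm|_]; last by rewrite mul0r.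
  by move: m0f; rewrite -mm lm.
move=> m; case: eqP => [->|_].
  rewrite /edom (negPf m0f); exact: rdiff_sqint (@rdiff_expCZ R _ _).
under eq_fun do rewrite mul0r; exact: sqint0.
Qed.

Lemma scatterZ (c : C) (x : End -> C) p : scatter v0 v1 (fun q => c * x q) p = c * scatter v0 v1 x p.
Proof.
rewrite /scatter; case: (validEnd p); last by rewrite mulr0.
by rewrite /vval -mulr_sumr; ring.
Qed.

Lemma cdiff_scatter (x : C -> End -> C) z p : (forall q, cdiff (fun w => x w q) z) ->
  cdiff (fun w => scatter v0 v1 (x w) p) z.
Proof.
move=> xd; rewrite /scatter; case: (validEnd p); last exact: cdiff_cst.
apply: cdiffB => //; apply: cdiffM; first exact: cdiff_cst.
exact: cdiff_sum.
Qed.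

Definition dlt (q : End) (q' : End) : C := (q' == q)%:R.

Lemma scatter_dlt (x : End -> C) p : scatter v0 v1 x p = \sum_q scatter v0 v1 (dlt q) p * x q.
Proof.
rewrite -scatter_sum; apply: eq_scatter => q' _; rewrite /dlt.
by rewrite (bigD1 q') //= eqxx mul1r big1 ?addr0 // => q qq; rewrite eq_sym (negPf qq) mul0r.
Qed.

Lemma sum_edge (F : End -> C) (m0 : E) : (forall p, p.1 != m0 -> F p = 0) ->
  \sum_p F p = F (m0, true) + F (m0, false).
Proof.
move=> F0; have -> : \sum_p F p = \sum_m \sum_b F (m, b).
  by rewrite pair_bigA /=; apply: eq_bigr => -[].
rewrite (bigD1 m0) //= big_bool big1 ?addr0 // => m mm.
by rewrite big_bool (F0 (m, true)) // (F0 (m, false)) //= addr0.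
Qed.

(** [t] is the transpose of the vertex scattering applied to [y]. So [y] vanishes on leads and is
    determined by [t] on finite edges: to show [y = 0] it suffices to show [t = 0] there. *)
Lemma left_kernel (z : C) (y : 'rV[C]_(nE K M)) : y *m Tgraph v0 v1 len z = 0 ->
  let yf p := y 0 (enum_rank p) in
  let t q := \sum_p yf p * scatter v0 v1 (dlt q) p in
  forall q, yf q = if isLead q.1 then 0 else t (flip q) * expC (ic R * rc (len q.1) * z).
Proof.
move=> yT yf t q.
have : (y *m Tgraph v0 v1 len z) 0 (enum_rank q) = 0 by rewrite yT mxE.
rewrite mxE.
have -> : \sum_j y 0 j * Tgraph v0 v1 len z j (enum_rank q) =
   \sum_p yf p * ((p == q)%:R - scatter v0 v1 (inc0 (dlt q)) p * expC (ic R * rc (len q.1) * z)).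
  rewrite [RHS](reindex (fun i : 'I_(nE K M) => enum_val i)) /=; last first.
    by exists enum_rank => x _; [exact: enum_valK|exact: enum_rankK].
  apply: eq_bigr => i _; rewrite /yf enum_valK !mxE enum_rankK; congr (_ * (_%:R - _)).
  by congr (nat_of_bool _); apply/eqP/eqP => [->|<-]; rewrite ?enum_rankK ?enum_valK.
under eq_bigr do rewrite mulrBr.
rewrite sumrB (bigD1 q) //= eqxx mulr1 big1 ?addr0; last first.
  by move=> p pq; rewrite (negPf pq) mulr0.
move/eqP; rewrite subr_eq0 => /eqP ->.
case: ifPn => lq.
  apply: big1 => p _; rewrite (@eq_scatter _ _ _ _ v0 v1 _ (fun=> 0 * 0)); last first.
    move=> q' _; rewrite /inc0 /dlt mul0r; case: ifPn => // lq'.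
    case: eqP => // qq; move: lq'; have -> : q'.1 = q.1 by rewrite -qq.
    by rewrite lq.
  by rewrite scatterZ !mul0r mulr0.
rewrite /t mulr_suml; apply: eq_bigr => p _; rewrite mulrA; congr (_ * _ * _).
apply: eq_scatter => q' _; rewrite /inc0 /dlt.
have -> : (q' == flip q) = (flip q' == q) by rewrite -(inj_eq (inv_inj (@flipK K M))) flipK.
case: ifPn => // lq'; case: eqP => // qq.
by move: lq; rewrite -qq /= lq'.
Qed.

End ResonanceOfZero.

(** * The relation forced on a left null vector at a regular point *)

Section ResonanceRelation.
Variables (R : realType) (J K M : nat) (v0 v1 : 'I_(K + M) -> 'I_J) (l len : 'I_(K + M) -> R).
Local Notation C := (Cx R).
Local Notation End := ('I_(K + M) * bool)%type.
Local Notation E := 'I_(K + M).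

(** Pairings over two adjacent intervals determine the two amplitudes on each finite edge, up to the
    factor [Ez]. The system satisfied by these expressions, free of denominators, extends from
    [Im z > 0] to [z1]; applying [y] kills the unknowns and leaves an identity on the source
    alone. *)
Lemma resonance_relation (S : set C) (F : C -> (E -> R -> C) -> (E -> R -> C))
    (lmin kp : R) (z1 : C) (y : 'rV[C]_(nE K M)) (m0 : E) :
  0 < lmin -> (forall m, lmin <= len m) -> (forall m, ~~ isLead m -> len m = l m) ->
  (forall z : C, exists2 r : R, 0 < r & forall y, S y -> absC (y - z) < r -> y = z) ->
  (forall f g, L2comp l f -> L2comp l g -> forall z, ~ S z ->
        derivable (fun y : C => pairing l (F y f) g) z 1) ->
  (forall f, L2comp l f -> forall z : C, 0 < Im z -> ~ S z ->
        forall u, solves v0 v1 l z f u -> forall g, L2comp l g ->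
        pairing l (F z f) g = pairing l u g) ->
  ~ S z1 -> z1 != 0 -> y *m Tgraph v0 v1 len z1 = 0 -> ~~ isLead m0 ->
  let t q := \sum_p y 0 (enum_rank p) * scatter v0 v1 (@dlt R K M q) p in
  let e := expC (wavenum z1 * rc (l m0)) in
  let P := expC (wavenum (rc kp) * rc (l m0)) in
  t (m0, false) * (z1 - rc kp) * (1 - e * P) + t (m0, true) * (z1 + rc kp) * (P - e) = 0.
Proof.
move=> lmin0 lenl lenE Sd Fd Fs Sz1 z1n yT m0f t e P.
set kap : C := rc kp.
pose f (m : E) (x : R) : C := (m == m0)%:R * expC (wavenum kap * rc x).
have fcomp : L2comp l f by exact: source_L2comp.
have lfin m : ~~ isLead m -> lmin <= l m by move=> lm; rewrite -lenE.
(* [sl] is a sampling length short enough that [Ez z1 != 0]. *)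
have e10 := expR_gt0 (1 : R).
have z1p : 0 < absC z1 by rewrite absC_gt0.
pose sl := Num.min (lmin / 2) (1 / (16 * expR 1 * absC z1)).
have sl0 : 0 < sl by rewrite lt_min !divr_gt0 // !mulr_gt0.
have sl1 : sl <= lmin / 2 by rewrite ge_min lexx.
have sl2 : sl * (16 * expR 1 * absC z1) <= 1.
  by rewrite -ler_pdivlMr ?mulr_gt0 // ge_min lexx orbT.
pose q z := expC (wavenum z * rc sl).
pose qi z := expC (- wavenum z * rc sl).
have qqi z : q z * qi z = 1 by rewrite -expCD -expC0; congr expC; ring.
(* The factor left on an amplitude after eliminating the other one between the two pairings. *)
pose Ez z := (q z - qi z) * (q z - 1).
have Ez1 : Ez z1 != 0.
  (* Both factors of [Ez z1] are nonzero once [q z1] squared is not 1. If [exp w = 1] with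
     [|w| <= 1], the quadratic remainder forces [w = 0] or [1 <= 4 e |w|], while [sl] makes
     [0 < |w| <= 1/(8 e)]. *)
  have qq : q z1 * q z1 != 1.
    apply/eqP => qq.
    pose w := wavenum z1 * rc sl + wavenum z1 * rc sl.
    have ew : expC w = 1 by rewrite expCD.
    have wa : absC w = 2 * (absC z1 * sl).
      have -> : w = rc 2 * (wavenum z1 * rc sl).
        by rewrite (_ : rc 2 = 1 + 1) ?[rc 2]rcD /w //; ring.
      by rewrite /wavenum !absCM !absC_rc absC_ic mul1r !ger0_norm // ltW.
    have e1 : 1 <= expR (1 : R) by have := expR_ge1Dx (1 : R); lra.
    have wz : 0 < absC z1 * sl by rewrite mulr_gt0.
    have w16 : 16 * expR 1 * (absC z1 * sl) <= 1
      by rewrite (_ : _ * _ = sl * (16 * expR 1 * absC z1)) //; ring.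
    have w1 : absC w <= 1 by rewrite wa; nra.
    have := expC_rem2 w1; rewrite ew subrr sub0r absCN.
    have -> : 4 * expR 1 * absC w ^+ 2 = absC w * (4 * expR 1 * absC w) by ring.
    have wp : 0 < absC w by rewrite wa; lra.
    move=> hw; have : 1 <= 4 * expR 1 * absC w by rewrite -(ler_pM2l wp) mulr1.
    by rewrite wa; lra.
  have q0 : q z1 != 0 by exact: expC_neq0.
  rewrite /Ez mulf_eq0 !subr_eq0 negb_or; apply/andP; split; apply: contraNneq qq => h.
    by rewrite {1}h mulrC qqi.
  by rewrite h mulr1.
pose g1 m : E -> R -> C := gtest m 0 sl.
pose g2 m : E -> R -> C := gtest m sl (sl + sl).
pose I1 : C := Cint [set x | 0 <= x <= sl] (fun x => expC (wavenum kap * rc x)).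
pose I2 : C := Cint [set x | sl <= x <= sl + sl] (fun x => expC (wavenum kap * rc x)).
(* The prefactors clear the denominators of the solution and of the integrated exponentials, and the
   source contribution is subtracted: what remains is linear in the two amplitudes. *)
pose Q1 m z : C := (kap ^+ 2 - z ^+ 2) * wavenum z * pairing l (F z f) (g1 m) - wavenum z * (m == m0)%:R * I1.
pose Q2 m z : C := (kap ^+ 2 - z ^+ 2) * wavenum z * pairing l (F z f) (g2 m) - wavenum z * (m == m0)%:R * I2.
(* For [Im z > 0] this is [Ez z] times the true amplitude on finite edges. The value 0 on leads is
   harmless: [incz] does not read it, and [y] vanishes in those rows. *)
pose Ah z (p : End) : C := if isLead p.1 then 0 else
  if p.2 then - expC (- wavenum z * rc (l p.1)) * q z * (Q2 p.1 z - q z * Q1 p.1 z)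
  else Q2 p.1 z - qi z * Q1 p.1 z.
pose bt z p := scatter v0 v1 (srcin l z kap m0) p - srcout l z kap m0 p.
pose Phi p z := z * (Ah z p - scatter v0 v1 (incz len z (Ah z)) p) - Ez z * bt z p.
have cexp (c : C) z : cdiff (fun w => expC (wavenum w * c)) z.
  apply: cdiff_expC_comp; apply: cdiffM; last exact: cdiff_cst.
  by apply: cdiffM; [exact: cdiff_cst|exact: cdiff_id].
have cexpN (c : C) z : cdiff (fun w => expC (- wavenum w * c)) z.
  apply: cdiff_expC_comp; apply: cdiffM; last exact: cdiff_cst.
  by apply: cdiffN; apply: cdiffM; [exact: cdiff_cst|exact: cdiff_id].
have cwave z : cdiff (@wavenum R) z by apply: cdiffM; [exact: cdiff_cst|exact: cdiff_id].
have cQ m (g : E -> R -> C) (I : C) z : L2comp l g -> ~ S z ->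
   cdiff (fun z => (kap ^+ 2 - z ^+ 2) * wavenum z * pairing l (F z f) g - wavenum z * (m == m0)%:R * I) z.
  move=> gc Sz; apply: cdiffB; last first.
    by apply: cdiffM; [apply: cdiffM => //; exact: cdiff_cst|exact: cdiff_cst].
  apply: cdiffM; last by apply: derivable_cdiff; exact: Fd.
  apply: cdiffM => //; apply: cdiffB; first exact: cdiff_cst.
  by apply: cdiffX; exact: cdiff_id.
have cAh z p : ~ S z -> cdiff (fun z => Ah z p) z.
  move=> Sz; rewrite /Ah; case: p => m b /=; have [lm|lm] := boolP (isLead m); first exact: cdiff_cst.
  have c1 : cdiff (Q1 m) z by apply: cQ => //; exact: gtest_L2comp.
  have c2 : cdiff (Q2 m) z by apply: cQ => //; exact: gtest_L2comp.
  case: b.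
    apply: cdiffM; first by apply: cdiffM; [apply: cdiffN; exact: cexpN|exact: cexp].
    by apply: cdiffB => //; apply: cdiffM => //; exact: cexp.
  by apply: cdiffB => //; apply: cdiffM => //; exact: cexpN.
have cinc z p : ~ S z -> cdiff (fun z => incz len z (Ah z) p) z.
  move=> Sz; rewrite /incz; case: (isLead p.1); first exact: cdiff_cst.
  by apply: cdiffM; [exact: cdiff_expZ|exact: cAh].
have clin (c d : C) z : cdiff (fun z => c * (z + d)) z.
  by apply: cdiffM; [exact: cdiff_cst|apply: cdiffD; [exact: cdiff_id|exact: cdiff_cst]].
have cbt z p : cdiff (fun z => bt z p) z.
  apply: cdiffB.
    apply: cdiff_scatter => r; rewrite /srcin; case: (r.1 == m0); last exact: cdiff_cst.
    case: r.2; last exact: clin.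
    by apply: cdiffM; [exact: clin|exact: cdiff_cst].
  rewrite /srcout; case: (p.1 == m0); last exact: cdiff_cst.
  case: p.2; last exact: clin.
  by apply: cdiffM; [exact: clin|exact: cdiff_cst].
have cPhi p z : ~ S z -> cdiff (Phi p) z.
  move=> Sz; apply: cdiffB.
    apply: cdiffM; first exact: cdiff_id.
    apply: cdiffB; first exact: cAh.
    by apply: cdiff_scatter => r; exact: cinc.
  apply: cdiffM => //; apply: cdiffM.
    by apply: cdiffB; [exact: cexp|exact: cexpN].
  by apply: cdiffB; [exact: cexp|exact: cdiff_cst].
have Phi0 p z : ~~ isLead p.1 -> ~ S z -> 0 < Im z -> Phi p z = 0.
  move=> lp Sz z0.
  have zn : z != 0 by apply: contraTneq z0 => ->; rewrite ltxx.
  have kz : kap ^+ 2 - z ^+ 2 != 0.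
    have -> : kap ^+ 2 - z ^+ 2 = (kap - z) * (kap + z) by ring.
    rewrite mulf_eq0 negb_or; apply/andP; split.
      by apply: contraTneq z0; rewrite /kap => /eqP; rewrite subr_eq0 => /eqP <-; rewrite ltxx.
    by apply: contraTneq z0; rewrite /kap => /eqP; rewrite addrC addr_eq0 => /eqP ->; rewrite ImN /= oppr0 ltxx.
  set T := Tgraph v0 v1 len z.
  have Tu : T \in unitmx.
    rewrite unitmxE unitfE; apply: (@Tmx_det_neq0 _ _ _ _ z lmin) => //; exact: Smx_contraction.
  pose av := invmx T *m end_col (fun p => z^-1 * bt z p).
  pose a (p : End) : C := av (enum_rank p) 0.
  have aE p' : z * (a p' - scatter v0 v1 (incz len z a) p') = bt z p'.
    have : T *m end_col a = end_col (fun p => z^-1 * bt z p).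
      by rewrite /a -end_col_surj /av mulmxA mulmxV // mul1mx.
    rewrite Tgraph_mul => /colP/(_ (enum_rank p')); rewrite !mxE enum_rankK => ->.
    by rewrite mulrA mulfV // mul1r.
  have sol := @graph_solution R J K M v0 v1 l len z kap m0 a z0 kz m0f lenE aE.
  have pairE m (A B : R) : ~~ isLead m -> 0 <= A -> A <= B -> B <= l m ->
      (kap ^+ 2 - z ^+ 2) * wavenum z * pairing l (F z f) (gtest m A B) -
       wavenum z * (m == m0)%:R * Cint [set x | A <= x <= B] (fun x => expC (wavenum kap * rc x)) =
      a (m, false) * (expC (wavenum z * rc B) - expC (wavenum z * rc A)) -
      a (m, true) * expC (wavenum z * rc (l m)) * (expC (- wavenum z * rc B) - expC (- wavenum z * rc A)).
    move=> lm A0 AB Bl.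
    rewrite (Fs f fcomp z z0 Sz _ sol) ?pairing_gtest //; last exact: gtest_L2comp.
    rewrite /solU (negPf lm) Cint_exp3 // -!Cint_expC //.
    set s := (kap ^+ 2 - z ^+ 2)^-1.
    have s1 : (kap ^+ 2 - z ^+ 2) * s = 1 by rewrite mulfV.
    set X1 := Cint _ _; set X2 := Cint _ _; set X3 := Cint _ _.
    transitivity (((kap ^+ 2 - z ^+ 2) * s) * wavenum z * (a (m, false) * X1 +
      a (m, true) * expC (wavenum z * rc (l m)) * X2 + (m == m0)%:R * X3) - wavenum z * (m == m0)%:R * X3).
      by ring.
    by rewrite s1; ring.
  have AhE p' : ~~ isLead p'.1 -> Ah z p' = Ez z * a p'.
    case: p' => m b /= lm; have lml := lfin m lm.
    have q1 : Q1 m z = a (m, false) * (q z - 1) -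
        a (m, true) * expC (wavenum z * rc (l m)) * (qi z - 1).
      rewrite /Q1 /I1 /g1 pairE //; [|exact: ltW|lra].
      by rewrite rc0 !mulr0 expC0.
    have q2 : Q2 m z = a (m, false) * (q z * q z - q z) -
        a (m, true) * expC (wavenum z * rc (l m)) * (qi z * qi z - qi z).
      rewrite /Q2 /I2 /g2 pairE //; [|exact: ltW|lra|lra].
      by rewrite rcD !mulrDr !expCD.
    rewrite /Ah /= (negPf lm); case: b; rewrite q1 q2 /Ez; last by ring.
    have en : expC (- wavenum z * rc (l m)) * expC (wavenum z * rc (l m)) = 1.
      by rewrite -expCD -expC0; congr expC; ring.
    set x := expC (- wavenum z * rc (l m)) in en *; set x' := expC (wavenum z * rc (l m)) in en *.
    transitivity ((x * x') * a (m, true) * ((q z * qi z) * qi z - (q z * qi z) - (q z * qi z) * q z + q z * q z)).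
      by ring.
    rewrite en qqi.
    transitivity (a (m, true) * (q z * q z - q z - q z * qi z + qi z)); last by ring.
    by rewrite qqi; ring.
  rewrite /Phi -aE AhE //.
  have -> : scatter v0 v1 (incz len z (Ah z)) p = Ez z * scatter v0 v1 (incz len z a) p.
    rewrite -scatterZ; apply: eq_scatter => r _; rewrite /incz; case: ifPn => lr; first by rewrite mulr0.
    by rewrite AhE //; ring.
  ring.
have Phi1 p : ~~ isLead p.1 -> Phi p z1 = 0.
  move=> lp; apply: (@identity_upper R S (Phi p) Sd) => //.
  - by move=> z Sz; exact: cPhi.
  - by move=> z Sz z0; exact: Phi0.
have yk := left_kernel yT.
have y_lead p : isLead p.1 -> y 0 (enum_rank p) = 0 by move=> lp; rewrite yk lp.
have sum0 : \sum_p y 0 (enum_rank p) * Phi p z1 = 0.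
  apply: big1 => p _; have [lp|lp] := boolP (isLead p.1); first by rewrite y_lead // mul0r.
  by rewrite Phi1 // mulr0.
have yTA : \sum_p y 0 (enum_rank p) * (Ah z1 p - scatter v0 v1 (incz len z1 (Ah z1)) p) = 0.
  have : (y *m (Tgraph v0 v1 len z1 *m end_col (Ah z1))) 0 0 = 0 by rewrite mulmxA yT mul0mx mxE.
  rewrite Tgraph_mul mxE => h; rewrite -[RHS]h.
  rewrite (reindex (fun i : 'I_(nE K M) => enum_val i)) /=; last first.
    by exists enum_rank => x _; [exact: enum_valK|exact: enum_rankK].
  by apply: eq_bigr => i _; rewrite enum_valK !mxE.
have ybt : \sum_p y 0 (enum_rank p) * bt z1 p = 0.
  apply: (mulfI Ez1); rewrite mulr0.
  have : \sum_p y 0 (enum_rank p) * Phi p z1 =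
     z1 * (\sum_p y 0 (enum_rank p) * (Ah z1 p - scatter v0 v1 (incz len z1 (Ah z1)) p)) -
     Ez z1 * \sum_p y 0 (enum_rank p) * bt z1 p.
    by rewrite !mulr_sumr -sumrB; apply: eq_bigr => p _; rewrite /Phi; ring.
  by rewrite sum0 yTA mulr0 sub0r => /eqP; rewrite eq_sym oppr_eq0 => /eqP.
(* Transposition turns the incoming source terms into [t]; [left_kernel] does the same for the
   outgoing ones, so that only the two values of [t] on [m0] survive. *)
have tin : \sum_p y 0 (enum_rank p) * scatter v0 v1 (srcin l z1 kap m0) p = \sum_q t q * srcin l z1 kap m0 q.
  under eq_bigr do rewrite scatter_dlt mulr_sumr.
  rewrite exchange_big /=; apply: eq_bigr => r _; rewrite /t mulr_suml.
  by apply: eq_bigr => p _; rewrite mulrA.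
move: ybt; rewrite /bt; under eq_bigr do rewrite mulrBr.
rewrite sumrB tin (@sum_edge _ _ _ _ m0); last by move=> p pm; rewrite /srcin (negPf pm) mulr0.
rewrite (@sum_edge _ _ _ _ m0); last by move=> p pm; rewrite /srcout (negPf pm) mulr0.
rewrite /srcin /srcout /= eqxx !yk /= (negPf m0f) /flip /= -/(t _) -/(t _) lenE //.
have -> : expC (ic R * rc (l m0) * z1) = e by rewrite /e /wavenum; congr expC; ring.
rewrite -/P -/kap => h.
have h2 : rc (1 / 2 : R) != 0.
  by rewrite -absC_gt0 absC_rc ger0_norm //; lra.
apply: (mulfI h2); rewrite mulr0 -[RHS]h; ring.
Qed.

End ResonanceRelation.

(** * Nonzero zeros of the determinant are resonances *)

Section ZeroIsResonance.
Variables (R : realType) (J K M : nat) (v0 v1 : 'I_(K + M) -> 'I_J) (l len : 'I_(K + M) -> R).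
Local Notation C := (Cx R).

Lemma expC_real (k x : R) :
  expC (wavenum (rc k) * rc x) = Complex (cos (k * x)) (sin (k * x)) :> C.
Proof.
rewrite /expC; have -> : wavenum (rc k) * rc x = Complex 0 (k * x).
  by apply: cplx_eq; rewrite /wavenum !(ReM, ImM) /=; ring.
by rewrite /= expR0 !mul1r.
Qed.

Lemma sum_diff_eq0 (a b : C) : a + b = 0 -> a - b = 0 -> a = 0 /\ b = 0.
Proof.
move=> h1 h2.
have n2 : (1 + 1 : C) != 0 by rewrite (_ : 1 + 1 = 2%:R) // pnatr_eq0.
have a0 : a = 0.
  apply: (mulfI n2); rewrite mulr0; transitivity ((a + b) + (a - b)); first by ring.
  by rewrite h1 h2 addr0.
by split => //; move: h1; rewrite a0 add0r.
Qed.

(** On each finite edge the relation is used for two opposite real [kap] giving the same value [P].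
    Adding and subtracting yields factors [z1] and [k], both nonzero, so the sum and the difference
    of the two values of [t] vanish. *)
Theorem zero_is_resonance (lmin : R) (z1 : C) : 0 < lmin -> (forall m, lmin <= len m) ->
  (forall m, ~~ isLead m -> len m = l m) -> z1 != 0 ->
  \det (Tgraph v0 v1 len z1) = 0 -> isResonance v0 v1 l z1.
Proof.
move=> lmin0 lenl lenE z1n /eqP/det0P[y y0 yT] S F Sd _ Fd Fs.
apply: contrapT => Sz1.
pose t q := \sum_p y 0 (enum_rank p) * scatter v0 v1 (@dlt R K M q) p.
have yk q : y 0 (enum_rank q) = if isLead q.1 then 0 else
    t (flip q) * expC (ic R * rc (len q.1) * z1) := left_kernel yT q.
have t0 m : ~~ isLead m -> t (m, false) = 0 /\ t (m, true) = 0.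
  move=> lm; have lm0 : 0 < l m by rewrite -lenE //; exact: lt_le_trans (lenl m).
  have rel k := @resonance_relation R J K M v0 v1 l len S F lmin k z1 y m lmin0 lenl lenE Sd Fd Fs Sz1 z1n yT lm.
  move: rel; rewrite /= -/(t _) -/(t _); set e := expC (wavenum z1 * rc (l m)) => rel.
  have pi0 := pi_gt0 R.
  have n2 : (1 + 1 : C) != 0 by rewrite (_ : 1 + 1 = 2%:R) // pnatr_eq0.
  have rcn0 (k : R) : 0 < k -> (rc k : C) != 0.
    by move=> k0; rewrite -absC_gt0 absC_rc gtr0_norm.
  (* [P] must differ from [e]: for [e = 1] take [P = -1], otherwise [P = 1]. *)
  have [e1|e1] := eqVneq e 1.
    pose k := pi / l m; have k0 : 0 < k by rewrite divr_gt0.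
    have kl : k * l m = pi by rewrite divfK // gt_eqF.
    have Pk : expC (wavenum (rc k) * rc (l m)) = -1 :> C.
      by rewrite expC_real kl cospi sinpi; apply: cplx_eq; rewrite ?ReN ?ImN //= oppr0.
    have PkN : expC (wavenum (rc (- k)) * rc (l m)) = -1 :> C.
      by rewrite expC_real mulNr kl cosN sinN cospi sinpi oppr0; apply: cplx_eq; rewrite ?ReN ?ImN //= oppr0.
    have r1 := rel k; have r2 := rel (- k); rewrite Pk e1 in r1; rewrite PkN e1 rcN in r2.
    have d4 : (1 + 1 : C) * (1 + 1) != 0 by rewrite mulf_neq0.
    apply: sum_diff_eq0.
      have kn : (1 + 1) * (1 + 1) * rc k != 0 by rewrite mulf_neq0 // rcn0.
      apply: (mulfI kn); rewrite mulr0; transitivity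
        ((t (m, false) * (z1 - - rc k) * (1 - 1 * -1) + t (m, true) * (z1 + - rc k) * (-1 - 1)) -
         (t (m, false) * (z1 - rc k) * (1 - 1 * -1) + t (m, true) * (z1 + rc k) * (-1 - 1))).
        by ring.
      by rewrite r1 r2 subrr.
    have zn : (1 + 1) * (1 + 1) * z1 != 0 by rewrite mulf_neq0.
    apply: (mulfI zn); rewrite mulr0; transitivity
        ((t (m, false) * (z1 - - rc k) * (1 - 1 * -1) + t (m, true) * (z1 + - rc k) * (-1 - 1)) +
         (t (m, false) * (z1 - rc k) * (1 - 1 * -1) + t (m, true) * (z1 + rc k) * (-1 - 1))).
      by ring.
    by rewrite r1 r2 addr0.
  pose k := (pi *+ 2) / l m; have k0 : 0 < k by rewrite divr_gt0 // mulrn_wgt0.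
  have kl : k * l m = pi *+ 2 by rewrite divfK // gt_eqF.
  have Pk : expC (wavenum (rc k) * rc (l m)) = 1 :> C.
    by rewrite expC_real kl cos2pi sin2pi.
  have PkN : expC (wavenum (rc (- k)) * rc (l m)) = 1 :> C.
    by rewrite expC_real mulNr kl cosN sinN cos2pi sin2pi oppr0.
  have r1 := rel k; have r2 := rel (- k); rewrite Pk in r1; rewrite PkN rcN in r2.
  have d2 : (1 + 1 : C) * (1 - e) != 0.
    by rewrite mulf_neq0 // subr_eq0 eq_sym.
  apply: sum_diff_eq0.
    have zn : (1 + 1) * (1 - e) * z1 != 0 by rewrite mulf_neq0.
    apply: (mulfI zn); rewrite mulr0; transitivity
        ((t (m, false) * (z1 - - rc k) * (1 - e * 1) + t (m, true) * (z1 + - rc k) * (1 - e)) +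
         (t (m, false) * (z1 - rc k) * (1 - e * 1) + t (m, true) * (z1 + rc k) * (1 - e))).
      by ring.
    by rewrite r1 r2 addr0.
  have kn : (1 + 1) * (1 - e) * rc k != 0 by rewrite mulf_neq0 // rcn0.
  apply: (mulfI kn); rewrite mulr0; transitivity
        ((t (m, false) * (z1 - - rc k) * (1 - e * 1) + t (m, true) * (z1 + - rc k) * (1 - e)) -
         (t (m, false) * (z1 - rc k) * (1 - e * 1) + t (m, true) * (z1 + rc k) * (1 - e))).
    by ring.
  by rewrite r1 r2 subrr.
move/eqP : y0; apply; apply/rowP => i; rewrite mxE.
have := yk (enum_val i); rewrite enum_valK => ->.
case: (enum_val i) => m b /=; case: ifPn => // lm.
have [tf tt] := t0 m lm.
by rewrite /flip /=; case: b; rewrite ?tf ?tt mul0r.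
Qed.

End ZeroIsResonance.

(** * Uniform bounds from compactness and the final assembly *)

Lemma compact_pos_bounds (R : realType) (A : set R) : compact A -> A `<=` [set x | 0 < x] ->
  exists a b : R, [/\ 0 < a, a <= b & forall x, A x -> a <= x <= b].
Proof.
move=> cA Apos.
have [N [_ NA]] := compact_bounded cA.
have clA : closed A by apply: compact_closed => //; exact: Rhausdorff.
have : nbhs (0 : R) (~` A).
  apply: open_nbhs_nbhs; split; first exact: closed_openC.
  by move=> /Apos /=; rewrite ltxx.
move=> /nbhs_ballP[r /= r0 rA].
pose b := `|N| + 1.
exists (Num.min r b), (Num.max r b); split.
- by rewrite lt_min r0 /b ltr_wpDl.
- by rewrite ge_min le_max lexx.
- move=> x Ax; have x0 := Apos x Ax; rewrite /= in x0; apply/andP; split.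
    rewrite ge_min; apply/orP; left; rewrite leNgt; apply/negP => xr.
    by apply: (rA x) => //; rewrite /ball /= sub0r normrN gtr0_norm.
  rewrite le_max; apply/orP; right; apply: le_trans (ler_norm _) _.
  apply: NA => //; rewrite /b; apply: le_lt_trans (ler_norm _) _; lra.
Qed.

Theorem theorem2 (R : realType) (J K M : nat) (v0 v1 : 'I_(K + M) -> 'I_J)
  (hK : (1 <= K)%N)
  (hfin : forall m : 'I_(K + M), (K <= m)%N -> v0 m != v1 m)
  (Ls : set R) (hLc : compact Ls) (hLpos : Ls `<=` [set x | 0 < x])
  (I : set R) (hIc : compact I) (hIpos : I `<=` [set x | 0 < x])
  (Rr : R) (hR : 0 < Rr) (gam : R) (hgam : gam < 1) :
  exists2 eps0 : R, 0 < eps0 &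
    forall l : 'I_(K + M) -> R,
      (forall m : 'I_(K + M), (K <= m)%N -> Ls (l m)) ->
      forall (u w : 'I_(K + M) -> R -> Cx R) (lam0 eps : R),
        inDP v0 v1 l u w -> inHR Rr u -> I lam0 ->
        L2norm l u = 1 ->
        L2norm l (fun m x => - w m x - Complex (lam0 ^+ 2) 0 * u m x) = eps ->
        0 < eps -> eps < eps0 ->
        exists lam : Cx R,
          isResonance v0 v1 l lam /\ absC (lam - Complex lam0 0) < eps `^ gam.
Proof.
have [la [lb [la0 lab lL]]] := compact_pos_bounds hLc hLpos.
have [ia [ib [ia0 _ iI]]] := compact_pos_bounds hIc hIpos.
(* The bounds include 1, the dummy length given to leads in [len]. *)
pose lmin := Num.min la 1; pose lmax := Num.max lb 1.
have lmin0 : 0 < lmin by rewrite lt_min la0 ltr01.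
have lmm : lmin <= lmax by rewrite ge_min /lmax !le_max lexx !orbT.
pose Xm := Num.max lb (Rr + 1).
have Xm1 : Rr + 1 <= Xm by rewrite le_max lexx orbT.
have Xm0 : 0 < Xm by lra.
have Xp : 0 < Xm + 1 by lra.
pose N : R := (K + M)%:R * Xm; have N0 : 0 <= N by rewrite mulr_ge0 // ltW.
(* If the amplitudes and [eta] were both at most [kp], [quasi_vector] would give
   [1 <= N (4 kp)^2 = N / (N + 1)^2], which is false. *)
pose kp := 1 / (4 * (N + 1)); have kp0 : 0 < kp by rewrite divr_gt0 // mulr_gt0 //; lra.
pose C0 := (nE K M)%:R * ((Xm + 1) / ia).
have C00 : 0 <= C0 by rewrite mulr_ge0 // divr_ge0 ?(ltW ia0) //; lra.
(* For [gam <= 0] the radius [eps^gam] need not be small; with [g] the zero lies within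
   [eps^g < ia <= lam0] of [lam0], hence is not 0, as [zero_is_resonance] requires. *)
pose g := Num.max gam (1 / 2).
have g1 : g < 1 by rewrite /g gt_max hgam /=; lra.
have gh : 1 / 2 <= g by rewrite /g le_max lexx orbT.
have gg : gam <= g by rewrite /g le_max lexx.
have [e1 e10 H1] := @quasi_zero R (nE K M) lmin lmax (kp ^+ 2) C0 g lmin0 lmm
  (ltac:(by rewrite exprn_gt0)) C00 g1.
have [e2 e20 H2] := @powR_small R g ia (ltac:(lra)) ia0.
exists (Num.min 1 (Num.min (Num.min e1 e2) (kp * ia / (Xm + 1)))).
  by rewrite !lt_min ltr01 e10 e20 /=; apply: divr_gt0 => //; exact: mulr_gt0.
move=> l lLs u w lam0 eps uD uR Ilam u1 feps eps0.
rewrite !lt_min => /and3P[eps1 /andP[epse1 epse2] epsk].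
have /andP[ial _] := iI _ Ilam.
have lam00 : 0 < lam0 by exact: lt_le_trans ial.
pose len (m : 'I_(K + M)) : R := if isLead m then 1 else l m.
have lf m : ~~ isLead m -> la <= l m <= lb.
  by rewrite /isLead -leqNgt => /lLs/lL.
have lenE m : ~~ isLead m -> len m = l m by rewrite /len => /negPf ->.
have lenb m : lmin <= len m <= lmax.
  rewrite /len; case: ifPn => [_|/lf/andP[h1 h2]].
    by rewrite ge_min le_max lexx !orbT.
  by rewrite ge_min le_max h1 h2.
have lX m : ~~ isLead m -> 0 < l m <= Xm.
  move=> /lf/andP[h1 h2]; rewrite (lt_le_trans la0 h1) /=.
  by rewrite le_max h2.
have [a [aT aN]] := @quasi_vector R J K M v0 v1 l len Rr Xm lam0 eps u w
  lam00 eps0 hR Xm1 lX lenE uD uR u1 feps.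
set eta := eps * (Xm + 1) / lam0 in aT aN.
have etai : eta <= (Xm + 1) / ia * eps.
  rewrite /eta [leRHS]mulrC -mulrA ler_pM2l // ler_pM2l // lef_pV2 ?posrE //.
have eta0 : 0 <= eta by rewrite /eta divr_ge0 ?(ltW lam00) // mulr_ge0 // ltW.
have etak : eta <= kp.
  apply: le_trans etai _; move: epsk; rewrite ltr_pdivlMr // => /ltW h.
  by rewrite mulrAC ler_pdivrMr // mulrC.
have aT' : sqnorm (Tgraph v0 v1 len (rc lam0) *m end_col a) <= (C0 * eps) ^+ 2.
  apply: le_trans aT _.
  have h1 : 0 <= (nE K M)%:R * eta by apply: mulr_ge0.
  have h2 : (nE K M)%:R * eta <= C0 * eps by rewrite /C0 -[leRHS]mulrA; apply: ler_wpM2l.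
  by rewrite lerXn2r ?nnegrE // (le_trans h1).
have ac : kp ^+ 2 <= sqnorm (end_col a).
  rewrite leNgt; apply/negP => /ltW /(aN kp (ltW kp0)).
  rewrite mulrA -/N leNgt => /negP; apply.
  apply: (@le_lt_trans _ _ (N * (4 * kp) ^+ 2)).
    have k1 : 0 <= 2 * kp + 2 * eta by clear -kp0 eta0; lra.
    have k2 : 2 * kp + 2 * eta <= 4 * kp by clear -etak; lra.
    by apply: ler_wpM2l => //; rewrite lerXn2r ?nnegrE // (le_trans k1).
  have -> : 4 * kp = (N + 1)^-1 by rewrite /kp; field; rewrite gt_eqF ?ltr_wpDl.
  rewrite exprVn ltr_pdivrMr ?exprn_gt0 ?ltr_wpDl //.
  by rewrite mul1r; clear -N0; nra.
have [z [dz zl]] := H1 (Smx R v0 v1) (fun j => len (enum_val j).1) (end_col a) lam0 eps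
  (@Smx_contraction R J K M v0 v1) (fun j => lenb _) eps0 epse1 ac aT'.
exists z; split; last first.
  apply: lt_le_trans zl _; apply: ger_powR => //; rewrite eps0 /=; exact: ltW.
apply: (@zero_is_resonance R J K M v0 v1 l len lmin z lmin0 _ lenE) => //.
  by move=> m; have /andP[] := lenb m.
apply: contraTneq (H2 eps eps0 epse2) => z0; rewrite -leNgt.
apply: le_trans (ltW zl); rewrite z0 sub0r absCN absC_rc gtr0_norm //.
Qed.
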